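(* Let $A=\mathbb F_q[z]$, $\mathfrak p=(z)$, and let $E$ be the Carlitz module over $R$, i.e. the Drinfeld $A$-module of rank $1$ with $\varphi_E(z)(x)=\pi x+x^q$. Then $(\mathbf H_\delta(E),\mathfrak q_{\mathbf H_\delta(E)},\mathfrak f^* )$ is the standard $z$-isocrystal with Hodge--Pink structure of the Carlitz module: $\mathbf H_\delta(E)$ is one-dimensional over $l((z))$ with a basis vector on which $\mathfrak f^*$ acts as multiplication by $z$ (equivalently, by $\pi$ under $R\simeq l[[z]]$), and $(z-\pi)\mathfrak q_{\mathbf H_\delta(E)}=\mathfrak p_{\mathbf H_\delta(E)}$. In particular, the Galois representation $\rho_{\mathbf H_\delta(E)}$ of $\mathrm{Gal}(K^{\mathrm{sep}}/K)$ associated to $(\mathbf H_\delta(E),\mathfrak q_{\mathbf H_\delta(E)},\mathfrak f^* )$ is isomorphic to the representation on the rational Tate module $\big(\varprojlim_nE[z^n](K^{\mathrm{sep}})\big)\otimes_{\mathbb F_q[[z]]}\mathbb F_q((z))$.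
   Context: Setting. $q$ is a prime power, $A=\mathbb F_q[z]$, $\mathfrak p=(z)$, $\hat A$ the $\mathfrak p$-adic completion of $A$, $\pi$ the image of $z$ in $\hat A$. $R$ is a flat $\hat A$-algebra which is a $\mathfrak p$-adically complete discrete valuation ring, with characteristic map $\theta:A\to\hat A\to R$; $K=\mathrm{Frac}\,R$, $l$ the residue field, $R\simeq l[[z]]$, $K\simeq l((z))$ with $z$ corresponding to $\pi$. $\phi:R\to R$ is a fixed $\hat A$-algebra endomorphism with $\phi(x)\equiv x^{q}\bmod\mathfrak pR$; under $R\simeq l[[z]]$ it is $z\mapsto z$, $a\mapsto a^{q}$ for $a\in l$. $S=\mathrm{Spf}\,R$. $\hat{\mathbb G}_a$ is the $\pi$-formal additive group over $S$ with $A$-action through $\theta$. The Carlitz module $E$ is $\hat{\mathbb G}_a$ with $A$-action determined by $\varphi_E(z)(x)=\pi x+x^q$. Jet spaces. $W_n(B)$ is the ring of $\pi$-typical Witt vectors of length $n+1$ of a $\pi$-adically complete $R$-algebra $B$ (ghost components $w_i=x_0^{q^i}+\pi x_1^{q^{i-1}}+\dots+\pi^i x_i$). $J^nE(B)=E(W_n(B))$; $u:J^nE\to J^{n-1}E$ is induced by truncation, $\phi:J^nE\to J^{n-1}E$ by Witt Frobenius. $N^n:=\ker(J^nE\to E)$, with inclusion $i$. Identifying, via Verschiebung, $N^n\cong\mathbb W_{n-1}$ as group schemes ($\mathbb W_{n-1}$ = additive Witt vectors of length $n$), the lateral Frobenius $\mathfrak f:N^{n+1}\to N^n$ is the Witt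 Frobenius; it is $A$-linear, lies over $\phi$ on $S$, and $\phi\circ i\circ\mathfrak f=\phi\circ\phi\circ i$. $\mathbf X_n(E)=\mathrm{Hom}_A(J^nE,\hat{\mathbb G}_a)$, $\mathbf X(N^n)=\mathrm{Hom}_A(N^n,\hat{\mathbb G}_a)$. Pullbacks $\phi^*$, $\mathfrak f^*$ on characters are relative pullbacks and are $\phi$-semilinear. $M_\phi$ is $M$ with $R$-structure precomposed with $\phi$. $\mathbf H(E):=\varinjlim_n\mathbf X(N^n)/i^*\phi^*(\mathbf X_{n-1}(E)_\phi)$ (transition maps $u^*$) with induced $\phi$-semilinear $\mathfrak f^*$. $\mathbf X_{\mathrm{prim}}(E):=\varinjlim_n\mathbf X_n(E)/\phi^*(\mathbf X_{n-1}(E)_\phi)$ embeds in $\mathbf H(E)$ by $i^*$. $\mathbf H_\delta(E):=\mathbf H(E)\otimes_Rl((z))$. $z$-isocrystals. With $\sigma=\phi$ on $l((z))$, a $z$-isocrystal is a finite-dimensional $l((z))$-space $D$ with an isomorphism $F_D:\sigma^*D=D\otimes_{\sigma,l((z))}l((z))\to D$. A Hodge--Pink structure over $K$ is a $K[[z-\pi]]$-lattice $\mathfrak q_D\subset\sigma^*D\otimes_{l((z))}K((z-\pi))$, where $l((z))\to K[[z-\pi]]$, $z\mapsto\pi+(z-\pi)$; $\mathfrak p_D=\sigma^*D\otimes K[[z-\pi]]$. On $\mathbf H_\delta(E)$: let $e=\mathrm{ord}_z(\det\mathfrak f^* )$, let $\Theta$ be a generator of the rank one module $\mathbf X_{\mathrm{prim}}(E)$,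 and extend $i^*\Theta$ to a basis of $\mathbf H_\delta(E)$ by elements $\Psi_1,\dots,\Psi_{m-1}$ of $\mathbf H(E)$ (here $m=1$, so none are needed); $\mathfrak q_{\mathbf H_\delta(E)}$ is the $K[[z-\pi]]$-span of the Frobenius pullbacks of $(z-\pi)^{-e}i^*\Theta,\Psi_1,\dots,\Psi_{m-1}$ in $\phi^*\mathbf H_\delta(E)\otimes K((z-\pi))$. Galois representations (Genestier--Lafforgue, Hartl). Let $R[[z]]$ be the power series ring in an independent variable $z$, with $\sigma:z\mapsto z$, $b\mapsto b^{q}$ for $b\in R$. A local shtuka of rank $m$ over $R$ is a free $R[[z]]$-module $M$ of rank $m$ with an isomorphism $\tau_M:\sigma^*M[\frac1{z-\pi}]\to M[\frac1{z-\pi}]$. Its associated $z$-isocrystal with Hodge--Pink structure $\mathbb H(M)$ is $D=M\otimes_{R[[z]]}l((z))$, $F_D=\tau_M\otimes1$, $\mathfrak q_D=(\sigma^*\delta\circ\tau_M^{-1})(M\otimes_{R[[z]]}K[[z-\pi]])$. Here $R[[z,z^{-1}\}$ is the ring of series $\sum_{i\in\mathbb Z}b_iz^i$ with $b_i\in R$ and $|b_i||\pi|^{si}\to0$ as $i\to-\infty$ for all $s>0$; $t_-=\prod_{i\ge0}(1-\pi^{q^i}/z)$; and $\delta:M\otimes R[[z,z^{-1}\}[t_-^{-1}]\to D\otimes_{l((z))}R[[z,z^{-1}\}[t_-^{-1}]$ is the unique Frobenius-compatible isomorphism reducing to the identity modulo the maximal ideal of $R$. $\mathbb H$ is fully faithful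 on local shtukas up to isogeny. The rational Tate module of $M$ is the $\mathbb F_q((z))$-dual $V_z(M)$ of $\{x\in M\otimes_{R[[z]]}K^{\mathrm{sep}}[[z]]:\tau_M(\sigma^*x)=x\}\otimes_{\mathbb F_q[[z]]}\mathbb F_q((z))$, a representation of $\mathrm{Gal}(K^{\mathrm{sep}}/K)$. If $(D,\mathfrak q_D,F_D)\cong\mathbb H(M)$, the representation associated to it is $V_z(M)$; for $D=\mathbf H_\delta(E)$ it is denoted $\rho_{\mathbf H_\delta(E)}$. $E[z^n](K^{\mathrm{sep}})$ is the kernel of $\varphi_E(z^n)$ on $K^{\mathrm{sep}}$. *)

(* Defs.v *)
From HB Require Import structures.
From mathcomp Require Import all_boot all_order all_algebra.
From mathcomp Require Import generic_quotient fraction finfield separable.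
From mathcomp Require Import boolp classical_sets.
From mathcomp Require Import mpoly.

Set Implicit Arguments.
Unset Strict Implicit.
Unset Printing Implicit Defensive.

Import Order.TTheory GRing.Theory Num.Theory.

Local Open Scope ring_scope.

(* Course-of-values recursion: [cov step n] is [step] applied to the list of
   the values of [cov step] at 0, ..., n-1. *)
Section CourseOfValues.
Variables (A : Type) (step : seq A -> A).

Fixpoint cov_seq n : seq A :=
  if n is m.+1 then rcons (cov_seq m) (step (cov_seq m)) else [::].

Definition cov n : A := step (cov_seq n).

Lemma size_cov_seq n : size (cov_seq n) = n.
Proof. by elim: n => //= n IH; rewrite size_rcons IH. Qed.

Lemma nth_cov_seq x0 n i : (i < n)%N -> nth x0 (cov_seq n) i = cov i.
Proof.
elim: n => //= n IH; rewrite nth_rcons size_cov_seq ltnS leq_eqVlt.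
by case/orP=> [/eqP ->|lt_in]; rewrite ?ltnn ?eqxx // lt_in IH.
Qed.
End CourseOfValues.

(* Formal power series; MathComp has polynomials but no power series. *)
Record fps (R : Type) := Fps { pcoef : nat -> R }.

Lemma fpsP (R : Type) (f g : fps R) : (forall n, pcoef f n = pcoef g n) -> f = g.
Proof. by case: f g => [f] [g] /= /funext ->. Qed.

HB.instance Definition _ (R : Type) := gen_eqMixin (fps R).
HB.instance Definition _ (R : Type) := gen_choiceMixin (fps R).

Section FpsZmod.
Variable R : zmodType.
Definition fps_zero : fps R := Fps (fun=> 0).
Definition fps_opp (f : fps R) := Fps (fun n => - pcoef f n).
Definition fps_add (f g : fps R) := Fps (fun n => pcoef f n + pcoef g n).
Lemma fps_addA : associative fps_add.
Proof. by move=> f g h; apply: fpsP => n /=; rewrite addrA. Qed.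
Lemma fps_addC : commutative fps_add.
Proof. by move=> f g; apply: fpsP => n /=; rewrite addrC. Qed.
Lemma fps_add0 : left_id fps_zero fps_add.
Proof. by move=> f; apply: fpsP => n /=; rewrite add0r. Qed.
Lemma fps_addN : left_inverse fps_zero fps_opp fps_add.
Proof. by move=> f; apply: fpsP => n /=; rewrite addNr. Qed.
HB.instance Definition _ :=
  GRing.isZmodule.Build (fps R) fps_addA fps_addC fps_add0 fps_addN.
End FpsZmod.

Section FpsRing.
Variable R : comNzRingType.
Implicit Types f g h : fps R.

Definition fpsC (a : R) : fps R := Fps (fun n => if n == 0%N then a else 0).
Definition fpsX : fps R := Fps (fun n => (n == 1%N)%:R).
Definition fps_mul f g : fps R :=
  Fps (fun n => \sum_(i < n.+1) pcoef f i * pcoef g (n - i)).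

Let tr n f : {poly R} := \poly_(i < n.+1) pcoef f i.
Let fps_mulE n f g k : (k <= n)%N -> pcoef (fps_mul f g) k = (tr n f * tr n g)`_k.
Proof.
move=> le_kn; rewrite coefM; apply: eq_bigr => i _.
rewrite !coef_poly !ltnS (leq_trans (leq_subr _ _) le_kn).
by rewrite (leq_trans _ le_kn) // -ltnS.
Qed.
Let coef_mul_eq n (p p' r r' : {poly R}) :
  (forall k, (k <= n)%N -> p`_k = p'`_k) -> (forall k, (k <= n)%N -> r`_k = r'`_k) ->
  (p * r)`_n = (p' * r')`_n.
Proof.
move=> Ep Er; rewrite !coefM; apply: eq_bigr => i _.
by rewrite Ep ?Er ?leq_subr // -ltnS.
Qed.
Let tr_mul n f g k : (k <= n)%N -> (tr n (fps_mul f g))`_k = (tr n f * tr n g)`_k.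
Proof. by move=> le_kn; rewrite coef_poly ltnS le_kn (fps_mulE _ _ le_kn). Qed.

Lemma fps_mulA : associative fps_mul.
Proof.
move=> f g h; apply: fpsP => n; rewrite !(fps_mulE _ _ (leqnn n)).
rewrite (coef_mul_eq (p' := tr n f) (r' := tr n g * tr n h)) //; last exact: tr_mul.
by rewrite mulrA; apply: coef_mul_eq => // k le_kn; rewrite tr_mul.
Qed.
Lemma fps_mulC : commutative fps_mul.
Proof. by move=> f g; apply: fpsP => n; rewrite !(fps_mulE _ _ (leqnn n)) mulrC. Qed.
Lemma fps_mul1 : left_id (fpsC 1) fps_mul.
Proof.
move=> f; apply: fpsP => n /=; rewrite big_ord_recl /= mul1r subn0 big1 ?addr0 //.
by move=> i _; rewrite mul0r.
Qed.
Lemma fps_mulD : left_distributive fps_mul +%R.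
Proof.
move=> f g h; apply: fpsP => n /=; rewrite -big_split; apply: eq_bigr => i _ /=.
by rewrite mulrDl.
Qed.
Lemma fps_1neq0 : fpsC 1 != 0.
Proof.
apply/eqP => /(congr1 (fun f => pcoef f 0)) /= /eqP; exact/negP/oner_neq0.
Qed.
HB.instance Definition _ :=
  GRing.Zmodule_isComNzRing.Build (fps R) fps_mulA fps_mulC fps_mul1 fps_mulD fps_1neq0.

Lemma pcoefD f g n : pcoef (f + g) n = pcoef f n + pcoef g n. Proof. by []. Qed.
Lemma pcoefN f n : pcoef (- f) n = - pcoef f n. Proof. by []. Qed.
Lemma pcoef0 n : pcoef (0 : fps R) n = 0. Proof. by []. Qed.
Lemma pcoef1 n : pcoef (1 : fps R) n = (n == 0%N)%:R.
Proof. by rewrite /=; case: eqP. Qed.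
Lemma pcoefM f g n :
  pcoef (f * g) n = \sum_(i < n.+1) pcoef f i * pcoef g (n - i).
Proof. by []. Qed.
End FpsRing.

Section FpsUnit.
Variable R : idomainType.
Implicit Types f g : fps R.

Definition fps_unit : {pred fps R} := [pred f | pcoef f 0 \is a GRing.unit].

Definition fps_invstep f (s : seq R) : R :=
  (pcoef f 0)^-1 *
    ((size s == 0%N)%:R - \sum_(i < size s) pcoef f (size s - i) * s`_i).
Definition fps_inv f : fps R :=
  if f \in fps_unit then Fps (cov (fps_invstep f)) else f.

Lemma fps_mulVr : {in fps_unit, left_inverse 1 fps_inv *%R}.
Proof.
move=> f Uf; rewrite mulrC /fps_inv Uf; apply: fpsP => n.
rewrite pcoefM big_ord_recl subn0 pcoef1 /=.
rewrite {1}/cov {1}/fps_invstep size_cov_seq mulrA divrr // mul1r.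
rewrite [X in _ - X + _](_ : _ = \sum_(i < n) pcoef f (bump 0 i) *
    cov (fps_invstep f) (n - bump 0 i)).
  by rewrite subrK; case: eqP.
rewrite (reindex_inj rev_ord_inj) /=; apply: eq_bigr => i _.
have lt_in := ltn_ord i.
have lt_ni : (n - i.+1 < n)%N by rewrite ltn_subrL (leq_ltn_trans _ lt_in).
rewrite nth_cov_seq // /bump /= add1n subKn //.
Qed.
Lemma fps_unitP f g : g * f = 1 -> f \in fps_unit.
Proof.
move/(congr1 (fun f => pcoef f 0)); rewrite pcoefM big_ord1 pcoef1 /= subnn => gf1.
by apply/unitrPr; exists (pcoef g 0); rewrite mulrC.
Qed.
Lemma fps_inv_out : {in [predC fps_unit], fps_inv =1 id}.
Proof. by move=> f; rewrite inE /= /fps_inv => /negbTE ->. Qed.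
HB.instance Definition _ :=
  GRing.ComNzRing_hasMulInverse.Build (fps R) fps_mulVr fps_unitP fps_inv_out.

Lemma fps_mul_eq0 f g : f * g = 0 -> (f == 0) || (g == 0).
Proof.
move=> fg0; apply/norP => -[/eqP f0 /eqP g0].
have ex h : h <> 0 :> fps R -> exists n, pcoef h n != 0.
  by move=> h0; apply: contrapT => /forallNP hn; apply/h0/fpsP => n; have /negP/negPn/eqP := hn n.
case: (ex_minnP (ex f f0)) => i fi mi; case: (ex_minnP (ex g g0)) => j gj mj.
have /(congr1 (fun f => pcoef f (i + j))) := fg0; rewrite pcoefM pcoef0.
have lt_i : (i < (i + j).+1)%N by rewrite ltnS leq_addr.
rewrite (bigD1 (Ordinal lt_i)) //= addKn big1 ?addr0 => [/eqP|k /eqP neq_k].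
  by rewrite mulf_eq0 (negbTE fi) (negbTE gj).
have [lt_ki|le_ik] := ltnP k i.
  suff /negbNE/eqP-> : ~~ (pcoef f k != 0) by rewrite mul0r.
  by apply/negP => /mi; rewrite leqNgt lt_ki.
suff /negbNE/eqP-> : ~~ (pcoef g (i + j - k) != 0) by rewrite mulr0.
apply/negP => /mj; rewrite leqNgt => /negP[].
have lt_ik : (i < k)%N.
  by rewrite ltn_neqAle le_ik andbT; apply/eqP => e; apply/neq_k/val_inj.
by rewrite ltn_subLR ?ltn_add2r // -ltnS.
Qed.
HB.instance Definition _ := GRing.ComUnitRing_isIntegral.Build (fps R) fps_mul_eq0.
End FpsUnit.

Definition fps_map (A B : Type) (h : A -> B) (f : fps A) : fps B :=
  Fps (fun n => h (pcoef f n)).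

Section FpsMap.
Variables (A B : comNzRingType) (h : {rmorphism A -> B}).
Lemma fps_map_zmod : zmod_morphism (fps_map h).
Proof. by move=> f g; apply: fpsP => n /=; rewrite rmorphB. Qed.
Lemma fps_map_monoid : monoid_morphism (fps_map h).
Proof.
split=> [|f g]; apply: fpsP => n /=; first by case: eqP; rewrite ?rmorph1 ?rmorph0.
by rewrite rmorph_sum; apply: eq_bigr => i _; rewrite rmorphM.
Qed.
HB.instance Definition _ := GRing.isZmodMorphism.Build _ _ (fps_map h) fps_map_zmod.
HB.instance Definition _ := GRing.isMonoidMorphism.Build _ _ (fps_map h) fps_map_monoid.
End FpsMap.

Section Frob.
(* [i] only serves to know that B has characteristic dividing #|F|, so that
   x |-> x ^ #|F| is a ring morphism. *)
Variables (F : finFieldType) (B : comNzRingType) (i : {rmorphism F -> B}).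
Definition frobq (_ : {rmorphism F -> B}) (x : B) : B := x ^+ #|F|.
Lemma frobq_zmod : zmod_morphism (frobq i).
Proof.
have [p p_pr pF] := finPcharP F.
have pB : p \in [pchar B] by rewrite (rmorph_pchar i).
move=> x y; rewrite /frobq (card_pprimeChar pF).
have pN n : [pchar B].-nat (p ^ n)%N by rewrite pnatX (eq_pnat _ (pcharf_eq pB)) pnat_id.
by rewrite exprDn_pchar // exprNn_pchar.
Qed.
Lemma frobq_monoid : monoid_morphism (frobq i).
Proof. by split=> [|x y]; rewrite /frobq ?expr1n ?exprMn. Qed.
HB.instance Definition _ := GRing.isZmodMorphism.Build _ _ (frobq i) frobq_zmod.
HB.instance Definition _ := GRing.isMonoidMorphism.Build _ _ (frobq i) frobq_monoid.
End Frob.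

(* For an integral domain A, [laurent A] is Frac A[[z]]; for a field it is the
   field A((z)) of Laurent series. *)
Notation laurent A := {fraction (fps A)}.
Notation tofrac := (@FracField.tofrac _).

Section Laurent.
Variable k : fieldType.

Definition zL : laurent k := tofrac (fpsX k).

Definition fps_coefz (f : fps k) (i : int) : k :=
  if i is Posz n then pcoef f n else 0.

(* The coefficient of z^i, read off any equation x * z^n = f with f in k[[z]]. *)
Definition lcoef (x : laurent k) (i : int) : k :=
  let nf := xget (0%N, 0) [set nf : nat * fps k | x * zL ^+ nf.1 = tofrac nf.2] in
  fps_coefz nf.2 (i + nf.1%:Z).

Definition is_ordz (x : laurent k) (e : int) : Prop :=
  exists2 u : fps k, u \is a GRing.unit & x = zL ^ e * tofrac u.
End Laurent.

(* The map induced on fraction fields by an injective ring morphism h. *)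
Definition frac_map (A B : idomainType) (h : A -> B) (x : {fraction A}) : {fraction B} :=
  tofrac (h \n_(repr x)%qT) / tofrac (h \d_(repr x)%qT).

(* [X] (cut out by [inX], with addition [addX] and scalar multiplication [scX])
   is a module over the domain S; the predicate says that j : X -> U exhibits
   the Frac S - space U as the tensor product of X with Frac S, i.e. as the
   localisation of X at S \ {0}. *)
Record is_frac_tensor (S : idomainType) (X : Type) (inX : X -> Prop)
    (addX : X -> X -> X) (scX : S -> X -> X)
    (U : lmodType {fraction S}) (j : X -> U) : Prop := IsFracTensor {
  ft_add : forall x y, inX x -> inX y -> j (addX x y) = j x + j y;
  ft_scale : forall s x, inX x -> j (scX s x) = tofrac s *: j x;
  ft_eq : forall x y, inX x -> inX y ->
    (j x = j y <-> exists2 s, s != 0 & scX s x = scX s y);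
  ft_gen : forall u, exists s x, [/\ s != 0, inX x & tofrac s *: u = j x]
}.

Section Colimit.
(* The colimit of a direct system of quotients X_n / Y_n of R-modules: X_n is
   cut out by [inX n] in a type of raw elements, Y_n by [inY n], and [tr] are
   the transition maps. *)
Variables (R : pzRingType) (X : nat -> Type) (inX : forall n, X n -> Prop).
Variables (addX : forall n, X n -> X n -> X n) (scX : forall n, R -> X n -> X n).
Variables (tr : forall n, X n -> X n.+1) (inY : forall n, X n -> Prop).

Fixpoint iter_tr m n : X n -> X (m + n) :=
  if m is m'.+1 return X n -> X (m + n) then fun x => tr (iter_tr m' x) else id.

Record is_colim (M : lmodType R) (c : forall n, X n -> M) : Prop := IsColim {
  cl_add : forall n x y, inX x -> inX y -> c n (addX x y) = c n x + c n y;
  cl_scale : forall n r x, inX x -> c n (scX r x) = r *: c n x;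
  cl_tr : forall n x, inX x -> c n.+1 (tr x) = c n x;
  cl_eq0 : forall n (x : X n), inX x -> (c n x = 0 <-> exists m, inY (iter_tr m x));
  cl_gen : forall v, exists n x, inX x /\ c n x = v
}.
End Colimit.

(* F is F_q, l an extension field of F_q, R = l[[pi]] with theta(z) = pi and
   K = l((pi)): the isomorphism of R with l[[z]] is taken to be the identity, so
   that K and l((z)) are the same type. *)
Section Setting.
Variables (F : finFieldType) (l : fieldType) (iota : {rmorphism F -> l}).
Local Notation q := #|F|.
Local Notation R := (fps l).
Local Notation K := (laurent l).

Definition piR : R := fpsX l.

Definition phi : R -> R := fps_map (frobq iota).
HB.instance Definition _ := GRing.RMorphism.on phi.

Lemma phi_pi : phi piR = piR.
Proof. by apply: fpsP => n /=; rewrite rmorph_nat. Qed.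

Definition sigmaL : laurent l -> laurent l := frac_map phi.

Definition pi_complete (B : comNzRingType) (p : B) : Prop :=
  (forall x, (forall n, exists y, x = p ^+ n * y) -> x = 0) /\
  (forall a : nat -> B, (forall n, exists y, a n.+1 - a n = p ^+ n * y) ->
     exists b, forall n, exists y, b - a n = p ^+ n * y).

(* pi-adically complete R-algebras; a pi-formal scheme over S = Spf R is
   identified with its functor of points on these. *)
Record piAlg := PiAlg {
  palg :> comNzRingType;
  pstr : {rmorphism R -> palg};
  pstr_complete : pi_complete (pstr piR)
}.

Lemma twist_complete (B : piAlg) : pi_complete ((@pstr B \o phi) piR).
Proof. by rewrite /= phi_pi; exact: pstr_complete. Qed.

(* B with its structure map precomposed with phi. *)
Definition twist (B : piAlg) : piAlg :=
  @PiAlg (palg B) (@pstr B \o phi : {rmorphism R -> palg B}) (twist_complete B).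

(* The operations on pi-typical Witt vectors are given by the universal
   polynomials over F_q[pi] obtained by solving the ghost equations; in
   [{poly F}] the variable is pi. *)
Section UniversalWitt.
Variable N : nat.
Local Notation U := {mpoly {poly F}[N]}.

Definition univ_pi : U := mpolyC N 'X.

Definition ghost (x : nat -> U) (k : nat) : U :=
  \sum_(i < k.+1) univ_pi ^+ i * x i ^+ (q ^ (k - i))%N.

Definition div_pi (k : nat) (p : U) : U := map_mpoly (fun c => c %/ 'X^k) p.

(* The components c_0, c_1, ... with ghost c k = g k for all k; the divisions
   are exact for the sequences g used below. *)
Definition unghost (g : nat -> U) : nat -> U :=
  cov (fun s => let k := size s in
    div_pi k (g k - \sum_(i < k) univ_pi ^+ i * s`_i ^+ (q ^ (k - i))%N)).
End UniversalWitt.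

Definition xvar (n i : nat) : {mpoly {poly F}[n]} :=
  oapp (fun j : 'I_n => mpolyX _ (mnm1 j)) 0 (insub i).
Definition xvarl (n i : nat) : {mpoly {poly F}[n + n]} :=
  oapp (fun j : 'I_n => mpolyX _ (mnm1 (lshift n j))) 0 (insub i).
Definition xvarr (n i : nat) : {mpoly {poly F}[n + n]} :=
  oapp (fun j : 'I_n => mpolyX _ (mnm1 (rshift n j))) 0 (insub i).

Section Witt.
Variable B : piAlg.

Definition weval N (v : 'rV[B]_N) (p : {mpoly {poly F}[N]}) : B :=
  mmap (fun c : {poly F} => (map_poly (fun a => pstr B (fpsC (iota a))) c).[pstr B piR])
       (fun j => v 0 j) p.

(* 'rV[B]_n is the set of Witt vectors of length n over B, so W_n(B) of the
   usual indexing is 'rV[B]_n.+1. *)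
Definition wadd n (x y : 'rV[B]_n) : 'rV[B]_n :=
  \row_k weval (row_mx x y) (unghost (fun i => ghost (xvarl n) i + ghost (xvarr n) i) k).
Definition wmul n (x y : 'rV[B]_n) : 'rV[B]_n :=
  \row_k weval (row_mx x y) (unghost (fun i => ghost (xvarl n) i * ghost (xvarr n) i) k).

(* The image of c in A = F_q[z] (z acting as pi): all ghost components are c. *)
Definition wconst n (c : {poly F}) : 'rV[B]_n :=
  \row_k weval (0 : 'rV_0) (unghost (fun=> mpolyC 0 c) k).
Definition wpow n (x : 'rV[B]_n) (m : nat) : 'rV[B]_n := iter m (wmul x) (wconst n 1).

(* Witt Frobenius: it shifts ghost components. *)
Definition wfrob n (x : 'rV[B]_n.+1) : 'rV[B]_n :=
  \row_k weval x (unghost (fun i => ghost (xvar n.+1) i.+1) k).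
Definition wver n (y : 'rV[B]_n) : 'rV[B]_n.+1 := row_mx (0 : 'rV[B]_1) y.
Definition wtrunc n (x : 'rV[B]_n.+1) : 'rV[B]_n :=
  \row_k x 0 (widen_ord (leqnSn n) k).

(* The A-module structure of E(W) for W a ring of Witt vectors: scalars act
   through A -> W, and z acts by pi x + x^q computed in the ring W. *)
Definition jet_scale n (a : F) (x : 'rV[B]_n) : 'rV[B]_n := wmul (wconst n a%:P) x.
Definition jet_z n (x : 'rV[B]_n) : 'rV[B]_n := wadd (wmul (wconst n 'X) x) (wpow x q).

(* N^n = ker (J^n E -> E) consists of the Verschiebungs of Witt vectors of
   length n, which are used as its coordinates. *)
Definition ker_scale n (a : F) (y : 'rV[B]_n) : 'rV[B]_n :=
  rsubmx (jet_scale a (wver y) : 'rV[B]_(1 + n)).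
Definition ker_z n (y : 'rV[B]_n) : 'rV[B]_n :=
  rsubmx (jet_z (wver y) : 'rV[B]_(1 + n)).
End Witt.

(* Families of functions from the points of J^(n-1)E or of N^n, both having
   'rV[B]_n as B-points, to those of the formal additive group. *)
Definition nfun (n : nat) := forall B : piAlg, 'rV[palg B]_n -> palg B.

Definition natural n (f : nfun n) : Prop :=
  forall (B C : piAlg) (h : {rmorphism palg B -> palg C}),
    (forall r, h (pstr B r) = pstr C r) ->
    forall x, h (f B x) = f C (map_mx h x).

(* Morphisms of A-modules: A is generated by F_q and z. *)
Definition is_hom n (scale : forall B : piAlg, F -> 'rV[palg B]_n -> 'rV[palg B]_n)
    (actz : forall B : piAlg, 'rV[palg B]_n -> 'rV[palg B]_n) (f : nfun n) : Prop :=
  [/\ natural f,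
      forall B x y, f B (wadd x y) = f B x + f B y,
      forall B a x, f B (scale B a x) = pstr B (fpsC (iota a)) * f B x
    & forall B x, f B (actz B x) = pstr B piR * f B x].

(* X_n(E) and X(N^n). *)
Definition XJ n (f : nfun n.+1) : Prop := is_hom (fun B => @jet_scale B n.+1) (fun B => @jet_z B n.+1) f.
Definition XN n (f : nfun n) : Prop := is_hom (fun B => @ker_scale B n) (fun B => @ker_z B n) f.

Definition nf_add n (f g : nfun n) : nfun n := fun B x => f B x + g B x.
Definition nf_scale n (r : R) (f : nfun n) : nfun n := fun B x => pstr B r * f B x.

(* u^*, for both J and N. *)
Definition u_pull n (f : nfun n) : nfun n.+1 := fun B x => f B (wtrunc x).
(* phi^* and the lateral Frobenius pullback f^*: the Witt Frobenius lies over
   phi : S -> S, so it takes a point over B to a point over [twist B]. *)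
Definition frob_pull n (f : nfun n) : nfun n.+1 := fun B x => f (twist B) (wfrob x).
(* i^* *)
Definition i_pull n (f : nfun n.+1) : nfun n := fun B y => f B (wver y).

(* As pullback along the Frobenius is phi-semilinear and l need not be perfect,
   the images below are taken to be the R-submodules they span. *)
Definition nf_span n (S : nfun n -> Prop) (f : nfun n) : Prop :=
  exists m (r : 'I_m -> R) (g : 'I_m -> nfun n), (forall i, S (g i)) /\
    forall B x, f B x = \sum_i pstr B (r i) * g i B x.

(* phi^*(X_n(E)_phi) in X_(n+1)(E), and i^* phi^*(X_n(E)_phi) in X(N^(n+1)). *)
Definition phi_image n : nfun n.+2 -> Prop :=
  nf_span (fun f => exists2 g : nfun n.+1, XJ g & f = frob_pull g).
Definition i_phi_image n : nfun n.+1 -> Prop :=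
  nf_span (fun f => exists2 g : nfun n.+1, XJ g & f = i_pull (frob_pull g)).

(* The modules attached to E. The characters are natural transformations over
   all algebras B, hence form a large type; so X_prim(E), H(E) and H_delta(E)
   are given as modules with colimit, resp. localisation, maps, which determine
   them up to unique isomorphism. *)
Record Hdata := MkHdata {
  Hmod : lmodType R;
  Hcl : forall n, nfun n.+1 -> Hmod;
  HclP : is_colim (fun n => @XN n.+1) (fun n => @nf_add n.+1) (fun n => @nf_scale n.+1)
           (fun n => @u_pull n.+1) i_phi_image Hcl;
  Hfrob : Hmod -> Hmod;
  HfrobP : forall n (f : nfun n.+1), XN f -> Hfrob (Hcl f) = Hcl (frob_pull f);
  Xprim : lmodType R;
  Pcl : forall n, nfun n.+2 -> Xprim;
  PclP : is_colim (fun n => @XJ n.+1) (fun n => @nf_add n.+2) (fun n => @nf_scale n.+2)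
           (fun n => @u_pull n.+2) phi_image Pcl;
  Pincl : Xprim -> Hmod;
  PinclP : forall n (f : nfun n.+2), XJ f -> Pincl (Pcl f) = Hcl (i_pull f);
  Hdelta : vectType (laurent l);
  Hloc : Hmod -> Hdelta;
  HlocP : is_frac_tensor (fun=> True) +%R *:%R Hloc;
  Dfrob : Hdelta -> Hdelta;
  DfrobP : forall a x y, Dfrob (a *: x + y) = sigmaL a *: Dfrob x + Dfrob y;
  DfrobE : forall h, Dfrob (Hloc h) = Hloc (Hfrob h)
}.

(* K[[z - pi]] is fps K and K((z - pi)) is laurent K, with series variable
   t = z - pi. *)

Definition tK : laurent K := zL K.

(* g is the expansion in powers of t of sum_i b_i z^i, with z = pi + t and b_i
   in R: every coefficient converges pi-adically in K. *)
Definition is_expansion (b : int -> R) (g : fps K) : Prop :=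
  forall k m : nat, exists n0 : nat, forall n, (n0 <= n)%N -> exists r : R,
    pcoef (g - \sum_(i < n.*2.+1)
       fpsC (tofrac (b (i%:Z - n%:Z))) * (fpsC (tofrac piR) + fpsX K) ^ (i%:Z - n%:Z)) k
    = tofrac (piR ^+ m * r).
Definition expand (b : int -> R) : fps K := xget 0 (is_expansion b).

(* l((z)) -> K[[z - pi]] *)
Definition expandL (x : laurent l) : fps K := expand (fun i => fpsC (lcoef x i)).

(* [hpV] is sigma^*D over K((z - pi)), [hpPull] is d |-> d (x) 1, [hpQ] is q_D. *)
Record hpIsocrystal := HPIsocrystal {
  hpD : vectType (laurent l);
  hpF : hpD -> hpD;
  hpV : vectType (laurent K);
  hpPull : hpD -> hpV;
  hpQ : hpV -> Prop
}.

Definition lattice_span (V : vectType (laurent K)) (S : V -> Prop) (v : V) : Prop :=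
  exists m (a : 'I_m -> fps K) (w : 'I_m -> V),
    (forall i, S (w i)) /\ v = \sum_i tofrac (a i) *: w i.

Definition hpP (X : hpIsocrystal) : hpV X -> Prop :=
  lattice_span (fun w => exists d, w = @hpPull X d).

Definition hp_iso (X Y : hpIsocrystal) : Prop :=
  exists (f : {linear hpD X -> hpD Y}) (g : {linear hpV X -> hpV Y}),
    [/\ bijective f, bijective g,
        forall d, f (@hpF X d) = @hpF Y (f d),
        forall d, g (@hpPull X d) = @hpPull Y (f d)
      & forall v, @hpQ X v <-> @hpQ Y (g v)].

(* sigma^*D (x) K((z - pi)) in the coordinates of a basis of D. *)
Definition sigma_pull (D : vectType (laurent l)) (d : D) : 'rV[laurent K]_(\dim {:D}) :=
  \row_i tofrac (expandL (sigmaL (coord (vbasis {:D}) i d))).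

Definition det_frob (X : Hdata) : laurent l :=
  \det (\matrix_(i, j) coord (vbasis {:Hdelta X}) j (Dfrob (vbasis {:Hdelta X})`_i)).

(* The choices in the definition of the Hodge-Pink structure of H_delta(E). *)
Record HPchoice (X : Hdata) := MkHPchoice {
  Theta : Xprim X;
  Theta_gen : forall p : Xprim X, exists r, p = r *: Theta;
  Psi : seq (Hmod X);
  Psi_basis : basis_of {:Hdelta X}
    (Hloc (Pincl Theta) :: map (@Hloc X) Psi);
  HPord : int;
  HPordP : is_ordz (det_frob X) HPord
}.

Definition HdeltaHP (X : Hdata) (c : HPchoice X) : hpIsocrystal :=
  @HPIsocrystal (Hdelta X) (@Dfrob X) 'rV[laurent K]_(\dim {:Hdelta X})
    (@sigma_pull (Hdelta X))
    (lattice_span (fun w =>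
       w = tK ^ (- HPord c) *: sigma_pull (Hloc (Pincl (Theta c))) \/
       exists2 h, h \in Psi c & w = sigma_pull (Hloc h))).

Definition zpi : fps R := fpsX R - fpsC piR.

(* M = R[[z]]^rank (row vectors) with tau_M (sigma^* x) = sigma(x) T for the
   matrix T = (z - pi)^(- sh_pole) sh_mat over R[[z]][1/(z - pi)]; T is
   invertible over this ring. *)
Record shtuka := Shtuka {
  sh_rank : nat;
  sh_pole : nat;
  sh_mat : 'M[fps R]_sh_rank;
  sh_inv : exists n (T' : 'M[fps R]_sh_rank), sh_mat *m T' = (zpi ^+ n)%:M
}.

(* T as a matrix over a ring receiving R[[z]] in which z - pi is invertible. *)
Definition sh_tau (A : comUnitRingType) (h : fps R -> A) (M : shtuka) : 'M[A]_(sh_rank M) :=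
  (h zpi ^- sh_pole M) *: map_mx h (sh_mat M).

(* R[[z]] -> l((z)), reduction of the coefficients. *)
Definition redL (f : fps R) : laurent l := tofrac (fps_map (fun b : R => pcoef b 0) f).
(* R[[z]] -> K((z - pi)) *)
Definition expandRz (f : fps R) : laurent K :=
  tofrac (expand (fun i => if i is Posz n then pcoef f n else 0)).

(* R[[z,1/z}: a series sum_i b_i z^i with b_i = sum_j b_ij pi^j in R = l[[pi]]
   tending to 0 as i -> -oo is regrouped as sum_j (sum_i b_ij z^i) pi^j. So
   R[[z,1/z} is the subring [inBR] of the ring l((z))[[pi]], in which t_- is
   invertible; [sigmaBR] is z |-> z, b |-> b^q. *)
Notation BR := (fps (laurent l)).

Definition BRcoef (f : BR) (i : int) : R := Fps (fun j => lcoef (pcoef f j) i).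

Definition inBR (f : BR) : Prop :=
  forall s c : rat, 0 < s -> exists n0 : nat, forall n, (n0 <= n)%N ->
    forall j : nat, pcoef (BRcoef f (- n%:Z)) j != 0 -> c <= j%:R - s * n%:R.

Definition sigmaBR (f : BR) : BR :=
  Fps (fun j => if (q %| j)%N then sigmaL (pcoef f (j %/ q)) else 0).

Definition embBR (f : fps R) : BR :=
  Fps (fun j => tofrac (fps_map (fun b : R => pcoef b j) f)).

(* The factors with q^i > j do not affect the coefficient of pi^j. *)
Definition tminus : BR :=
  Fps (fun j => pcoef (\prod_(i < j.+1) (1 - fpsC (zL l)^-1 * fpsX (laurent l) ^+ (q ^ i)%N)) j).

Definition inBRloc (f : BR) : Prop := exists n, inBR (tminus ^+ n * f).

(* The matrix Delta of delta : x |-> x Delta. *)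
Record is_delta (M : shtuka) (Delta : 'M[BR]_(sh_rank M)) : Prop := IsDelta {
  delta_loc : forall i j, inBRloc (Delta i j);
  delta_iso : exists Delta' : 'M[BR]_(sh_rank M),
    (forall i j, inBRloc (Delta' i j)) /\ Delta *m Delta' = 1%:M;
  delta_frob : sh_tau embBR M *m Delta =
    map_mx sigmaBR Delta *m map_mx (@fpsC _) (sh_tau redL M);
  delta_red : map_mx (fun f : BR => pcoef f 0) Delta = 1%:M
}.

(* The value in K[[z - pi]] of an element of R[[z,1/z}[1/sigma(t_-)]. *)
Definition expandBR (f : BR) : fps K :=
  xget 0 [set g | exists n, inBR (sigmaBR tminus ^+ n * f) /\
    expand (BRcoef (sigmaBR tminus ^+ n * f)) =
    expand (BRcoef (sigmaBR tminus)) ^+ n * g].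

Definition shtukaHP (M : shtuka) (Delta : 'M[BR]_(sh_rank M)) : hpIsocrystal :=
  @HPIsocrystal 'rV[laurent l]_(sh_rank M)
    (fun x => map_mx sigmaL x *m sh_tau redL M)
    'rV[laurent K]_(sh_rank M)
    (fun x => map_mx (fun a => tofrac (expandL (sigmaL a))) x)
    (fun v => exists x : 'rV[fps K]_(sh_rank M),
       v = map_mx tofrac x *m invmx (sh_tau expandRz M)
           *m map_mx (fun f => tofrac (expandBR (sigmaBR f))) Delta).

Section Galois.
Variables (Ksep : fieldType) (jK : {rmorphism K -> Ksep}).

Definition is_sep_closure : Prop :=
  (forall x : Ksep, exists p : {poly K}, separable_poly p /\ root (map_poly jK p) x) /\
  (forall p : {poly Ksep}, separable_poly p -> (1 < size p)%N -> exists x, root p x).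

Record galAut := GalAut {
  gal_fun :> {rmorphism Ksep -> Ksep};
  gal_inv : {rmorphism Ksep -> Ksep};
  gal_funK : cancel gal_fun gal_inv;
  gal_invK : cancel gal_inv gal_fun;
  gal_fix : forall x, gal_fun (jK x) = jK x
}.

Lemma gal_inv_fix (g : galAut) x : gal_inv g (jK x) = jK x.
Proof. by rewrite -{1}(gal_fix g x) gal_funK. Qed.

Definition galV (g : galAut) : galAut :=
  GalAut (gal_invK g) (gal_funK g) (gal_inv_fix g).

(* Representations over F_q((z)). *)
Record galRep := GalRep {
  rep_sp :> vectType (laurent F);
  rep_act : galAut -> 'End(rep_sp)
}.

Definition rep_iso (V W : galRep) : Prop :=
  exists f : 'Hom(rep_sp V, rep_sp W),
    bijective f /\ forall g v, f (rep_act V g v) = rep_act W g (f v).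

Definition dual_rep (V : galRep) : galRep :=
  @GalRep 'Hom(rep_sp V, (laurent F)^o)
    (fun g => linfun (fun lam => (lam \o rep_act V (galV g))%VF)).

(* V is the tensor product with F_q((z)) of the F_q[[z]]-module cut out by
   [inX], with the Galois action induced by [gal]. *)
Definition is_rational_rep (X : Type) (inX : X -> Prop) (addX : X -> X -> X)
    (scX : fps F -> X -> X) (gal : galAut -> X -> X) (V : galRep) : Prop :=
  exists2 j : X -> rep_sp V, is_frac_tensor inX addX scX j &
    forall g x, inX x -> rep_act V g (j x) = j (gal g x).

Definition jF (a : F) : Ksep := jK (tofrac (fpsC (iota a))).
Definition jR (b : R) : Ksep := jK (tofrac b).

(* V is { x in M (x) K^sep[[z]] | tau_M (sigma^* x) = x } (x) F_q((z)). *)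
Definition is_shtuka_rep (M : shtuka) : galRep -> Prop :=
  is_rational_rep
    (fun x : 'rV[fps Ksep]_(sh_rank M) =>
       map_mx (fps_map (fun b => b ^+ q)) x *m sh_tau (fps_map jR) M = x)
    +%R (fun a x => fps_map jF a *: x) (fun g x => map_mx (fps_map g) x).

(* The representation V_z(M) for a local shtuka M with H(M) isomorphic to X. *)
Definition is_assoc_rep (X : hpIsocrystal) (V : galRep) : Prop :=
  exists M Delta, [/\ @is_delta M Delta, hp_iso X (@shtukaHP M Delta) &
    exists2 W : galRep, is_shtuka_rep M W & V = dual_rep W].

Definition carlitz (y : Ksep) : Ksep := jR piR * y + y ^+ q.

(* Compatible systems of z^n-torsion points. *)
Definition in_tate (y : nat -> Ksep) : Prop :=
  forall n, iter n carlitz (y n) = 0 /\ carlitz (y n.+1) = y n.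

(* a = sum_i a_i z^i acts on the z^n-torsion point y_n through sum_(i<n) a_i z^i. *)
Definition tate_scale (a : fps F) (y : nat -> Ksep) : nat -> Ksep :=
  fun n => \sum_(i < n) jF (pcoef a i) * iter i carlitz (y n).

Definition is_tate_rep : galRep -> Prop :=
  is_rational_rep in_tate (fun x y n => x n + y n) tate_scale (fun g y n => g (y n)).
End Galois.
End Setting.

(* Main.v *)
(* A character is determined by its values at generic points, which live over
   pi-torsion-free algebras, where Witt vectors embed in their ghost components.
   If ell denotes the logarithm of pi x + pi^(q-1) x^q and w_k the k-th ghost
   component, the characters psi_k = ell o w_k, k < n, form a basis of X(N^n); as
   Hom(E, G_a) = 0, X_n(E) has a basis theta_k with
   i^* theta_k = psi_k - pi psi_(k-1).  Since f^* psi_k = psi_(k+1) and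
   phi^* theta_k = theta_(k+1), H(E) is free of rank one on the class of psi_0,
   in which psi_k = pi^k psi_0, so that f^* acts on this class by pi, and
   X_prim(E) is generated by theta_0, which maps to psi_0.

   The Carlitz shtuka (R[[z]], z - pi), with delta given by 1 / t_-, realises this
   isocrystal and its Hodge-Pink structure.  Conversely, comparing Frobenius
   structures, any shtuka realising it has rank one with tau = u (z - pi) for a
   unit u, and Lang's trick writes u = C / sigma(C).  Its Tate module is then
   spanned by C x, where x is a unit of K^sep[[z]] with sigma(x) (z - pi) = x,
   whereas 1 / x is the generating series of a generator of the Tate module of
   the Carlitz module.  So the Galois group acts on these two lines by inverse
   characters. *)

From HB Require Import structures.
From mathcomp Require Import all_boot all_order all_algebra.
From mathcomp Require Import generic_quotient fraction finfield separable.
From mathcomp Require Import boolp classical_sets.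
From mathcomp Require Import mpoly ring zify.
Require Import Defs.

Set Implicit Arguments.
Unset Strict Implicit.
Unset Printing Implicit Defensive.

Import Order.TTheory GRing.Theory Num.Theory.
Local Open Scope ring_scope.

(** * Power series *)

(** The modules of [Hdata] are known only through their universal properties, so the computation is
    made on characters: [char_class] sends psi_k to pi^k, and lemmas on colimits of rank one carry
    the result over to any such data.

    Verschiebung multiplies ghost components by pi, so on N^n the element z acts on them by the
    conjugate pi x + pi^(q-1) x^q of the Carlitz action. Its logarithm (1/pi) log_E(pi x) has
    integral coefficients tending to 0 and converges on every pi-adically complete algebra, which
    log_E, having denominators, does not. The existence of theta_k is a divisibility: w_(k+1)(x) and
    w_k([z] x) agree modulo pi, and their difference divided by pi obeys the same conjugate action.

    Expansion in powers of z - pi is specified as a chosen pi-adic limit, which hides its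
    multiplicativity. Since l((z))[[pi]] and K[[z - pi]] are modelled by one type, it is recovered
    as the continuous extension of the substitution z = pi + t from Laurent polynomials, for the
    topology given by the total order in both variables. *)

Section FpsTheory.
Variable A : comNzRingType.
Implicit Types (f g : fps A) (a : A).

Lemma pcoefC a n : pcoef (fpsC a) n = if n == 0%N then a else 0.
Proof. by []. Qed.

Lemma pcoefX n : pcoef (fpsX A) n = (n == 1%N)%:R.
Proof. by []. Qed.

Lemma fpsC_zmod : zmod_morphism (@fpsC A).
Proof. by move=> a b; apply: fpsP => -[|n] /=; rewrite ?subr0. Qed.

Lemma pcoefCM a f n : pcoef (fpsC a * f) n = a * pcoef f n.
Proof.
rewrite pcoefM big_ord_recl /= subn0 big1 ?addr0 // => i _.
by rewrite mul0r.
Qed.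

Lemma fpsC_monoid : monoid_morphism (@fpsC A).
Proof.
split=> // a b; apply: fpsP => n; rewrite pcoefCM !pcoefC.
by case: eqP; rewrite ?mulr0.
Qed.
HB.instance Definition _ := GRing.isZmodMorphism.Build _ _ (@fpsC A) fpsC_zmod.
HB.instance Definition _ := GRing.isMonoidMorphism.Build _ _ (@fpsC A) fpsC_monoid.

Lemma pcoef_sum I r (P : pred I) (E : I -> fps A) n :
  pcoef (\sum_(i <- r | P i) E i) n = \sum_(i <- r | P i) pcoef (E i) n.
Proof. by apply: (big_morph (fun f => pcoef f n)). Qed.

Lemma pcoefXM f n :
  pcoef (fpsX A * f) n = if n is n'.+1 then pcoef f n' else 0.
Proof.
rewrite pcoefM; case: n => [|n]; first by rewrite big_ord1 pcoefX mul0r.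
rewrite !big_ord_recl /= mul0r add0r mul1r subn1 big1 ?addr0 // => i _.
by rewrite mul0r.
Qed.

Lemma pcoefXnM k f n :
  pcoef (fpsX A ^+ k * f) n = if (n < k)%N then 0 else pcoef f (n - k).
Proof.
elim: k n => [|k IH] n; first by rewrite expr0 mul1r subn0.
rewrite exprS -mulrA pcoefXM; case: n => [|n] //.
Qed.

Lemma pcoefXn k n : pcoef (fpsX A ^+ k) n = (n == k)%:R.
Proof.
rewrite -[_ ^+ k]mulr1 pcoefXnM pcoef1 subn_eq0.
by case: ltngtP.
Qed.

Lemma pcoefZXn a k n : pcoef (fpsC a * fpsX A ^+ k) n = if n == k then a else 0.
Proof. by rewrite pcoefCM pcoefXn; case: eqP; rewrite ?mulr1 ?mulr0. Qed.

Definition fps_shift k f : fps A := Fps (fun n => pcoef f (n + k)).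

Lemma fps_dvdX k f : (forall n, (n < k)%N -> pcoef f n = 0) ->
  f = fpsX A ^+ k * fps_shift k f.
Proof.
move=> f0; apply: fpsP => n; rewrite pcoefXnM.
by case: ltnP => [/f0//|le]; rewrite /= subnK.
Qed.

Lemma fpsX_regular k f g : fpsX A ^+ k * f = fpsX A ^+ k * g -> f = g.
Proof.
move=> e; apply: fpsP => n; have := congr1 (fun h => pcoef h (n + k)) e.
by rewrite !pcoefXnM ltnNge leq_addl /= addnK.
Qed.

Definition fps_trunc n f : fps A := \sum_(i < n) fpsC (pcoef f i) * fpsX A ^+ i.

Lemma pcoef_trunc n f k : pcoef (fps_trunc n f) k = if (k < n)%N then pcoef f k else 0.
Proof.
rewrite pcoef_sum; under eq_bigr do rewrite pcoefZXn.
case: ltnP => [lt_kn|le_nk].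
  rewrite (bigD1 (Ordinal lt_kn)) //= eqxx big1 ?addr0 // => i /eqP ne.
  by case: eqP => // e; case: ne; apply: val_inj.
rewrite big1 // => i _; case: eqP => // e.
by have := ltn_ord i; rewrite -e ltnNge le_nk.
Qed.

Lemma fps_split n f : f = fps_trunc n f + fpsX A ^+ n * fps_shift n f.
Proof.
apply: fpsP => k; rewrite pcoefD pcoef_trunc pcoefXnM.
by case: ltnP => [_|le]; rewrite ?addr0 // add0r /= subnK.
Qed.

Lemma fpsX_complete : pi_complete (fpsX A).
Proof.
split=> [f fX|a aX].
  apply: fpsP => n; have [g ->] := fX n.+1.
  by rewrite pcoefXnM leqnn.
have aS m n : (n <= m)%N -> forall k, (k < n)%N -> pcoef (a m) k = pcoef (a n) k.
  elim: m => [|m IH]; first by rewrite leqn0 => /eqP->.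
  rewrite leq_eqVlt ltnS => /orP[/eqP->//|le_nm] k lt_kn.
  rewrite -(IH le_nm) //; have [g eg] := aX m.
  have := congr1 (fun h => pcoef h k) eg.
  rewrite pcoefD pcoefN pcoefXnM (leq_trans lt_kn le_nm).
  by move/eqP; rewrite subr_eq0 => /eqP.
(* By [aS] the coefficient of index n is constant from [a n.+1] on, hence this diagonal. *)
exists (Fps (fun n => pcoef (a n.+1) n)) => n.
exists (fps_shift n (Fps (fun n => pcoef (a n.+1) n) - a n)).
apply: fps_dvdX => k lt_kn; rewrite pcoefD pcoefN /= (aS n k.+1) ?subrr //.
Qed.

End FpsTheory.

Lemma fps_complete (A : comNzRingType) (p : A) : pi_complete p -> pi_complete (fpsC p).
Proof.
move=> [sep lim].
have coefC n (f g : fps A) : f = fpsC p ^+ n * g -> forall k, pcoef f k = p ^+ n * pcoef g k.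
  by move=> -> k; rewrite -rmorphXn pcoefCM.
split=> [f fp|a ap].
  apply: fpsP => k; apply: sep => n; have [g eg] := fp n.
  by exists (pcoef g k); rewrite (coefC _ _ _ eg).
have ex k : exists b, forall n, exists y, b - pcoef (a n) k = p ^+ n * y.
  apply: lim => n; have [g eg] := ap n.
  by exists (pcoef g k); rewrite -(coefC _ _ _ eg).
have [b bP] := choice ex.
exists (Fps b) => n; have [y yP] := choice (fun k => bP k n).
by exists (Fps y); apply: fpsP => k; rewrite -rmorphXn pcoefCM /= -yP.
Qed.

Lemma fpsC_map (A B : comNzRingType) (h : {rmorphism A -> B}) a :
  fps_map h (fpsC a) = fpsC (h a).
Proof. by apply: fpsP => -[|n] //=; rewrite rmorph0. Qed.

Lemma fpsX_map (A B : comNzRingType) (h : {rmorphism A -> B}) :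
  fps_map h (fpsX A) = fpsX B.
Proof. by apply: fpsP => n /=; rewrite rmorph_nat. Qed.

(** * Evaluation of power series in a complete ring *)

Section FpsExt.
Variables (A B : comNzRingType).

(** Both maps agree on truncations, and the tails differ by multiples of every power of the image of
    X, which separatedness kills. *)
Lemma fps_hom_eq (g g' : {rmorphism fps A -> B}) :
  pi_complete (g (fpsX A)) -> (forall a, g (fpsC a) = g' (fpsC a)) ->
  g (fpsX A) = g' (fpsX A) -> g =1 g'.
Proof.
move=> [sep _] eC eX f; apply/eqP; rewrite -subr_eq0; apply/eqP/sep => n.
exists (g (fps_shift n f) - g' (fps_shift n f)).
rewrite {1 2}(fps_split n f) !rmorphD !rmorphM !rmorphXn eX mulrBr.
have -> : g (fps_trunc n f) = g' (fps_trunc n f).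
  rewrite !rmorph_sum; apply: eq_bigr => i _.
  by rewrite !rmorphM !rmorphXn eC eX.
by rewrite opprD addrACA subrr add0r.
Qed.

Variables (psi : {rmorphism A -> B}) (p : B) (cp : pi_complete p).

Let psum n (f : fps A) : B := \sum_(i < n) psi (pcoef f i) * p ^+ i.
Let lim (f : fps A) (b : B) := forall n, exists y, b - psum n f = p ^+ n * y.

(** Evaluation of f at X = p. The completeness proof is an argument so that the ring morphism
    structure can be attached to [fps_ext cp]. *)
Definition fps_ext (_ : pi_complete p) (f : fps A) : B := xget 0 (lim f).

Let lim_ex f : exists b, lim f b.
Proof.
apply: cp.2 => n; exists (psi (pcoef f n)).
by rewrite /psum big_ord_recr /= addrAC subrr add0r mulrC.
Qed.
Let lim_uniq f b b' : lim f b -> lim f b' -> b = b'.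
Proof.
move=> lb lb'; apply/eqP; rewrite -subr_eq0; apply/eqP/cp.1 => n.
have [[y ey] [y' ey']] := (lb n, lb' n); exists (y - y').
by rewrite mulrBr -ey -ey' opprB addrA subrK.
Qed.
Let extP f : lim f (fps_ext cp f).
Proof. by have := lim_ex f; apply: xgetPex. Qed.
Let ext_eq f b : lim f b -> fps_ext cp f = b.
Proof. by apply: lim_uniq; exact: extP. Qed.

Lemma fps_ext_zmod : zmod_morphism (fps_ext cp).
Proof.
move=> f g; apply: ext_eq => n.
have [[y ey] [y' ey']] := (extP f n, extP g n); exists (y - y').
have -> : psum n (f - g) = psum n f - psum n g.
  by rewrite /psum -sumrB; apply: eq_bigr => i _; rewrite pcoefD pcoefN rmorphB mulrBl.
by rewrite mulrBr -ey -ey'; ring.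
Qed.
Lemma fps_ext_monoid : monoid_morphism (fps_ext cp).
Proof.
split=> [|f g]; apply: ext_eq => n.
  case: n => [|n]; first by exists 1; rewrite /psum big_ord0 subr0 expr0 mulr1.
  exists 0; rewrite /psum big_ord_recl /= rmorph1 mulr1 big1 ?addr0 ?subrr ?mulr0 //.
  by move=> i _; rewrite rmorph0 mul0r.
have [[y ey] [y' ey']] := (extP f n, extP g n).
have psumE h : psum n h = (\poly_(i < n) psi (pcoef h i)).[p] by rewrite horner_poly.
(* Truncation at degree n is multiplicative modulo X^n; evaluating at p turns this into a congruence
   modulo p^n. *)
have [r er] : exists r : {poly B},
    (\poly_(i < n) psi (pcoef f i)) * (\poly_(i < n) psi (pcoef g i)) =
    (\poly_(i < n) psi (pcoef (f * g) i)) + 'X^n * r.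
  set P := \poly_(i < n) psi (pcoef f i) * \poly_(i < n) psi (pcoef g i).
  exists (drop_poly n P).
  rewrite -[LHS](poly_take_drop n) [drop_poly _ _ * _]mulrC; congr (_ + _).
  apply/polyP => i; rewrite coef_take_poly coef_poly; case: ltnP => // lt_in.
  rewrite /P coefM pcoefM rmorph_sum; apply: eq_bigr => j _.
  have lt_jn : (j < n)%N by rewrite (leq_ltn_trans _ lt_in) // -ltnS.
  rewrite !coef_poly lt_jn rmorphM (leq_ltn_trans _ lt_in) //; exact: leq_subr.
exists (r.[p] + y * psum n g + fps_ext cp f * y').
move/(congr1 (fun q => q.[p])): er; rewrite !hornerE -!psumE => er.
have -> : fps_ext cp f = psum n f + p ^+ n * y by rewrite -ey addrC subrK.
have -> : fps_ext cp g = psum n g + p ^+ n * y' by rewrite -ey' addrC subrK.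
transitivity (psum n f * psum n g - psum n (f * g) + p ^+ n *
  (y * psum n g + (psum n f + p ^+ n * y) * y')); first by ring.
by rewrite er; ring.
Qed.
HB.instance Definition _ := GRing.isZmodMorphism.Build _ _ (fps_ext cp) fps_ext_zmod.
HB.instance Definition _ := GRing.isMonoidMorphism.Build _ _ (fps_ext cp) fps_ext_monoid.

Lemma fps_extC a : fps_ext cp (fpsC a) = psi a.
Proof.
apply: ext_eq => -[|n]; first by exists (psi a); rewrite /psum big_ord0 subr0 expr0 mul1r.
exists 0; rewrite /psum big_ord_recl /= mulr1 big1 ?addr0 ?subrr ?mulr0 //.
by move=> i _; rewrite rmorph0 mul0r.
Qed.

Lemma fps_extX : fps_ext cp (fpsX A) = p.
Proof.
apply: ext_eq => -[|[|n]].
- by exists p; rewrite /psum big_ord0 subr0 expr0 mul1r.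
- by exists 1; rewrite /psum big_ord1 /= rmorph0 mul0r subr0 expr1 mulr1.
exists 0; rewrite /psum !big_ord_recl /= !rmorph0 !rmorph1 mul0r add0r mul1r expr1.
rewrite big1 ?addr0 ?subrr ?mulr0 // => i _.
by rewrite mul0r.
Qed.
End FpsExt.

(** * Witt vectors and ghost components *)

Section CharQ.
Variables (F : finFieldType).
Local Notation q := #|F|.

Lemma card_gt1 : (1 < q)%N.
Proof. exact: finNzRing_gt1. Qed.

Lemma leq_expq k : (k < q ^ k)%N.
Proof. exact: ltn_expl card_gt1. Qed.

Section Ring.
Variables (B : comNzRingType) (i : {rmorphism F -> B}).

Lemma exprq_rmorph (x y : B) :
  [/\ (x + y) ^+ q = x ^+ q + y ^+ q, (x - y) ^+ q = x ^+ q - y ^+ q,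
      0 ^+ q = 0 :> B & (- x) ^+ q = - x ^+ q].
Proof.
have eq_f z : z ^+ q = frobq i z by [].
by rewrite !eq_f rmorphD rmorphB rmorph0 rmorphN.
Qed.

Lemma exprqD k (x y : B) : (x + y) ^+ (q ^ k) = x ^+ (q ^ k) + y ^+ (q ^ k).
Proof.
elim: k x y => [|k IH] x y; first by rewrite !expr1.
by rewrite expnS !exprM; case: (exprq_rmorph x y) => -> _ _ _; rewrite IH.
Qed.
Lemma exprq0 k : 0 ^+ (q ^ k) = 0 :> B.
Proof. by rewrite expr0n expn_eq0 gtn_eqF ?andFb // ltnW ?card_gt1. Qed.
Lemma exprqN k (x : B) : (- x) ^+ (q ^ k) = - x ^+ (q ^ k).
Proof. by apply/eqP; rewrite -addr_eq0 -exprqD addNr exprq0. Qed.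
Lemma exprqB k (x y : B) : (x - y) ^+ (q ^ k) = x ^+ (q ^ k) - y ^+ (q ^ k).
Proof. by rewrite exprqD exprqN. Qed.
Lemma expf_cardX k (a : F) : a ^+ (q ^ k) = a.
Proof. by elim: k => [|k IH]; rewrite ?expr1 // expnS exprM expf_card. Qed.
End Ring.
End CharQ.

(** * Universal Witt polynomials and Dwork's criterion *)

Section Universal.
Variables (F : finFieldType) (N : nat).
Local Notation q := #|F|.
Local Notation U := {mpoly {poly F}[N]}.
Local Notation p := (univ_pi F N).

Definition univ_const : {rmorphism F -> U} := (@mpolyC N {poly F}) \o polyC.

Lemma div_piK k (u : U) : div_pi k (p ^+ k * u) = u.
Proof.
pose dv c : {poly F} := c %/ 'X^k.
have dvZ : zmod_morphism dv by move=> a b; rewrite /dv divpD divpN.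
pose dvA : {additive {poly F} -> {poly F}} :=
  HB.pack dv (GRing.isZmodMorphism.Build _ _ dv dvZ).
apply/mpolyP => m; rewrite /div_pi -[fun c => _]/(dvA : _ -> _).
rewrite mcoeff_map_mpoly /= /dv /univ_pi -rmorphXn mcoeffCM mulKp //.
by rewrite expf_neq0 // polyX_eq0.
Qed.

Definition wsum (c : nat -> U) k i := \sum_(j < i) p ^+ j * c j ^+ (q ^ (k - j)).

Lemma ghostE (c : nat -> U) k : ghost c k = wsum c k k + p ^+ k * c k.
Proof. by rewrite /ghost big_ord_recr /= subnn expr1. Qed.

Lemma eq_wsum (c c' : nat -> U) k i : (forall j, (j < i)%N -> c j = c' j) ->
  wsum c k i = wsum c' k i.
Proof. by move=> cc'; apply: eq_bigr => j _; rewrite cc'. Qed.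

Lemma unghostE (g : nat -> U) k :
  unghost g k = div_pi k (g k - wsum (unghost g) k k).
Proof.
rewrite {1}/unghost {1}/cov size_cov_seq; congr (div_pi k (g k - _)).
apply: eq_bigr => j _; congr (_ * _ ^+ _); exact: nth_cov_seq.
Qed.

Lemma unghost_eq (g c : nat -> U) :
  (forall i, ghost c i = g i) -> unghost g =1 c.
Proof.
move=> gc; move: (unghost g) (unghostE g) => u uE; elim/ltn_ind => i IH.
by rewrite uE (eq_wsum _ IH) -gc ghostE [wsum _ _ _ + _]addrC addrK div_piK.
Qed.

(** The lift of the q-power map modulo pi that Dwork's criterion needs; it may fix all of F[pi]
    because c^q = c modulo pi there. *)
Definition usigma : U -> U := mmap (@mpolyC N {poly F}) (fun j => 'X_j ^+ q).
HB.instance Definition _ := GRing.RMorphism.on usigma.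

Lemma usigmaC c : usigma c%:MP = c%:MP.
Proof. by rewrite /usigma mmapC. Qed.
Lemma usigmaX j : usigma 'X_j = 'X_j ^+ q.
Proof. by rewrite /usigma mmapX mmap1U. Qed.
Lemma usigma_pi : usigma p = p.
Proof. exact: usigmaC. Qed.

Lemma exprq_usigma (u : U) : exists d, u ^+ q = usigma u + p * d.
Proof.
have qD x y := exprq_rmorph univ_const x y.
elim/mpolyind: u => [|c m u _ _ [d du]].
  by exists 0; rewrite rmorph0 mulr0 addr0; case: (qD 0 0).
(* The constant term of c lies in F_q, so c^q - c vanishes at pi = 0. *)
have [e ce] : exists e, c ^+ q = c + 'X * e.
  have : root (c ^+ q - c) 0.
    by rewrite /root !hornerE expf_card subrr.
  move/factor_theorem => [e ce]; exists e; rewrite mulrC -['X]subr0.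
  by rewrite -[X in _ - X]/(0%:P) -ce addrC subrK.
have [f mf] : exists f, 'X_[m] ^+ q = usigma 'X_[m] + p * f.
  exists 0; rewrite mulr0 addr0 /usigma mmapX /mmap1 mpolyXE_id.
  rewrite -prodrXl; apply: eq_bigr => j _.
  by rewrite -!exprM mulnC.
exists (usigma (c *: 'X_[m]) * 0 + d + (e%:MP * usigma 'X_[m] + c%:MP * f + p * e%:MP * f)).
case: (qD (c *: 'X_[m]) u) => -> _ _ _; rewrite du.
rewrite -!mul_mpolyC exprMn mf -rmorphXn ce !rmorphD !rmorphM /= usigmaC.
by rewrite -[_ 'X]/p; ring.
Qed.

(** In characteristic p the q^m-th power is additive, so an error pi d becomes pi^(q^m) d^(q^m), and
    q^m >= m + 1. *)
Lemma exprq_usigma_iter (u : U) m : exists d,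
  (u ^+ q) ^+ (q ^ m) = usigma u ^+ (q ^ m) + p ^+ m.+1 * d.
Proof.
have [d ->] := exprq_usigma u.
rewrite (exprqD univ_const) exprMn.
exists (p ^+ (q ^ m - m.+1) * d ^+ (q ^ m)).
by rewrite mulrA -exprD subnKC // leq_expq.
Qed.

(* Dwork's criterion for g to be a sequence of ghost components. *)
Definition dwork (g : nat -> U) :=
  forall k, exists h, g k.+1 = usigma (g k) + p ^+ k.+1 * h.

Lemma wsum_usigma (c : nat -> U) k :
  exists d, wsum c k.+1 k.+1 = usigma (ghost c k) + p ^+ k.+1 * d.
Proof.
have [d dP] := choice (fun i : nat => exprq_usigma_iter (c i) (k - i)).
exists (\sum_(i < k.+1) d i).
rewrite rmorph_sum mulr_sumr -big_split; apply: eq_bigr => i _ /=.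
have le_ik : (i <= k)%N by rewrite -ltnS.
rewrite rmorphM !rmorphXn /= usigma_pi subSn // expnS exprM dP mulrDr mulrA -exprD.
by rewrite addnS subnKC.
Qed.

(** The criterion for g and [wsum_usigma] for the components already found both compare with
    [usigma (g k)] modulo pi^(k+1); so the division in the next step of [unghost] is exact. *)
Lemma dwork_ghost (g : nat -> U) : dwork g -> forall k, ghost (unghost g) k = g k.
Proof.
move=> dg; move: (unghost g) (unghostE g) => c cE; elim/ltn_ind => k IH.
suff [u eu] : exists u, g k - wsum c k k = p ^+ k * u.
  by rewrite ghostE [c k]cE eu div_piK -eu addrC subrK.
case: k IH => [|k] IH; first by exists (g 0%N); rewrite /wsum big_ord0 subr0 expr0 mul1r.
have [h ->] := dg k; rewrite -IH //; have [d ->] := wsum_usigma c k.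
by exists (h - d); rewrite mulrBr opprD addrACA subrr add0r.
Qed.

Lemma dwork_const c : dwork (fun=> c%:MP).
Proof. by move=> k; exists 0; rewrite usigmaC mulr0 addr0. Qed.

Lemma dworkM g g' : dwork g -> dwork g' -> dwork (fun k => g k * g' k).
Proof.
move=> dg dg' k; have [[h ->] [h' ->]] := (dg k, dg' k).
exists (usigma (g k) * h' + h * usigma (g' k) + p ^+ k.+1 * h * h').
by rewrite rmorphM /=; ring.
Qed.

Lemma ghostS (x : nat -> U) k : (forall i, usigma (x i) = x i ^+ q) ->
  ghost x k.+1 = usigma (ghost x k) + p ^+ k.+1 * x k.+1.
Proof.
move=> xq; rewrite /ghost big_ord_recr /= subnn expr1; congr (_ + _).
rewrite rmorph_sum; apply: eq_bigr => i _.
by rewrite rmorphM !rmorphXn /= usigma_pi xq -exprM -expnS subSn // -ltnS.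
Qed.

Lemma dwork_vars (x : nat -> U) : (forall i, usigma (x i) = x i ^+ q) -> dwork (ghost x).
Proof. by move=> xq k; exists (x k.+1); rewrite ghostS. Qed.

Lemma dwork_shift (x : nat -> U) : (forall i, usigma (x i) = x i ^+ q) ->
  dwork (fun k => ghost x k.+1).
Proof. by move=> xq k; exists (p * x k.+2); rewrite ghostS // mulrA -exprSr. Qed.

End Universal.

(** * Ghost components over pi-adically complete algebras *)

Section WittGhost.
Variables (F : finFieldType) (l : fieldType) (iota : {rmorphism F -> l}).
Local Notation q := #|F|.
Local Notation R := (fps l).
Local Notation PI B := (pstr B (piR l)).

Definition wscal (B : piAlg l) : {rmorphism F -> B} :=
  (@pstr l B) \o (@fpsC l) \o iota.

Section OneAlg.
Variable B : piAlg l.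

Lemma wbase_comm : commr_rmorph (wscal B) (PI B).
Proof. by move=> a; rewrite /GRing.comm mulrC. Qed.
Definition wbase : {rmorphism {poly F} -> B} := horner_morph wbase_comm.

Lemma wbaseC a : wbase a%:P = wscal B a.
Proof. exact: horner_morphC. Qed.
Lemma wbaseX : wbase 'X = PI B.
Proof. exact: horner_morphX. Qed.

Lemma wevalE N (v : 'rV[B]_N) p : weval iota v p = mmap wbase (fun j => v 0 j) p.
Proof. by []. Qed.

Lemma weval_zmod N (v : 'rV[B]_N) : zmod_morphism (weval iota v).
Proof. by move=> x y; rewrite !wevalE rmorphB. Qed.
Lemma weval_monoid N (v : 'rV[B]_N) : monoid_morphism (weval iota v).
Proof. by split=> [|x y]; rewrite !wevalE ?rmorph1 ?rmorphM. Qed.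
HB.instance Definition _ N (v : 'rV[B]_N) :=
  GRing.isZmodMorphism.Build _ _ (weval iota v) (weval_zmod v).
HB.instance Definition _ N (v : 'rV[B]_N) :=
  GRing.isMonoidMorphism.Build _ _ (weval iota v) (weval_monoid v).

Lemma wevalC N (v : 'rV[B]_N) c : weval iota v c%:MP = wbase c.
Proof. by rewrite wevalE mmapC. Qed.
Lemma wevalX N (v : 'rV[B]_N) j : weval iota v 'X_j = v 0 j.
Proof. by rewrite wevalE mmapX mmap1U. Qed.
Lemma weval_pi N (v : 'rV[B]_N) : weval iota v (univ_pi F N) = PI B.
Proof. by rewrite wevalC wbaseX. Qed.

(** Indexed by all naturals, with value 0 beyond the length, so that ghost sums carry no bound
    proofs. *)
Definition wcomp n (x : 'rV[B]_n) (i : nat) : B := oapp (fun j => x 0 j) 0 (insub i).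

Definition gcomp n (x : 'rV[B]_n) (k : nat) : B :=
  \sum_(i < k.+1) PI B ^+ i * wcomp x i ^+ (q ^ (k - i)).

Lemma wcomp_ord n (x : 'rV[B]_n) (i : 'I_n) : wcomp x i = x 0 i.
Proof. by rewrite /wcomp valK. Qed.
Lemma wcomp_row n (f : nat -> B) k : (k < n)%N -> wcomp (\row_(i < n) f i) k = f k.
Proof. by move=> lt_kn; rewrite /wcomp insubT /= mxE. Qed.
Lemma wcomp_out n (x : 'rV[B]_n) k : (n <= k)%N -> wcomp x k = 0.
Proof. by move=> le_nk; rewrite /wcomp insubF // ltnNge le_nk. Qed.
Lemma wcompP n (x y : 'rV[B]_n) :
  (forall k, (k < n)%N -> wcomp x k = wcomp y k) -> x = y.
Proof. by move=> xy; apply/rowP => i; rewrite -!wcomp_ord xy. Qed.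
Lemma wcompD n (x y : 'rV[B]_n) k : wcomp (x + y) k = wcomp x k + wcomp y k.
Proof. by rewrite /wcomp; case: insub => [i|] /=; rewrite ?mxE ?addr0. Qed.
Lemma wcompZ n a (x : 'rV[B]_n) k : wcomp (a *: x) k = a * wcomp x k.
Proof. by rewrite /wcomp; case: insub => [i|] /=; rewrite ?mxE ?mulr0. Qed.
Lemma wcomp_ver n (y : 'rV[B]_n) k :
  wcomp (wver y) k = if k is k'.+1 then wcomp y k' else 0.
Proof.
rewrite /wver; case: k => [|k].
  by rewrite (wcomp_ord _ (lshift n (ord0 : 'I_1))) [LHS]row_mxEl !mxE.
have [lt_kn|le_nk] := ltnP k n; last by rewrite !wcomp_out.
by rewrite (wcomp_ord _ (rshift 1 (Ordinal lt_kn))) [LHS]row_mxEr -wcomp_ord.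
Qed.
Lemma wcomp_trunc n (x : 'rV[B]_n.+1) k : (k < n)%N -> wcomp (wtrunc x) k = wcomp x k.
Proof.
move=> lt_kn; rewrite -[k]/(val (Ordinal lt_kn)) wcomp_ord mxE -wcomp_ord //.
Qed.

Lemma gcomp0 n (x : 'rV[B]_n) : gcomp x 0 = wcomp x 0.
Proof. by rewrite /gcomp big_ord1 mul1r. Qed.

Lemma gcompD n (x y : 'rV[B]_n) k : gcomp (x + y) k = gcomp x k + gcomp y k.
Proof.
rewrite /gcomp -big_split; apply: eq_bigr => i _ /=.
by rewrite wcompD (exprqD (wscal B)) mulrDr.
Qed.

Lemma gcomp_scal n (a : F) (x : 'rV[B]_n) k :
  gcomp (wscal B a *: x) k = wscal B a * gcomp x k.
Proof.
rewrite /gcomp mulr_sumr; apply: eq_bigr => i _ /=.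
by rewrite wcompZ exprMn -(rmorphXn (wscal B)) expf_cardX mulrCA.
Qed.

Lemma gcomp_ver0 n (y : 'rV[B]_n) : gcomp (wver y) 0 = 0.
Proof. by rewrite gcomp0 wcomp_ver. Qed.
Lemma gcomp_verS n (y : 'rV[B]_n) k : gcomp (wver y) k.+1 = PI B * gcomp y k.
Proof.
rewrite /gcomp big_ord_recl wcomp_ver exprq0 mulr0 add0r mulr_sumr.
apply: eq_bigr => i _.
by rewrite /= /bump add1n wcomp_ver subSS exprS mulrA.
Qed.

Lemma gcomp_trunc n (x : 'rV[B]_n.+1) k : (k < n)%N -> gcomp (wtrunc x) k = gcomp x k.
Proof.
move=> lt_kn; apply: eq_bigr => i _; rewrite wcomp_trunc //.
by rewrite (leq_ltn_trans _ lt_kn) // -ltnS.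
Qed.

Lemma gcomp_inj n (x y : 'rV[B]_n) : (forall u : B, PI B * u = 0 -> u = 0) ->
  (forall k, (k < n)%N -> gcomp x k = gcomp y k) -> x = y.
Proof.
move=> reg xy; apply: wcompP; elim/ltn_ind => k IH lt_kn.
have := xy k lt_kn; rewrite /gcomp !big_ord_recr /= subnn !expr1.
rewrite [X in X + _ = _](_ : _ =
    \sum_(i < k) PI B ^+ i * wcomp y i ^+ (q ^ (k - i))); last first.
  by apply: eq_bigr => i _; rewrite IH // (ltn_trans _ lt_kn).
move/addrI/eqP; rewrite -subr_eq0 -mulrBr => /eqP e; apply/eqP; rewrite -subr_eq0.
apply/eqP; move: e; elim: k {IH lt_kn} (_ - _) => [|m IHm] u; first by rewrite mul1r.
by rewrite exprSr -mulrA => /IHm/reg.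
Qed.

Lemma weval_xvar n (x : 'rV[B]_n) i : weval iota x (xvar F n i) = wcomp x i.
Proof.
by rewrite /xvar /wcomp; case: insub => [j|] /=; rewrite ?wevalX ?rmorph0.
Qed.
Lemma weval_xvarl n (x y : 'rV[B]_n) i : weval iota (row_mx x y) (xvarl F n i) = wcomp x i.
Proof.
by rewrite /xvarl /wcomp; case: insub => [j|] /=; rewrite ?wevalX ?rmorph0 ?row_mxEl.
Qed.
Lemma weval_xvarr n (x y : 'rV[B]_n) i : weval iota (row_mx x y) (xvarr F n i) = wcomp y i.
Proof.
by rewrite /xvarr /wcomp; case: insub => [j|] /=; rewrite ?wevalX ?rmorph0 ?row_mxEr.
Qed.

Lemma weval_ghost N (v : 'rV[B]_N) (c : nat -> {mpoly {poly F}[N]}) k :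
  weval iota v (ghost c k) =
  \sum_(i < k.+1) PI B ^+ i * weval iota v (c i) ^+ (q ^ (k - i)).
Proof.
rewrite /ghost rmorph_sum; apply: eq_bigr => i _.
by rewrite rmorphM !rmorphXn /= weval_pi.
Qed.

Lemma gcomp_weval n N (v : 'rV[B]_N) (g : nat -> {mpoly {poly F}[N]}) k :
  dwork g -> (k < n)%N ->
  gcomp (\row_(i < n) weval iota v (unghost g i)) k = weval iota v (g k).
Proof.
move=> dg lt_kn; rewrite -[in RHS](dwork_ghost dg) weval_ghost; apply: eq_bigr => i _.
by rewrite (wcomp_row (fun i => weval iota v (unghost g i))) // (leq_ltn_trans _ lt_kn) // -ltnS.
Qed.

End OneAlg.

Lemma usigma_xvar n i : usigma (xvar F n i) = xvar F n i ^+ q.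
Proof.
rewrite /xvar; case: insub => [j|] /=; first by rewrite usigmaX.
by rewrite rmorph0 expr0n gtn_eqF // ltnW ?card_gt1.
Qed.
Lemma usigma_xvarl n i : usigma (xvarl F n i) = xvarl F n i ^+ q.
Proof.
rewrite /xvarl; case: insub => [j|] /=; first by rewrite usigmaX.
by rewrite rmorph0 expr0n gtn_eqF // ltnW ?card_gt1.
Qed.
Lemma usigma_xvarr n i : usigma (xvarr F n i) = xvarr F n i ^+ q.
Proof.
rewrite /xvarr; case: insub => [j|] /=; first by rewrite usigmaX.
by rewrite rmorph0 expr0n gtn_eqF // ltnW ?card_gt1.
Qed.

Section OneAlg2.
Variable B : piAlg l.

(** In characteristic p the powers x^(q^j) are additive, so the sums of components already solve the
    ghost equations: these Witt vectors add componentwise. *)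
Lemma waddE n (x y : 'rV[B]_n) : wadd iota x y = x + y.
Proof.
apply/rowP => k; rewrite !mxE (unghost_eq (c := fun i => xvarl F n i + xvarr F n i)).
  by rewrite rmorphD /= weval_xvarl weval_xvarr !wcomp_ord.
move=> i; rewrite /ghost -big_split; apply: eq_bigr => j _ /=.
by rewrite (exprqD (univ_const F (n + n))) mulrDr.
Qed.

Lemma gcomp_mul n (x y : 'rV[B]_n) k : (k < n)%N ->
  gcomp (wmul iota x y) k = gcomp x k * gcomp y k.
Proof.
move=> lt_kn; rewrite gcomp_weval //; last first.
  by apply: dworkM; apply: dwork_vars; [apply: usigma_xvarl|apply: usigma_xvarr].
rewrite rmorphM /= !weval_ghost /gcomp; congr (_ * _); apply: eq_bigr => i _.
  by rewrite weval_xvarl.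
by rewrite weval_xvarr.
Qed.

Lemma gcomp_const n c k : (k < n)%N -> gcomp (wconst iota B n c) k = wbase B c.
Proof.
by move=> lt_kn; rewrite gcomp_weval ?wevalC //; apply: dwork_const.
Qed.

Lemma gcomp_pow n (x : 'rV[B]_n) m k : (k < n)%N ->
  gcomp (wpow iota x m) k = gcomp x k ^+ m.
Proof.
move=> lt_kn; elim: m => [|m IH]; first by rewrite gcomp_const // rmorph1.
by rewrite /wpow iterS gcomp_mul // IH exprS.
Qed.

Lemma gcomp_frob n (x : 'rV[B]_n.+1) k : (k < n)%N ->
  gcomp (wfrob iota x) k = gcomp x k.+1.
Proof.
move=> lt_kn; rewrite gcomp_weval //; last by apply: dwork_shift; apply: usigma_xvar.
by rewrite weval_ghost; apply: eq_bigr => i _; rewrite weval_xvar.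
Qed.

Lemma gcomp_jet_scale n a (x : 'rV[B]_n) k : (k < n)%N ->
  gcomp (jet_scale iota a x) k = wscal B a * gcomp x k.
Proof. by move=> lt_kn; rewrite gcomp_mul // gcomp_const // wbaseC. Qed.

Lemma gcomp_jet_z n (x : 'rV[B]_n) k : (k < n)%N ->
  gcomp (jet_z iota x) k = PI B * gcomp x k + gcomp x k ^+ q.
Proof.
move=> lt_kn; rewrite /jet_z waddE gcompD gcomp_mul // gcomp_const // wbaseX.
by rewrite gcomp_pow.
Qed.

Lemma wver_rsub n (x : 'rV[B]_(1 + n)) : wcomp x 0 = 0 -> wver (rsubmx x) = x.
Proof.
move=> x0; rewrite -[RHS](@hsubmxK _ 1 1 n x) (_ : lsubmx x = 0) //.
by apply/rowP => i; rewrite !mxE ord1 -wcomp_ord.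
Qed.

Lemma wver_ker_scale n a (y : 'rV[B]_n) :
  wver (ker_scale iota a y) = jet_scale iota a (wver y).
Proof.
by apply: wver_rsub; rewrite -gcomp0 gcomp_jet_scale // gcomp_ver0 mulr0.
Qed.

Lemma wver_ker_z n (y : 'rV[B]_n) : wver (ker_z iota y) = jet_z iota (wver y).
Proof.
apply: wver_rsub; rewrite -gcomp0 gcomp_jet_z // gcomp_ver0 mulr0 add0r.
by rewrite -[#|F|]expn1 exprq0.
Qed.

End OneAlg2.

Section Naturality.
Variables (B C : piAlg l) (h : {rmorphism B -> C}).
Hypothesis hP : forall r, h (pstr B r) = pstr C r.

Lemma wbase_nat c : h (wbase B c) = wbase C c.
Proof.
elim/poly_ind: c => [|c a IH]; first by rewrite !rmorph0.
by rewrite !(rmorphD, rmorphM) /= IH !wbaseX !wbaseC /= !hP.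
Qed.

Lemma weval_nat N (v : 'rV[B]_N) u : h (weval iota v u) = weval iota (map_mx h v) u.
Proof.
elim/mpolyind: u => [|c m u _ _ IH]; first by rewrite !rmorph0.
rewrite -mul_mpolyC !(rmorphD, rmorphM) /= IH !wevalC wbase_nat; congr (_ * _ + _).
rewrite mpolyXE_id !rmorph_prod; apply: eq_bigr => j _.
by rewrite !rmorphXn /= !wevalX mxE.
Qed.

Lemma wcomp_nat n (x : 'rV[B]_n) k : h (wcomp x k) = wcomp (map_mx h x) k.
Proof. by rewrite /wcomp; case: insub => [j|] /=; rewrite ?mxE ?rmorph0. Qed.

Lemma gcomp_nat n (x : 'rV[B]_n) k : h (gcomp x k) = gcomp (map_mx h x) k.
Proof.
rewrite rmorph_sum; apply: eq_bigr => i _.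
by rewrite rmorphM !rmorphXn /= hP wcomp_nat.
Qed.

Lemma wadd_nat n (x y : 'rV[B]_n) :
  map_mx h (wadd iota x y) = wadd iota (map_mx h x) (map_mx h y).
Proof. by rewrite !waddE map_mxD. Qed.

Lemma wmul_nat n (x y : 'rV[B]_n) :
  map_mx h (wmul iota x y) = wmul iota (map_mx h x) (map_mx h y).
Proof. by apply/rowP => k; rewrite !mxE weval_nat map_row_mx. Qed.

Lemma wconst_nat n c : map_mx h (wconst iota B n c) = wconst iota C n c.
Proof. by apply/rowP => k; rewrite !mxE weval_nat map_mx0. Qed.

Lemma wfrob_nat n (x : 'rV[B]_n.+1) : map_mx h (wfrob iota x) = wfrob iota (map_mx h x).
Proof. by apply/rowP => k; rewrite !mxE weval_nat. Qed.

Lemma wver_nat n (x : 'rV[B]_n) : map_mx h (wver x) = wver (map_mx h x).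
Proof. by apply/rowP => k; rewrite !mxE; case: split => j; rewrite !mxE ?rmorph0. Qed.

Lemma wtrunc_nat n (x : 'rV[B]_n.+1) : map_mx h (wtrunc x) = wtrunc (map_mx h x).
Proof. by apply/rowP => k; rewrite !mxE. Qed.

Lemma jet_scale_nat n a (x : 'rV[B]_n) :
  map_mx h (jet_scale iota a x) = jet_scale iota a (map_mx h x).
Proof. by rewrite wmul_nat wconst_nat. Qed.

Lemma jet_z_nat n (x : 'rV[B]_n) : map_mx h (jet_z iota x) = jet_z iota (map_mx h x).
Proof.
rewrite /jet_z wadd_nat wmul_nat wconst_nat; congr wadd.
by elim: #|F| => [|m IH] /=; rewrite ?wconst_nat // wmul_nat IH.
Qed.

Lemma ker_scale_nat n a (y : 'rV[B]_n) :
  map_mx h (ker_scale iota a y) = ker_scale iota a (map_mx h y).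
Proof. by rewrite /ker_scale -wver_nat -jet_scale_nat map_rsubmx. Qed.

Lemma ker_z_nat n (y : 'rV[B]_n) : map_mx h (ker_z iota y) = ker_z iota (map_mx h y).
Proof. by rewrite /ker_z -wver_nat -jet_z_nat map_rsubmx. Qed.
End Naturality.

Lemma twist_pi (B : piAlg l) : PI (twist iota B) = PI B.
Proof. by rewrite /= phi_pi. Qed.

Lemma twist_gcomp (B : piAlg l) n (x : 'rV[B]_n) k :
  gcomp (B := twist iota B) x k = gcomp x k.
Proof. by apply: eq_bigr => i _; rewrite twist_pi. Qed.

End WittGhost.

(** * The generic point of the line *)

Section Generic.
Variables (F : finFieldType) (l : fieldType) (iota : {rmorphism F -> l}).
Local Notation q := #|F|.
Local Notation R := (fps l).
Local Notation PI B := (pstr B (piR l)).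

Definition alg_hom (B C : piAlg l) (h : {rmorphism B -> C}) : Prop :=
  forall r, h (pstr B r) = pstr C r.

Definition pi_regular (B : piAlg l) : Prop := forall u : B, PI B * u = 0 -> u = 0.

Lemma pi_regularX (B : piAlg l) n (u v : B) : pi_regular B ->
  PI B ^+ n * u = PI B ^+ n * v -> u = v.
Proof.
move=> reg /eqP; rewrite -subr_eq0 -mulrBr => /eqP e; apply/eqP; rewrite -subr_eq0.
apply/eqP; move: e; elim: n (u - v) => [|m IHm] w; first by rewrite mul1r.
by rewrite exprSr -mulrA => /IHm/reg.
Qed.

Lemma pi_sep (B : piAlg l) (u v : B) :
  (forall n, exists y, u - v = PI B ^+ n * y) -> u = v.
Proof. by move=> uv; apply/eqP; rewrite -subr_eq0; apply/eqP/(pstr_complete B).1. Qed.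

Section GenAlg.
Variables (A : comNzRingType) (s : {rmorphism l -> A}).

Lemma gen_complete : pi_complete (fps_map s (piR l)).
Proof. by rewrite fpsX_map; apply: fpsX_complete. Qed.
(** A[[pi]], the pi-adic completion of the base change of A from l to R; it has no pi-torsion. *)
Definition gen_alg : piAlg l := @PiAlg l (fps A) (fps_map s : {rmorphism _ -> _}) gen_complete.

Lemma gen_pi : PI gen_alg = fpsX A.
Proof. exact: fpsX_map. Qed.

Lemma gen_regular : pi_regular gen_alg.
Proof.
move=> u; rewrite gen_pi => e; apply: (@fpsX_regular A 1).
by rewrite expr1 mulr0.
Qed.

Lemma gen_hom (B : piAlg l) (psi : {rmorphism A -> B}) :
  (forall a, psi (s a) = pstr B (fpsC a)) ->
  exists2 h : {rmorphism gen_alg -> B}, alg_hom h & forall a, h (fpsC a) = psi a.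
Proof.
move=> psiP; exists (fps_ext psi (pstr_complete B)) => [r|a]; last exact: fps_extC.
rewrite -[LHS]/((fps_ext psi (pstr_complete B) \o fps_map s) r); apply: fps_hom_eq.
- by rewrite /= fpsX_map fps_extX; apply: (pstr_complete B).
- by move=> a; rewrite /= fpsC_map fps_extC psiP.
- by rewrite /= fpsX_map fps_extX.
Qed.
End GenAlg.

Definition gen_row n : piAlg l := gen_alg (@mpolyC n l).
Definition gen_pt n : 'rV[gen_row n]_n := \row_j fpsC 'X_j.

(** Every point is the image of [gen_pt], so identities between natural families need only be
    checked there, where pi is regular and ghost components determine a Witt vector. *)
Lemma gen_row_pt n (B : piAlg l) (x : 'rV[B]_n) :
  exists2 h : {rmorphism gen_row n -> B}, alg_hom h & x = map_mx h (gen_pt n).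
Proof.
have [a|h hP hC] := @gen_hom _ (@mpolyC n l) B
    (mmap (@pstr l B \o @fpsC l) (fun j => x 0 j)); first by rewrite /= mmapC.
exists h => //; apply/rowP => j; rewrite !mxE hC /=.
by rewrite mmapX mmap1U.
Qed.

Definition lineA : piAlg l := gen_alg (@polyC l).
Definition lineT : lineA := fpsC 'X.

Lemma line_pt (B : piAlg l) (b : B) :
  exists2 h : {rmorphism lineA -> B}, alg_hom h & h lineT = b.
Proof.
have cb : commr_rmorph (@pstr l B \o @fpsC l) b by move=> a; rewrite /GRing.comm mulrC.
have [a|h hP hC] := @gen_hom _ (@polyC l) B (horner_morph cb).
  exact: horner_morphC.
by exists h => //; rewrite hC; apply: horner_morphX.
Qed.

(** An element of l[T][[pi]] is viewed as a series in T over R = l[[pi]]; this is its coefficient of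
    T^N. *)
Definition lcf N (G : lineA) : R := Fps (fun m => (pcoef G m)`_N).

Lemma lcfE N G m : pcoef (lcf N G) m = (pcoef G m)`_N.
Proof. by []. Qed.
Lemma lcfD N G G' : lcf N (G + G') = lcf N G + lcf N G'.
Proof. by apply: fpsP => m /=; rewrite coefD. Qed.
Lemma lcfN N G : lcf N (- G) = - lcf N G.
Proof. by apply: fpsP => m /=; rewrite coefN. Qed.
Lemma lcf_sum N I r (P : pred I) (E : I -> lineA) :
  lcf N (\sum_(i <- r | P i) E i) = \sum_(i <- r | P i) lcf N (E i).
Proof.
apply: (big_morph (lcf N)) => [x y|]; first exact: lcfD.
by apply: fpsP => m /=; rewrite coef0.
Qed.
Lemma lcfM N r G : lcf N (pstr lineA r * G) = r * lcf N G.
Proof.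
apply: fpsP => m /=; rewrite coef_sum; apply: eq_bigr => i _.
by rewrite coefCM.
Qed.
Lemma lcfX N m r : lcf N (pstr lineA r * lineT ^+ m) = if N == m then r else 0.
Proof.
rewrite lcfM; have -> : lineT ^+ m = fpsC 'X^m by rewrite -rmorphXn.
apply: fpsP => k; rewrite /lcf; case: eqP => [->|/eqP ne].
  rewrite mulrC pcoefM big_ord_recl /= subn0 coefXn eqxx mul1r big1 ?addr0 // => i _.
  by rewrite coef0 mul0r.
rewrite pcoef0 pcoefM big1 // => i _ /=; case: eqP => _.
  by rewrite coefXn (negbTE ne) mulr0.
by rewrite coef0 mulr0.
Qed.

Lemma lcf_dvd n G : (forall k, (k < n)%N -> lcf k G = 0) -> exists G', G = lineT ^+ n * G'.
Proof.
move=> G0; exists (Fps (fun m => drop_poly n (pcoef G m))).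
rewrite /lineT -rmorphXn; apply: fpsP => m; rewrite pcoefCM /=.
rewrite -[LHS](poly_take_drop n) [X in X + _](_ : _ = 0) ?add0r 1?mulrC //.
apply/polyP => k; rewrite coef_take_poly coef0; case: ltnP => // lt_kn.
by have /(congr1 (fun f => pcoef f m)) := G0 k lt_kn.
Qed.

Lemma lineT_regular n (G G' : lineA) : lineT ^+ n * G = lineT ^+ n * G' -> G = G'.
Proof.
rewrite /lineT -rmorphXn => e; apply: fpsP => m.
have := congr1 (fun f => pcoef f m) e; rewrite !pcoefCM; apply: mulfI.
by rewrite expf_neq0 // polyX_eq0.
Qed.

(** [lcf 0] is the ring morphism T = 0; precomposing it with h gives a map with the same values on
    constants, on T and on pi, so [fps_hom_eq] applies. *)
Lemma lcf0_hom (h : {rmorphism lineA -> lineA}) : alg_hom h ->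
  lcf 0 (h lineT) = 0 -> forall G, lcf 0 (h G) = lcf 0 G.
Proof.
move=> hP hT G.
pose e : {rmorphism fps {poly l} -> R} := fps_map (horner_eval 0).
have eE G' : lcf 0 G' = e G' by apply: fpsP => m /=; rewrite /horner_eval horner_coef0.
rewrite !eE; rewrite -[LHS]/((e \o h) G).
have eX : e (fpsX _) = piR l by apply: (fpsX_map (horner_eval 0)).
have ehX : (e \o h) (fpsX _) = piR l.
  by rewrite /= -(gen_pi (@polyC l)) hP gen_pi.
apply: fps_hom_eq; [by rewrite [X in pi_complete X]ehX; apply: fpsX_complete| |exact: etrans ehX (esym eX)].
move=> P; rewrite [RHS]fpsC_map -[LHS]/(e (h (fpsC P))); elim/poly_ind: P => [|P a IH].
  by rewrite !rmorph0.
rewrite !(rmorphD, rmorphM) /= {}IH /= -[fpsC 'X]/lineT.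
rewrite [X in _ * X + _](_ : _ = 0); last by have := hT; rewrite eE.
rewrite /= !mulr0 !add0r.
have -> : fpsC a%:P = pstr lineA (fpsC a) by rewrite /= fpsC_map.
rewrite hP /= fpsC_map fpsC_map.
rewrite [RHS]addrC /horner_eval !hornerE rmorph0 mulr0 addr0; congr fpsC; exact: hornerC.
Qed.

(* The n-th coefficient of the equation is (pi ^ n - pi) a_n = 0 as soon as the
   lower ones vanish. *)
Lemma line_rigid (h : {rmorphism lineA -> lineA}) w G : alg_hom h ->
  h lineT = lineT * w -> lcf 0 w = piR l -> h G = PI lineA * G ->
  lcf 1 G = 0 -> G = 0.
Proof.
move=> hP hT w0 hG G1.
have lcfT G' : lcf 0 (lineT * G') = 0.
  by apply: fpsP => m; rewrite lcfE pcoefCM coefXM.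
have hT0 : lcf 0 (h lineT) = 0 by rewrite hT lcfT.
have dvdG n : exists G', G = lineT ^+ n * G'.
  elim: n => [|n [G' eG]]; first by exists G; rewrite mul1r.
  suff G'0 : lcf 0 G' = 0.
    have [k|G'' eG'] := @lcf_dvd 1 G'; first by case: k.
    by exists G''; rewrite exprSr -mulrA -[lineT]expr1 -eG'.
  have e : w ^+ n * h G' = PI lineA * G'.
    apply: (@lineT_regular n); rewrite mulrA -exprMn -hT -rmorphXn -rmorphM -eG hG eG.
    by rewrite mulrCA.
  have lcf0M a b : lcf 0 (a * b) = lcf 0 a * lcf 0 b.
    have eE G0 : lcf 0 G0 = fps_map (horner_eval 0) G0.
      by apply: fpsP => m /=; rewrite /horner_eval horner_coef0.
    by rewrite !eE; apply: rmorphM.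
  have lcf0X a k : lcf 0 (a ^+ k) = lcf 0 a ^+ k.
    elim: k => [|k IH]; last by rewrite !exprS lcf0M IH.
    by apply: fpsP => -[|m]; rewrite /= ?coef1 ?coef0.
  have := congr1 (lcf 0) e; rewrite lcf0M lcf0X w0 lcf0_hom // lcfM.
  (* For n = 1 the factor pi^n - pi vanishes, and the assumption on [lcf 1 G] supplies the
     coefficient instead. *)
  have [n1 _|n1] := eqVneq n 1%N.
    rewrite -G1 eG n1; apply: fpsP => m.
    by rewrite !lcfE expr1 pcoefCM coefXM.
  move/eqP; rewrite -subr_eq0 -mulrBl mulf_eq0 => /orP[|/eqP//].
  rewrite subr_eq0 => /eqP/(congr1 (fun f => pcoef f 1%N))/eqP.
  by rewrite pcoefXn pcoefX eqxx [(1 == n)%N]eq_sym (negbTE n1) eq_sym oner_eq0.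
apply: fpsP => m; apply/polyP => k; have [G' ->] := dvdG k.+1.
by rewrite /lineT -rmorphXn pcoefCM coefXnM ltnSn coef0.
Qed.
End Generic.

(** * Characters of N^n and of J^n E *)

Section CarlitzLog.
Variables (F : finFieldType) (l : fieldType) (iota : {rmorphism F -> l}).
Local Notation q := #|F|.
Local Notation R := (fps l).
Local Notation PI B := (pstr B (piR l)).
Local Notation p := (piR l).

Lemma leq_predq i : (i <= q.-1 * q ^ i)%N.
Proof.
apply: leq_trans (ltnW (leq_expq F i)) _; rewrite leq_pmull // -subn1 subn_gt0.
exact: card_gt1.
Qed.

(* Coefficients of the logarithm of the formal module pi x + pi ^ (q-1) x ^ q,
   i.e. of (1 / pi) log_E (pi x). *)
Fixpoint log_coef (i : nat) : R :=
  if i is j.+1 then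
    log_coef j * p ^+ (q.-1 * q ^ j).-1 / (1 - p ^+ (q ^ j.+1).-1)
  else 1.

Lemma sub1X_unit k : (0 < k)%N -> 1 - p ^+ k \is a GRing.unit.
Proof.
move=> k0; rewrite -[_ \is a _]/(pcoef (1 - p ^+ k) 0 \is a GRing.unit).
by rewrite pcoefD pcoefN pcoef1 pcoefXn (ltn_eqF k0) subr0 unitr1.
Qed.

Lemma pred_expq_gt0 i : (0 < (q ^ i.+1).-1)%N.
Proof.
rewrite -subn1 subn_gt0; apply: leq_trans (card_gt1 F) _.
by rewrite -[X in (X <= _)%N]expn1 leq_exp2l // card_gt1.
Qed.

(** The coefficient of x^(q^(i+1)) in ell(pi x + pi^(q-1) x^q) = pi ell(x). *)
Lemma log_coefS i : log_coef i.+1 * (p - p ^+ (q ^ i.+1)) =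
  log_coef i * p ^+ (q.-1 * q ^ i).
Proof.
have U := sub1X_unit (pred_expq_gt0 i).
have e0 : (0 < q.-1 * q ^ i)%N.
  rewrite muln_gt0 expn_gt0 (ltnW (card_gt1 F)) andbT.
  by rewrite -subn1 subn_gt0 card_gt1.
have -> : p - p ^+ (q ^ i.+1) = (1 - p ^+ (q ^ i.+1).-1) * p.
  by rewrite mulrBl mul1r -exprSr prednK // expn_gt0 ltnW ?card_gt1.
by rewrite /= mulrA divrK // -mulrA -exprSr prednK.
Qed.

(** Each recursion step gains the exponent (q-1) q^i - 1, which is positive for i > 0 but is 0 at i
    = 0 when q = 2; hence the shift by one. This makes the logarithm converge on every complete
    algebra. *)
Lemma log_coef_dvd i : exists d, log_coef i.+1 = p ^+ i * d.
Proof.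
elim: i => [|i [d dP]]; first by exists (log_coef 1); rewrite mul1r.
have [e eP] : exists e, p ^+ (q.-1 * q ^ i.+1).-1 = p * e.
  exists (p ^+ (q.-1 * q ^ i.+1).-2); rewrite -exprS prednK // -subn1 subn_gt0.
  apply: (@leq_trans (1 * q ^ i.+1)%N).
    by rewrite mul1n -{1}(expn0 q) ltn_exp2l ?card_gt1.
  by rewrite leq_mul2r -subn1 subn_gt0 card_gt1 orbT.
exists (d * e / (1 - p ^+ (q ^ i.+2).-1)).
rewrite [LHS]/= -/(log_coef i.+1) dP eP exprSr; ring.
Qed.

(** The coefficients are built from pi and 1 alone. Hence [ell] does not change when the structure
    map is twisted by phi, as pullback along Frobenius requires. *)
Lemma phi_log_coef i : phi iota (log_coef i) = log_coef i.
Proof.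
elim: i => [|i IH]; first by rewrite /= rmorph1.
rewrite [log_coef i.+1]/= !rmorphM rmorphV ?sub1X_unit ?pred_expq_gt0 //.
by rewrite rmorphB rmorph1 !rmorphXn /= phi_pi IH.
Qed.

Section Ell.
Variable B : piAlg l.

Definition log_sum n (b : B) : B := \sum_(i < n.+1) pstr B (log_coef i) * b ^+ (q ^ i).

Definition log_lim (b v : B) := forall n, exists y, v - log_sum n b = PI B ^+ n * y.

Definition ell (b : B) : B := xget 0 (log_lim b).

Lemma log_lim_ex b : exists v, log_lim b v.
Proof.
apply: (pstr_complete B).2 => n; rewrite /log_sum [X in X - _]big_ord_recr /=.
rewrite addrAC subrr add0r -/(log_coef n.+1); have [d ->] := log_coef_dvd n.
by exists (pstr B d * b ^+ (q ^ n.+1)); rewrite rmorphM rmorphXn /= mulrA.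
Qed.

Lemma ellP b : log_lim b (ell b).
Proof. by have := log_lim_ex b; apply: xgetPex. Qed.

Lemma ell_eq b v : log_lim b v -> ell b = v.
Proof.
move=> bv; apply: pi_sep => n; have [[y yP] [z zP]] := (ellP b n, bv n).
by exists (y - z); rewrite mulrBr -yP -zP opprB addrA subrK.
Qed.

Lemma log_sumD n a b : log_sum n (a + b) = log_sum n a + log_sum n b.
Proof.
rewrite /log_sum -big_split; apply: eq_bigr => i _ /=.
by rewrite (exprqD (wscal iota B)) mulrDr.
Qed.

Lemma ellD a b : ell (a + b) = ell a + ell b.
Proof.
apply: ell_eq => n; have [[y yP] [z zP]] := (ellP a n, ellP b n).
by exists (y + z); rewrite mulrDr -yP -zP log_sumD opprD addrACA.
Qed.

Lemma ell0 : ell 0 = 0.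
Proof. by apply: (@addrI _ (ell 0)); rewrite -ellD !addr0. Qed.
Lemma ellN b : ell (- b) = - ell b.
Proof. by apply/eqP; rewrite -addr_eq0 -ellD addNr ell0. Qed.
Lemma ellB a b : ell (a - b) = ell a - ell b.
Proof. by rewrite ellD ellN. Qed.

Lemma ell_scal a b : ell (wscal iota B a * b) = wscal iota B a * ell b.
Proof.
apply: ell_eq => n; have [y yP] := ellP b n; exists (wscal iota B a * y).
rewrite mulrCA -yP mulrBr; congr (_ - _); rewrite mulr_sumr; apply: eq_bigr => i _.
by rewrite exprMn -(rmorphXn (wscal iota B)) expf_cardX mulrCA.
Qed.

(** The functional equation for partial sums: all terms cancel except the last one, whose
    coefficient is divisible by pi^n by [leq_predq] and so disappears in the limit. *)
Lemma log_sum_telescope n b :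
  log_sum n (PI B * b + PI B ^+ q.-1 * b ^+ q) =
  PI B * log_sum n b + pstr B (log_coef n * p ^+ (q.-1 * q ^ n)) * b ^+ (q ^ n.+1).
Proof.
elim: n => [|n IH]; first by rewrite /log_sum !big_ord1 !rmorph1 !expr1 !mul1r muln1 rmorphXn.
rewrite /log_sum big_ord_recr /= -/(log_sum _ _) IH.
rewrite [in RHS]big_ord_recr /= -/(log_sum _ _) -/(log_coef n.+1) mulrDr -!addrA; congr (_ + _).
rewrite -log_coefS (exprqD (wscal iota B)) !exprMn -!exprM -expnS.
rewrite !(rmorphM, rmorphB, rmorphXn) /= -/(log_coef n.+1); ring.
Qed.

Lemma ell_z b : ell (PI B * b + PI B ^+ q.-1 * b ^+ q) = PI B * ell b.
Proof.
apply: ell_eq => n; have [y yP] := ellP b n; rewrite log_sum_telescope.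
rewrite opprD addrA -mulrBr yP rmorphM rmorphXn /=.
exists (PI B * y - pstr B (log_coef n) * PI B ^+ (q.-1 * q ^ n - n) * b ^+ (q ^ n.+1)).
rewrite -{1}(subnKC (leq_predq n)) exprD; ring.
Qed.
End Ell.

Lemma ell_nat (B C : piAlg l) (h : {rmorphism B -> C}) b : alg_hom h ->
  h (ell b) = ell (h b).
Proof.
move=> hP; apply/esym/ell_eq => n; have [y yP] := ellP b n; exists (h y).
rewrite -hP -rmorphXn -rmorphM -yP rmorphB; congr (_ - _).
rewrite rmorph_sum; apply: eq_bigr => i _.
by rewrite rmorphM rmorphXn /= hP.
Qed.

Lemma ell_twist (B : piAlg l) (b : B) : ell (B := twist iota B) b = ell b.
Proof.
apply: (@ell_eq (twist iota B)) => n; have [y yP] := ellP b n; exists y.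
rewrite twist_pi -yP; congr (_ - _); apply: eq_bigr => i _.
by rewrite /= phi_log_coef.
Qed.

Lemma lcf_ell N (b : lineA l) r : (forall n, lcf N (log_sum n b) = r) ->
  lcf N (ell b) = r.
Proof.
move=> sr; apply/eqP; rewrite -subr_eq0; apply/eqP/(fpsX_complete l).1 => n.
have [y yP] := ellP b n; exists (lcf N y).
by rewrite -(sr n) -lcfN -lcfD yP -rmorphXn lcfM.
Qed.

(** ell(b) is b plus multiples of b^(q^j) with j > 0, so ell(T^(q^k)) starts at T^(q^k) with
    coefficient 1. This triangularity makes the psi_k independent, even modulo pi. *)
Lemma lcf_ell_frob i k : (i <= k)%N ->
  lcf (q ^ i) (ell (lineT l ^+ (q ^ k))) = (i == k)%:R.
Proof.
move=> le_ik; apply: lcf_ell => n.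
rewrite /log_sum lcf_sum big_ord_recl /= -exprM muln1 lcfX.
rewrite eqn_exp2l ?card_gt1 // big1 ?addr0; first by case: eqP.
move=> j _; rewrite -exprM -expnD lcfX eqn_exp2l ?card_gt1 //.
by rewrite ltn_eqF // (leq_ltn_trans le_ik) // -[X in (X < _)%N]addn0 ltn_add2l.
Qed.

Lemma lcf1_ell n : lcf 1 (ell (PI (lineA l) ^+ n * lineT l)) = p ^+ n.
Proof.
apply: lcf_ell => m; rewrite -rmorphXn /log_sum lcf_sum big_ord_recl.
rewrite [log_coef _]/= rmorph1 mul1r expr1 -[lineT l]expr1 lcfX eqxx big1 ?addr0 // => j _.
rewrite exprMn -rmorphXn mulrA -rmorphM ?expr1 lcfX ltn_eqF //.
by rewrite -{1}(expn0 q) ltn_exp2l ?card_gt1.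
Qed.

End CarlitzLog.

(** * The basis psi_k of X(N^n) *)

Section CharN.
Variables (F : finFieldType) (l : fieldType) (iota : {rmorphism F -> l}).
Local Notation q := #|F|.
Local Notation R := (fps l).
Local Notation PI B := (pstr B (piR l)).
Local Notation p := (piR l).

Lemma q_gt0 : (0 < q)%N. Proof. exact: ltnW (card_gt1 F). Qed.
Lemma qS : q = q.-1.+1. Proof. by rewrite prednK // q_gt0. Qed.

Lemma gcomp_ker_scale (B : piAlg l) n a (y : 'rV[B]_n) k : (k < n)%N ->
  gcomp F (ker_scale iota a y) k = wscal iota B a * gcomp F y k.
Proof.
move=> lt_kn; have [h hP ->] := gen_row_pt y.
rewrite -(ker_scale_nat _ hP) -!(gcomp_nat _ hP) /= -(hP (fpsC _)) -rmorphM; congr (h _).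
have reg := @gen_regular l _ (@mpolyC n l).
apply: (pi_regularX (n := 1) reg); rewrite expr1 -gcomp_verS wver_ker_scale.
by rewrite gcomp_jet_scale // gcomp_verS mulrCA.
Qed.

(** The ghost component k + 1 of the Verschiebung of y is pi g, with g the component k of y; the
    Carlitz action gives pi (pi g) + (pi g)^q, and pi is cancelled at the generic point. *)
Lemma gcomp_ker_z (B : piAlg l) n (y : 'rV[B]_n) k : (k < n)%N ->
  gcomp F (ker_z iota y) k = PI B * gcomp F y k + PI B ^+ q.-1 * gcomp F y k ^+ q.
Proof.
move=> lt_kn; have [h hP ->] := gen_row_pt y.
rewrite -(ker_z_nat _ hP) -!(gcomp_nat _ hP).
set B0 := gen_row l n in h hP *; set x := gen_pt l n.
have -> : PI B = h (PI B0) by rewrite hP.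
rewrite -(rmorphXn h) -(rmorphXn h q (gcomp F x k)) -!(rmorphM h) -(rmorphD h); congr (h _).
have reg : pi_regular B0 by apply: gen_regular.
apply: (pi_regularX (n := 1) reg); rewrite expr1 -[LHS]gcomp_verS wver_ker_z.
rewrite gcomp_jet_z // gcomp_verS exprMn mulrDr; congr (_ + _).
by rewrite mulrA -exprS -qS.
Qed.

Lemma ker_scaleE (B : piAlg l) n a (y : 'rV[B]_n) :
  ker_scale iota a y = wscal iota B a *: y.
Proof.
have [h hP ->] := gen_row_pt y.
rewrite -(ker_scale_nat _ hP) /= -(hP (fpsC _)) -map_mxZ; congr map_mx.
apply: (@gcomp_inj F l (gen_row l n) n) => [|k lt_kn]; first exact: gen_regular.
by rewrite gcomp_ker_scale // gcomp_scal.
Qed.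

Lemma ker_z_trunc (B : piAlg l) n (y : 'rV[B]_n.+1) :
  wtrunc (ker_z iota y) = ker_z iota (wtrunc y).
Proof.
have [h hP ->] := gen_row_pt y.
rewrite -(ker_z_nat _ hP) -!wtrunc_nat -(ker_z_nat _ hP); congr map_mx.
apply: (@gcomp_inj F l (gen_row l n.+1) n) => [|k lt_kn]; first exact: gen_regular.
have lt_kSn : (k < n.+1)%N by rewrite ltnS ltnW.
rewrite [LHS](gcomp_trunc _ _ lt_kn).
rewrite [LHS](gcomp_ker_z _ lt_kSn).
rewrite [RHS](gcomp_ker_z _ lt_kn).
rewrite (gcomp_trunc _ _ lt_kn).
by [].
Qed.

(** Common source of the characters of N^n (with G a ghost component) and of J^n E (with G =
    [hcomp]). *)
Lemma is_hom_ell n (sc : forall B : piAlg l, F -> 'rV[B]_n -> 'rV[B]_n)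
    (act : forall B : piAlg l, 'rV[B]_n -> 'rV[B]_n) (G : nfun l n) :
  natural G -> (forall (B : piAlg l) (x y : 'rV[B]_n), G B (x + y) = G B x + G B y) ->
  (forall (B : piAlg l) a (x : 'rV[B]_n), G B (sc B a x) = wscal iota B a * G B x) ->
  (forall (B : piAlg l) (x : 'rV[B]_n), G B (act B x) = PI B * G B x + PI B ^+ q.-1 * G B x ^+ q) ->
  is_hom iota sc act (fun B x => ell F (G B x)).
Proof.
move=> natG addG scG actG; split=> [B C h hP x|B x y|B a x|B x].
- by rewrite (ell_nat _ _ hP) natG.
- by rewrite waddE addG (ellD iota).
- by rewrite scG ell_scal.
- by rewrite actG (ell_z iota).
Qed.

Definition psiN k n : nfun l n := fun B y => ell F (gcomp F y k).

Lemma Psi_XN k n : (k < n)%N -> XN iota (@psiN k n).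
Proof.
move=> lt_kn; apply: (is_hom_ell (G := fun B y => gcomp F y k)) => [B C h hP x|B x y|B a x|B x].
- by rewrite gcomp_nat.
- exact: (gcompD iota).
- exact: gcomp_ker_scale.
- exact: gcomp_ker_z.
Qed.

Section HomClosed.
Variables (n : nat) (sc : forall B : piAlg l, F -> 'rV[B]_n -> 'rV[B]_n)
    (act : forall B : piAlg l, 'rV[B]_n -> 'rV[B]_n).

Lemma is_hom_add f g : is_hom iota sc act f -> is_hom iota sc act g ->
  is_hom iota sc act (nf_add f g).
Proof.
move=> [natf Df sf zf] [natg Dg sg zg].
split=> [B C h hP x|B x y|B a x|B x]; rewrite /nf_add.
- by rewrite rmorphD natf ?natg.
- by rewrite Df Dg addrACA.
- by rewrite sf sg mulrDr.
- by rewrite zf zg mulrDr.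
Qed.

Lemma is_hom_scale r f : is_hom iota sc act f -> is_hom iota sc act (nf_scale r f).
Proof.
move=> [natf Df sf zf].
split=> [B C h hP x|B x y|B a x|B x]; rewrite /nf_scale.
- by rewrite rmorphM natf // hP.
- by rewrite Df mulrDr.
- by rewrite sf mulrCA.
- by rewrite zf mulrCA.
Qed.

Lemma is_hom_comb m (r : nat -> R) (g : nat -> nfun l n) :
  (forall k, (k < m)%N -> is_hom iota sc act (g k)) ->
  is_hom iota sc act (fun B x => \sum_(k < m) pstr B (r k) * g k B x).
Proof.
move=> hg; split=> [B C h hP x|B x y|B a x|B x].
- rewrite rmorph_sum; apply: eq_bigr => k _; case: (hg k (ltn_ord k)) => ng _ _ _.
  by rewrite rmorphM hP ng.
- rewrite -big_split; apply: eq_bigr => k _; case: (hg k (ltn_ord k)) => _ dg _ _.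
  by rewrite dg mulrDr.
- rewrite mulr_sumr; apply: eq_bigr => k _; case: (hg k (ltn_ord k)) => _ _ sg _.
  by rewrite sg mulrCA.
- rewrite mulr_sumr; apply: eq_bigr => k _; case: (hg k (ltn_ord k)) => _ _ _ zg.
  by rewrite zg mulrCA.
Qed.
End HomClosed.

Definition Psi_comb n (a : nat -> R) : nfun l n :=
  fun B y => \sum_(k < n) pstr B (a k) * psiN k y.

Arguments Psi_comb n a B y : clear implicits.

Lemma Psi_comb_XN n a : XN iota (Psi_comb n a).
Proof. exact: (@is_hom_comb _ _ _ n a (fun k => @psiN k n) (fun k => @Psi_XN k n)). Qed.

(** [row0 n b] is the Teichmueller vector [b] of length n, [rowL n b] is V^n [b], which runs through
    the kernel of truncation, and [ext0] is a section of truncation. *)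
Definition row0 n (B : piAlg l) (b : B) : 'rV[B]_n := \row_i (if i == 0%N :> nat then b else 0).
Definition rowL n (B : piAlg l) (b : B) : 'rV[B]_n.+1 := \row_i (if i == n :> nat then b else 0).
Definition ext0 n (B : piAlg l) (y : 'rV[B]_n) : 'rV[B]_n.+1 := \row_i wcomp y i.

Lemma row0_nat n (B C : piAlg l) (h : {rmorphism B -> C}) b :
  map_mx h (row0 n b) = row0 n (h b).
Proof. by apply/rowP => i; rewrite !mxE; case: eqP; rewrite ?rmorph0. Qed.
Lemma rowL_nat n (B C : piAlg l) (h : {rmorphism B -> C}) b :
  map_mx h (rowL n b) = rowL n (h b).
Proof. by apply/rowP => i; rewrite !mxE; case: eqP; rewrite ?rmorph0. Qed.
Lemma ext0_nat n (B C : piAlg l) (h : {rmorphism B -> C}) (y : 'rV[B]_n) :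
  map_mx h (ext0 y) = ext0 (map_mx h y).
Proof. by apply/rowP => i; rewrite !mxE wcomp_nat. Qed.

Lemma wtrunc_ext0 n (B : piAlg l) (y : 'rV[B]_n) : wtrunc (ext0 y) = y.
Proof. by apply/rowP => i; rewrite !mxE wcomp_ord. Qed.

Lemma ext0_trunc n (B : piAlg l) (y : 'rV[B]_n.+1) :
  y = ext0 (wtrunc y) + rowL n (wcomp y n).
Proof.
apply: wcompP => k; rewrite ltnS leq_eqVlt wcompD => /orP[/eqP ->|lt_kn].
  rewrite (wcomp_row (wcomp (wtrunc y))) // [wcomp (wtrunc y) n]wcomp_out // add0r.
  by rewrite (wcomp_row (fun i => if i == n then wcomp y n else 0)) // eqxx.
have lt_kS : (k < n.+1)%N by rewrite ltnS ltnW.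
rewrite (wcomp_row (wcomp (wtrunc y)) lt_kS) (wcomp_trunc _ lt_kn).
by rewrite (wcomp_row (fun i => if i == n then wcomp y n else 0) lt_kS) ltn_eqF ?addr0.
Qed.

Lemma gcomp_row0 n (B : piAlg l) (b : B) k : (k < n)%N ->
  gcomp F (row0 n b) k = b ^+ (q ^ k).
Proof.
move=> lt_kn; have lt0n := leq_ltn_trans (leq0n _) lt_kn.
have cE i : wcomp (row0 n b) i = if i == 0%N then b else 0.
  have [lt_in|le_ni] := ltnP i n.
    by rewrite (wcomp_row (fun i => if i == 0%N then b else 0)).
  by rewrite wcomp_out // gtn_eqF // (leq_trans lt0n).
rewrite /gcomp big_ord_recl cE /= mul1r subn0 big1 ?addr0 // => i _.
by rewrite cE /= exprq0 mulr0.
Qed.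

Lemma gcomp_rowL n (B : piAlg l) (b : B) k : (k <= n)%N ->
  gcomp F (rowL n b) k = if k == n then PI B ^+ n * b else 0.
Proof.
move=> le_kn.
have cE i : (i <= n)%N -> wcomp (rowL n b) i = if i == n then b else 0.
  by move=> le_in; rewrite (wcomp_row (fun i => if i == n then b else 0)).
rewrite /gcomp big_ord_recr /= cE // subnn expr1 big1 ?add0r.
  by case: eqP => [->|]; rewrite ?mulr0.
move=> i _; have lt_in : (i < n)%N by exact: leq_trans (ltn_ord i) le_kn.
by rewrite cE ?(ltnW lt_in) // ltn_eqF // exprq0 mulr0.
Qed.

(** The last ghost component of V^n [b] is pi^n b, so the action is conjugated by a further pi^n:
    the exponent is q - 1 + n q - n = (q-1)(n+1). *)
Lemma ker_z_rowL n (b : lineA l) :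
  ker_z iota (rowL n b) = rowL n (PI _ * b + PI _ ^+ (q.-1 * n.+1) * b ^+ q).
Proof.
apply: (@gcomp_inj F l (lineA l) n.+1) => [|k lt_kn]; first exact: gen_regular.
rewrite gcomp_ker_z // !gcomp_rowL //; case: eqP => _.
  rewrite exprMn mulrDr mulrCA; congr (_ + _).
  rewrite !mulrA -!exprM -!exprD; congr (_ ^+ _ * _).
  by rewrite {2}qS; lia.
by rewrite mulr0 add0r -[X in 0 ^+ X]expn1 exprq0 mulr0.
Qed.

Lemma XN_eqB n (f g : nfun l n) : natural f -> natural g ->
  f (gen_row l n) (gen_pt l n) = g (gen_row l n) (gen_pt l n) ->
  forall B y, f B y = g B y.
Proof.
move=> nf ng fg B y; have [h hP ->] := gen_row_pt y.
by rewrite -(nf _ _ _ hP) fg (ng _ _ _ hP).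
Qed.

(** A character trivial on the kernel of truncation factors through it. The section [ext0] need not
    commute with z, but truncation does, and g sees only the truncation. *)
Lemma XN_ext0 n (g : nfun l n.+1) : XN iota g -> (forall B b, g B (rowL n b) = 0) ->
  XN iota (fun B y => g B (ext0 y)) /\
  forall B y, g B y = g B (ext0 (wtrunc y)).
Proof.
move=> [ng Dg sg zg] g0.
have gt B y : g B y = g B (ext0 (wtrunc y)).
  by rewrite {1}(ext0_trunc y) -(waddE iota) Dg g0 addr0.
split=> //; split=> [B C h hP x|B x y|B a x|B x].
- by rewrite ng // ext0_nat.
- rewrite -Dg !waddE; congr (g B _); apply/rowP => i.
  by rewrite !mxE wcompD.
- rewrite -sg !ker_scaleE; congr (g B _); apply/rowP => i.
  by rewrite !mxE wcompZ.
- by rewrite -zg [RHS]gt ker_z_trunc wtrunc_ext0.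
Qed.

Lemma Psi_rowL k n (B : piAlg l) (b : B) : (k <= n)%N ->
  psiN k (rowL n b) = if k == n then ell F (PI B ^+ n * b) else 0.
Proof. by move=> le_kn; rewrite /psiN gcomp_rowL //; case: eqP; rewrite ?ell0. Qed.

(** On the Teichmueller point [T], psi_k becomes ell(T^(q^k)). The matrix of the coefficients of the
    T^(q^i) is unitriangular, so divisibility by pi^m passes to each a_i in turn. *)
Lemma Psi_comb_dvd n m (a : nat -> R) (G : lineA l) :
  PI _ ^+ m * G = Psi_comb n a _ (row0 n (lineT l)) ->
  forall i, (i < n)%N -> exists r, a i = p ^+ m * r.
Proof.
move=> eG; elim/ltn_ind => i IH lt_in.
have eG' : PI _ ^+ m * G =
    \sum_(k < n) pstr (lineA l) (a k) * ell F (lineT l ^+ (q ^ k)).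
  by rewrite eG; apply: eq_bigr => k _; rewrite /psiN gcomp_row0.
pose e k := lcf (q ^ i) (ell F (lineT l ^+ (q ^ k))).
have : p ^+ m * lcf (q ^ i) G = \sum_(k < n) a k * e k.
  rewrite -lcfM rmorphXn eG' lcf_sum; apply: eq_bigr => k _; exact: lcfM.
rewrite (bigD1 (Ordinal lt_in) isT).
have -> : e (Ordinal lt_in) = 1 by rewrite /e lcf_ell_frob // eqxx.
rewrite mulr1; suff [r ->] : exists r, \sum_(k < n | k != Ordinal lt_in) a k * e k = p ^+ m * r.
  move=> eq; exists (lcf (q ^ i) G - r).
  by rewrite mulrBr eq addrK.
apply: (big_ind (fun s => exists r, s = p ^+ m * r)) => [|_ _ [r ->] [s ->]|k ne].
- by exists 0; rewrite mulr0.
- by exists (r + s); rewrite mulrDr.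
have [lt_ki|le_ik] := ltnP k i.
  by have [r ->] := IH k lt_ki (ltn_ord k); exists (r * e k); rewrite mulrA.
exists 0; rewrite /e lcf_ell_frob //; case: eqP => [ik|_]; last by rewrite !mulr0.
by case/eqP: ne; apply: val_inj.
Qed.

(** Induction along the Verschiebung filtration: on its last step, an additive group, [line_rigid]
    says that a character is determined by its linear coefficient. *)
Lemma XN_comb n (f : nfun l n) : XN iota f ->
  exists a : nat -> R, forall B y, f B y = Psi_comb n a B y.
Proof.
elim: n f => [|n IH] f Xf.
  exists (fun=> 0) => B y; rewrite /Psi_comb big_ord0; case: Xf => _ Df _ _.
  apply: (@addrI _ (f B y)); rewrite -Df addr0 waddE; congr (f B _).
  by apply/rowP => -[].
(* b is the linear coefficient of f on the last step, where psi_n has linear coefficient pi^n. So g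
   = pi^n f - b psi_n has none there, without dividing b by pi^n. *)
pose T := lineT l; pose b := lcf 1 (f (lineA l) (rowL n T)).
pose g := nf_add (nf_scale (p ^+ n) f) (nf_scale (- b) (@psiN n n.+1)).
have Xg : XN iota g by apply: is_hom_add; apply: is_hom_scale => //; apply: Psi_XN.
have gT : g (lineA l) (rowL n T) = 0.
  have [h hP hT] := line_pt (B := lineA l) (PI _ * T + PI _ ^+ (q.-1 * n.+1) * T ^+ q).
  apply: (@line_rigid _ h (PI _ + PI _ ^+ (q.-1 * n.+1) * T ^+ q.-1)) => //.
  - by rewrite hT mulrDr mulrC; congr (_ + _); rewrite mulrCA -exprS -qS.
  - rewrite lcfD -rmorphXn lcfX -[PI _]mulr1 -[1](expr0 (lineT l)) lcfX eqxx.
    by rewrite ltn_eqF ?addr0 // -subn1 subn_gt0 card_gt1.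
  - case: Xg => ng _ _ zg.
    by rewrite (ng _ _ _ hP) rowL_nat hT -ker_z_rowL zg.
  rewrite /g /nf_add /nf_scale lcfD !lcfM Psi_rowL // eqxx lcf1_ell -/b.
  by rewrite mulrC mulNr subrr.
have g0 (B : piAlg l) (c : B) : g B (rowL n c) = 0.
  have [h hP <-] := line_pt c; case: Xg => ng _ _ _.
  by rewrite -rowL_nat -(ng _ _ _ hP) gT rmorph0.
have [Xg' gE] := XN_ext0 Xg g0; have [a aP] := IH _ Xg'.
pose a' k := if k == n then b else a k.
have pf B y : PI B ^+ n * f B y = Psi_comb n.+1 a' B y.
  have := gE B y; rewrite aP {1}/g /nf_add /nf_scale => e.
  rewrite /Psi_comb big_ord_recr /= {2}/a' eqxx.
  move: e; rewrite rmorphN mulNr rmorphXn => /(canRL (subrK _)) ->; congr (_ + _).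
  apply: eq_bigr => k _; rewrite /a' ltn_eqF //; congr (_ * ell F _).
  by rewrite gcomp_trunc.
(* So far only pi^n f is a combination of the psi_k; triangularity allows pi^n to be divided out of
   its coefficients. *)
have dvd := Psi_comb_dvd (pf _ _).
have [c cP] : exists c : nat -> R, forall i, (i < n.+1)%N -> a' i = p ^+ n * c i.
  have ex i : exists r, (i < n.+1)%N -> a' i = p ^+ n * r.
    by case: (ltnP i n.+1) => [/dvd[r]|_]; [exists r|exists 0].
  by have [c cP] := choice ex; exists c.
exists c; apply: XN_eqB; first by case: Xf.
  by case: (Psi_comb_XN n.+1 c).
apply: (@pi_regularX _ _ n); first exact: gen_regular.
rewrite pf mulr_sumr; apply: eq_bigr => i _.
by rewrite cP // rmorphM rmorphXn mulrA.
Qed.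

(** The zero value is divisible by every pi^m, hence so are the differences of coefficients. *)
Lemma Psi_comb_inj n (a a' : nat -> R) :
  (forall B y, Psi_comb n a B y = Psi_comb n a' B y) ->
  forall i, (i < n)%N -> a i = a' i.
Proof.
move=> aa' i lt_in; apply/eqP; rewrite -subr_eq0; apply/eqP/(fpsX_complete l).1 => m.
have e : Psi_comb n (fun k => a k - a' k) _ (row0 n (lineT l)) = 0.
  apply/eqP; rewrite -(subrr (Psi_comb n a _ (row0 n (lineT l)))) {2}aa'; apply/eqP.
  rewrite /Psi_comb -sumrB; apply: eq_bigr => k _.
  by rewrite rmorphB mulrBl.
have e' : PI _ ^+ m * 0 = Psi_comb n (fun k => a k - a' k) _ (row0 n (lineT l)).
  by rewrite e mulr0.
exact: (Psi_comb_dvd e' lt_in).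
Qed.

End CharN.

(** * The characters theta_k of J^n E *)

Section CharJ.
Variables (F : finFieldType) (l : fieldType) (iota : {rmorphism F -> l}).
Local Notation q := #|F|.
Local Notation R := (fps l).
Local Notation PI B := (pstr B (piR l)).
Local Notation p := (piR l).

Lemma exprq1D (B : piAlg l) (u v : B) : (u + v) ^+ q = u ^+ q + v ^+ q.
Proof. by have := exprqD (wscal iota B) 1 u v; rewrite !expn1. Qed.
Lemma exprq1B (B : piAlg l) (u v : B) : (u - v) ^+ q = u ^+ q - v ^+ q.
Proof. by have := exprqB (wscal iota B) 1 u v; rewrite !expn1. Qed.

(** Multiplication by r = pi intertwines the rescaled action of z with the Carlitz action. *)
Lemma mul_zform (B : comNzRingType) (r u : B) :
  r * (r * u + r ^+ q.-1 * u ^+ q) = r * (r * u) + (r * u) ^+ q.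
Proof. by rewrite mulrDr [r * (r ^+ _ * _)]mulrA -exprS -qS exprMn. Qed.

Definition wtail (B : piAlg l) n (x : 'rV[B]_n.+1) : 'rV[B]_n := \row_i wcomp x i.+1.

Lemma wcomp_tail (B : piAlg l) n (x : 'rV[B]_n.+1) k : wcomp (wtail x) k = wcomp x k.+1.
Proof.
have [lt_kn|le_nk] := ltnP k n; first by rewrite (wcomp_row (fun i => wcomp x i.+1) lt_kn).
by rewrite !wcomp_out.
Qed.

Lemma wtail_ver (B : piAlg l) n (y : 'rV[B]_n) : wtail (wver y) = y.
Proof. by apply: wcompP => k _; rewrite wcomp_tail wcomp_ver. Qed.

Lemma wtail_nat (B C : piAlg l) (h : {rmorphism B -> C}) n (x : 'rV[B]_n.+1) :
  map_mx h (wtail x) = wtail (map_mx h x).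
Proof. by apply/rowP => i; rewrite !mxE wcomp_nat. Qed.

Lemma row0_tail (B : piAlg l) n (x : 'rV[B]_n.+1) :
  x = row0 n.+1 (wcomp x 0) + wver (wtail x).
Proof.
apply: wcompP => k lt_kn; rewrite wcompD wcomp_ver.
rewrite (wcomp_row (fun i => if i == 0%N then wcomp x 0 else 0) lt_kn).
by case: k {lt_kn} => [|k] /=; rewrite ?addr0 // wcomp_tail add0r.
Qed.

Lemma gcomp_tail (B : piAlg l) n (x : 'rV[B]_n.+1) k :
  gcomp F x k.+1 = wcomp x 0 ^+ (q ^ k.+1) + PI B * gcomp F (wtail x) k.
Proof.
rewrite /gcomp big_ord_recl mul1r subn0 mulr_sumr; congr (_ + _).
by apply: eq_bigr => i _; rewrite wcomp_tail mulrA -exprS.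
Qed.

(* These linear forms satisfy [hcomp (jet_z x) = pi * hcomp x + pi ^ (q-1) * hcomp x ^ q]
   because [pi * hcomp x k] is the difference of the ghost components k + 1 of x
   and k of [jet_z x]. *)
Definition hcomp (B : piAlg l) n (x : 'rV[B]_n.+1) k : B :=
  gcomp F (wtail x) k
  - (if k is k'.+1 then PI B ^+ q.-1 * gcomp F (wtail x) k' ^+ q else 0)
  - gcomp F x k.

(** Write x = [x_0] + V(tail). The powers of x_0 cancel between w_(k+1)(x) and w_k(x)^q, and what
    remains is visibly divisible by pi; [hcomp] is the quotient, defined without division so that it
    makes sense on every B. *)
Lemma hcompE (B : piAlg l) n (x : 'rV[B]_n.+1) k :
  PI B * hcomp x k = gcomp F x k.+1 - gcomp F x k ^+ q - PI B * gcomp F x k.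
Proof.
rewrite /hcomp !mulrBr gcomp_tail; congr (_ - _).
case: k => [|k].
  by rewrite mulr0 subr0 [gcomp F x 0]gcomp0 expn1 addrAC subrr add0r.
rewrite [gcomp F x k.+1]gcomp_tail.
have -> : (wcomp x 0 ^+ (q ^ k.+1) + PI B * gcomp F (wtail x) k) ^+ q =
   wcomp x 0 ^+ (q ^ k.+2) + PI B * (PI B ^+ q.-1 * gcomp F (wtail x) k ^+ q).
  rewrite exprq1D -exprM -expnSr; congr (_ + _).
  by rewrite exprMn mulrA -exprS -qS.
by rewrite opprD addrACA subrr add0r.
Qed.

Lemma hcomp_nat (B C : piAlg l) (h : {rmorphism B -> C}) n (x : 'rV[B]_n.+1) k :
  alg_hom h -> h (hcomp x k) = hcomp (map_mx h x) k.
Proof.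
move=> hP; rewrite /hcomp !rmorphB -wtail_nat !(gcomp_nat F hP); congr (_ - _ - _).
case: k => [|k]; first by rewrite rmorph0.
by rewrite rmorphM !rmorphXn hP (gcomp_nat F hP).
Qed.

Lemma hcompD (B : piAlg l) n (x y : 'rV[B]_n.+1) k : hcomp (x + y) k = hcomp x k + hcomp y k.
Proof.
have tD : wtail (x + y) = wtail x + wtail y.
  by apply: wcompP => i _; rewrite wcompD !wcomp_tail wcompD.
rewrite /hcomp tD !(gcompD iota); case: k => [|k]; first by rewrite !subr0 opprD addrACA.
rewrite (gcompD iota) exprq1D mulrDr.
by move: (_ * _ ^+ q) (_ * _ ^+ q) => c c'; ring.
Qed.

Lemma hcomp_scale_reg (B : piAlg l) n a (x : 'rV[B]_n.+1) k : pi_regular B ->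
  (k < n)%N -> hcomp (jet_scale iota a x) k = wscal iota B a * hcomp x k.
Proof.
move=> reg lt_kn; have lt_kSn : (k < n.+1)%N by rewrite ltnS ltnW.
have lt_kS2 : (k.+1 < n.+1)%N by rewrite ltnS.
have e1 := hcompE (jet_scale iota a x) k; have e2 := hcompE x k.
rewrite (gcomp_jet_scale _ _ _ lt_kSn) (gcomp_jet_scale _ _ _ lt_kS2) in e1.
apply: (pi_regularX (n := 1) reg); rewrite expr1 e1 [RHS]mulrCA e2.
have cq : wscal iota B a ^+ q = wscal iota B a by rewrite -rmorphXn expf_card.
move: (wscal iota B a) (gcomp F x k) (gcomp F x k.+1) (PI B) cq => c g g' r cq.
by rewrite exprMn cq !mulrBr [r * (c * g)]mulrCA.
Qed.

Lemma hcomp_z_reg (B : piAlg l) n (x : 'rV[B]_n.+1) k : pi_regular B ->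
  (k < n)%N -> hcomp (jet_z iota x) k = PI B * hcomp x k + PI B ^+ q.-1 * hcomp x k ^+ q.
Proof.
move=> reg lt_kn; have lt_kSn : (k < n.+1)%N by rewrite ltnS ltnW.
have lt_kS2 : (k.+1 < n.+1)%N by rewrite ltnS.
have e1 := hcompE (jet_z iota x) k; have e2 := hcompE x k.
rewrite (gcomp_jet_z _ _ lt_kSn) (gcomp_jet_z _ _ lt_kS2) in e1.
apply: (pi_regularX (n := 1) reg); rewrite expr1 mul_zform e1 e2.
move: (gcomp F x k) (gcomp F x k.+1) (PI B) => g g' r.
rewrite !exprq1B exprq1D; move: (g' ^+ q) (g ^+ q ^+ q) ((r * g) ^+ q) (g ^+ q) => a b c d; ring.
Qed.

Lemma hcomp_frob_reg (B : piAlg l) n (x : 'rV[B]_n.+2) k : pi_regular B ->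
  (k < n)%N -> hcomp (wfrob iota x) k = hcomp x k.+1.
Proof.
move=> reg lt_kn; have lt_kSn : (k < n.+1)%N by rewrite ltnS ltnW.
have lt_kS2 : (k.+1 < n.+1)%N by rewrite ltnS.
apply: (pi_regularX (n := 1) reg); rewrite expr1 !hcompE.
by rewrite (gcomp_frob _ _ lt_kSn) (gcomp_frob _ _ lt_kS2).
Qed.

Lemma hcomp_trunc_reg (B : piAlg l) n (x : 'rV[B]_n.+2) k : pi_regular B ->
  (k < n)%N -> hcomp (wtrunc x) k = hcomp x k.
Proof.
move=> reg lt_kn; have lt_kSn : (k < n.+1)%N by rewrite ltnS ltnW.
have lt_kS2 : (k.+1 < n.+1)%N by rewrite ltnS.
apply: (pi_regularX (n := 1) reg); rewrite expr1 !hcompE.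
by rewrite (gcomp_trunc _ _ lt_kSn) (gcomp_trunc _ _ lt_kS2).
Qed.

Lemma gen_row_regular n : pi_regular (gen_row l n).
Proof. exact: gen_regular. Qed.

Lemma hcomp_scale (B : piAlg l) n a (x : 'rV[B]_n.+1) k : (k < n)%N ->
  hcomp (jet_scale iota a x) k = wscal iota B a * hcomp x k.
Proof.
move=> lt_kn; have [h hP ->] := gen_row_pt x.
rewrite -(jet_scale_nat _ hP) -!(hcomp_nat _ _ hP).
rewrite (hcomp_scale_reg _ _ (@gen_row_regular _) lt_kn) rmorphM; congr (_ * _).
exact: hP.
Qed.

Lemma hcomp_z (B : piAlg l) n (x : 'rV[B]_n.+1) k : (k < n)%N ->
  hcomp (jet_z iota x) k = PI B * hcomp x k + PI B ^+ q.-1 * hcomp x k ^+ q.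
Proof.
move=> lt_kn; have [h hP ->] := gen_row_pt x.
rewrite -(jet_z_nat _ hP) -!(hcomp_nat _ _ hP).
rewrite (hcomp_z_reg _ (@gen_row_regular _) lt_kn).
by rewrite rmorphD !rmorphM rmorphXn (rmorphXn h q (hcomp _ _)) !hP.
Qed.

Lemma hcomp_frob (B : piAlg l) n (x : 'rV[B]_n.+2) k : (k < n)%N ->
  hcomp (wfrob iota x) k = hcomp x k.+1.
Proof.
move=> lt_kn; have [h hP ->] := gen_row_pt x.
rewrite -(wfrob_nat _ hP) -!(hcomp_nat _ _ hP).
by rewrite (hcomp_frob_reg _ (@gen_row_regular _) lt_kn).
Qed.

Lemma hcomp_trunc (B : piAlg l) n (x : 'rV[B]_n.+2) k : (k < n)%N ->
  hcomp (wtrunc x) k = hcomp x k.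
Proof.
move=> lt_kn; have [h hP ->] := gen_row_pt x.
rewrite -wtrunc_nat -!(hcomp_nat _ _ hP).
by rewrite (hcomp_trunc_reg _ (@gen_row_regular _) lt_kn).
Qed.

Definition thetaJ k n : nfun l n.+1 := fun B x => ell F (hcomp x k).

Lemma Theta_XJ k n : (k < n)%N -> XJ iota (@thetaJ k n).
Proof.
move=> lt_kn; apply: (is_hom_ell (G := fun B x => hcomp x k)) => [B C h hP x|B x y|B a x|B x].
- exact: hcomp_nat.
- exact: hcompD.
- exact: hcomp_scale.
- exact: hcomp_z.
Qed.

Lemma Theta_frob k n (B : piAlg l) (x : 'rV[B]_n.+2) : (k < n)%N ->
  frob_pull iota (@thetaJ k n) x = thetaJ k.+1 x.
Proof.
move=> lt_kn; rewrite /frob_pull /thetaJ (ell_twist iota) -(hcomp_frob _ lt_kn).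
rewrite /hcomp !(twist_gcomp iota) twist_pi.
by case: (k) => [|j] //; rewrite (twist_gcomp iota).
Qed.

Lemma Theta_trunc k n (B : piAlg l) (x : 'rV[B]_n.+2) : (k < n)%N ->
  u_pull (@thetaJ k n) x = thetaJ k x.
Proof. by move=> lt_kn; rewrite /u_pull /thetaJ hcomp_trunc. Qed.

Lemma Psi_frob k n (B : piAlg l) (y : 'rV[B]_n.+1) : (k < n)%N ->
  frob_pull iota (@psiN F l k n) y = psiN F k.+1 y.
Proof.
move=> lt_kn; rewrite /frob_pull /psiN (ell_twist iota) (twist_gcomp iota).
by rewrite (gcomp_frob _ _ lt_kn).
Qed.

Lemma Psi_trunc k n (B : piAlg l) (y : 'rV[B]_n.+1) : (k < n)%N ->
  u_pull (@psiN F l k n) y = psiN F k y.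
Proof. by move=> lt_kn; rewrite /u_pull /psiN gcomp_trunc. Qed.

(** On V(y) the two terms subtracted in [hcomp] form pi u + pi^(q-1) u^q with u the ghost component
    k - 1 of y, and ell sends this to pi ell(u). *)
Lemma Theta_i k n (B : piAlg l) (y : 'rV[B]_n) :
  i_pull (@thetaJ k n) y = psiN F k y - (if k is j.+1 then PI B * psiN F j y else 0).
Proof.
rewrite /i_pull /thetaJ /psiN; case: k => [|k].
  by rewrite /hcomp wtail_ver gcomp_ver0 !subr0.
rewrite -(ell_z iota) -(ellB iota) /hcomp wtail_ver gcomp_verS; congr ell.
by rewrite [X in _ = _ - X]addrC opprD addrA.
Qed.
End CharJ.

Lemma nfunP (l : fieldType) n (f g : nfun l n) : (forall B x, f B x = g B x) -> f = g.
Proof.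
move=> fg; apply: functional_extensionality_dep => B.
by apply: functional_extensionality_dep => x.
Qed.

(** * H(E) and X_prim(E) *)

Section Rank1Colimit.
Variables (R : comNzRingType) (X : nat -> Type) (inX : forall n, X n -> Prop).
Variables (addX : forall n, X n -> X n -> X n) (scX : forall n, R -> X n -> X n).
Variables (tr : forall n, X n -> X n.+1) (inY : forall n, X n -> Prop).
Variables (cls : forall n, X n -> R) (gen : forall n, X n).
Hypotheses (inX_add : forall n x y, inX x -> inX y -> inX (@addX n x y))
  (inX_sc : forall n r x, inX x -> inX (@scX n r x))
  (inX_tr : forall n x, inX x -> inX (@tr n x))
  (cls_add : forall n x y, inX x -> inX y -> cls (@addX n x y) = cls x + cls y)
  (cls_sc : forall n r x, inX x -> cls (@scX n r x) = r * cls x)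
  (cls_tr : forall n x, inX x -> cls (@tr n x) = cls x)
  (cls0 : forall n x, inX x -> (@cls n x = 0 <-> inY x))
  (inX_gen : forall n, inX (gen n)) (cls_gen : forall n, cls (gen n) = 1)
  (tr_gen : forall n, tr (gen n) = gen n.+1).

Lemma iter_trP m n (x : X n) : inX x ->
  inX (iter_tr tr m x) /\ cls (iter_tr tr m x) = cls x.
Proof.
move=> Xx; elim: m => [//|m [IHX IHc]] /=.
by split; [apply: inX_tr|rewrite cls_tr].
Qed.

(** [cls] has kernel Y_n at every level and is compatible with the transition maps, so each quotient
    is already R and the transitions are isomorphisms. *)
Lemma rank1_colim : is_colim inX addX scX tr inY (M := R^o) (fun n x => cls x).
Proof.
split=> // [n x Xx|v]; last first.
  by exists 0%N, (scX v (gen 0)); rewrite cls_sc // cls_gen mulr1; split; auto.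
split=> [c0|[m]]; first by exists 0%N; apply/cls0.
by have [Xm <-] := iter_trP m Xx; move/(cls0 Xm).
Qed.

Variables (M : lmodType R) (c : forall n, X n -> M).
Hypothesis cP : is_colim inX addX scX tr inY c.

Lemma rank1_colim_gen n : c (gen n) = c (gen 0).
Proof. by elim: n => // n <-; rewrite -tr_gen (cl_tr cP). Qed.

Lemma rank1_colimE n (x : X n) : inX x -> c x = cls x *: c (gen 0).
Proof.
move=> Xx; rewrite -(rank1_colim_gen n) -(cl_scale cP) //.
have Xg : inX (scX (- cls x) (gen n)) by apply: inX_sc.
have : c (addX x (scX (- cls x) (gen n))) = 0.
  apply/(cl_eq0 cP); first exact: inX_add.
  by exists 0%N; apply/cls0; rewrite ?cls_add ?cls_sc ?cls_gen ?mulr1 ?subrr //; exact: inX_add.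
rewrite (cl_add cP) // (cl_scale cP) // scaleNr => /eqP; rewrite subr_eq0 => /eqP ->.
by rewrite (cl_scale cP).
Qed.

Lemma rank1_colim_span v : exists r, v = r *: c (gen 0).
Proof.
by have [n [x [Xx <-]]] := cl_gen cP v; exists (cls x); apply: rank1_colimE.
Qed.

Lemma rank1_colim_free r : r *: c (gen 0) = 0 -> r = 0.
Proof.
rewrite -(cl_scale cP) // => /(cl_eq0 cP (inX_sc r (inX_gen 0)))[m Ym].
have [Xm] := iter_trP m (inX_sc r (inX_gen 0)).
by move/cls0: (Ym) => ->; rewrite // cls_sc // cls_gen mulr1.
Qed.
End Rank1Colimit.

(** * The basis theta_k of X_n(E) and the matrix of i^* *)

Section Classes.
Variables (F : finFieldType) (l : fieldType) (iota : {rmorphism F -> l}).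
Local Notation q := #|F|.
Local Notation R := (fps l).
Local Notation PI B := (pstr B (piR l)).
Local Notation p := (piR l).

Lemma abel_sum (B : comNzRingType) (u : B) (H psi : nat -> B) n :
  \sum_(k < n.+1) (H k - u * H k.+1) * psi k =
  H 0%N * psi 0%N + \sum_(j < n) H j.+1 * (psi j.+1 - u * psi j) - u * H n.+1 * psi n.
Proof.
elim: n => [|n IH]; first by rewrite big_ord1 big_ord0 addr0 mulrBl.
by rewrite big_ord_recr /= IH [in RHS]big_ord_recr /=; ring.
Qed.

(** Horner tails: the solution of h_j - pi h_(j+1) = a_j with h_n = 0. They convert coordinates in
    the psi_k into coordinates in the theta_k. *)
Definition hsum (a : nat -> R) n j := \sum_(i < n - j) a (j + i)%N * p ^+ i.

Lemma hsumS a n j : (j < n)%N -> a j = hsum a n j - p * hsum a n j.+1.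
Proof.
move=> lt_jn; rewrite /hsum -(subnSK lt_jn) big_ord_recl addn0 mulr1.
rewrite [X in _ + X - _](_ : _ = p * \sum_(i < n - j.+1) a (j.+1 + i)%N * p ^+ i) ?addrK //.
rewrite mulr_sumr; apply: eq_bigr => i _.
by rewrite lift0 addSnnS exprS mulrCA.
Qed.

Lemma hsum0 a n : hsum a n 0 = \sum_(i < n) a i * p ^+ i.
Proof. by rewrite /hsum subn0; apply: eq_bigr => i _; rewrite add0n. Qed.
Lemma hsum_last a n : hsum a n n = 0.
Proof. by rewrite /hsum subnn big_ord0. Qed.

Local Notation Psic n a := (@Psi_comb F l n a).

Definition Theta_comb n (a : nat -> R) : nfun l n.+1 :=
  fun B x => \sum_(k < n) pstr B (a k) * thetaJ F k x.
Local Notation Thetac n a := (@Theta_comb n a).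

Lemma Theta_comb_XJ n a : XJ iota (Thetac n a).
Proof.
exact: (@is_hom_comb _ _ _ _ _ _ n a (fun k => @thetaJ F l k n) (fun k => @Theta_XJ _ _ _ k n)).
Qed.

(** Coordinates of i^* (sum of the c_k theta_k) in the basis psi_k; [hsum] inverts it. *)
Definition icoef n (c : nat -> R) k := c k - (if (k.+1 < n)%N then p * c k.+1 else 0).

Lemma abel_icoef (B : comNzRingType) (h : {rmorphism R -> B}) (c : nat -> R) (psi : nat -> B) n :
  \sum_(k < n) h (c k) * (psi k - (if nat_of_ord k is j.+1 then h p * psi j else 0)) =
  \sum_(k < n) h (icoef n c k) * psi k.
Proof.
case: n => [|n]; first by rewrite !big_ord0.
pose H k := if (k < n.+1)%N then h (c k) else 0.
transitivity (\sum_(k < n.+1) (H k - h p * H k.+1) * psi k); last first.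
  apply: eq_bigr => k _; rewrite /H ltn_ord /icoef rmorphB; congr ((_ - _) * _).
  by case: ifP => _; rewrite ?rmorphM ?rmorph0 ?mulr0.
rewrite abel_sum /H ltnn mulr0 mul0r subr0 big_ord_recl subr0 /=; congr (_ + _).
by apply: eq_bigr => j _; rewrite ltnS ltn_ord.
Qed.

Lemma i_pull_Theta_comb n c (B : piAlg l) (y : 'rV[B]_n) :
  i_pull (Thetac n c) y = Psic n (icoef n c) y.
Proof.
rewrite [RHS](_ : _ = \sum_(k < n) pstr B (icoef n c k) * psiN F k y) //.
rewrite -(abel_icoef (pstr B) c (fun k => psiN F k y)).
apply: eq_bigr => k _; congr (_ * _); exact: Theta_i.
Qed.

Lemma pcoef0_monoid (A : comNzRingType) : monoid_morphism (fun f : fps A => pcoef f 0).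
Proof. by split=> // f g; rewrite pcoefM big_ord1. Qed.
Lemma pcoef0_zmod (A : comNzRingType) : zmod_morphism (fun f : fps A => pcoef f 0).
Proof. by []. Qed.

Definition fps_at0 (A : comNzRingType) : {rmorphism fps A -> A} :=
  HB.pack (fun f : fps A => pcoef f 0)
    (GRing.isZmodMorphism.Build _ _ _ (@pcoef0_zmod A))
    (GRing.isMonoidMorphism.Build _ _ _ (@pcoef0_monoid A)).

Lemma zero_complete (A : comNzRingType) : pi_complete (0 : A).
Proof.
split=> [x xP|a aP]; first by have [y ->] := xP 1%N; rewrite mul0r.
have aS n : a n.+1 = a 1%N.
  elim: n => // n <-; have [y] := aP n.+1.
  by rewrite expr0n mul0r => /eqP; rewrite subr_eq0 => /eqP.
exists (a 1%N) => -[|n]; first by exists (a 1%N - a 0%N); rewrite mul1r.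
by exists 0; rewrite aS subrr mulr0.
Qed.

(* Hom(E, Ga) = 0: modulo pi the equation reads f(T ^ q) = 0, so a solution is
   infinitely divisible by pi. *)
Lemma line_rigid0 (h : {rmorphism lineA l -> lineA l}) G : alg_hom h ->
  h (lineT l) = PI _ * lineT l + lineT l ^+ q -> h G = PI _ * G -> G = 0.
Proof.
move=> hP hT.
pose e : {rmorphism fps {poly l} -> {poly l}} := fps_at0 {poly l}.
have ePI G' : e (PI (lineA l) * G') = 0.
  by rewrite rmorphM [X in X * _](_ : _ = 0) ?mul0r //= rmorph0.
(* Modulo pi, h is the substitution of T^q for T, which is injective. *)
have eh G' : e (h G') = e G' \Po 'X^q.
  pose g : {rmorphism fps {poly l} -> {poly l}} := (comp_poly 'X^q) \o e.
  rewrite -[RHS]/(g G') -[LHS]/((e \o h) G').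
  have X0 : (e \o h) (fpsX _) = 0.
    by rewrite /= -(gen_pi (@polyC l)) hP gen_pi.
  apply: fps_hom_eq => [|P|].
  - by rewrite [X in pi_complete X]X0; apply: zero_complete.
  - rewrite -[LHS]/(e (h (fpsC P))) -[RHS]/((e (fpsC P)) \Po 'X^q).
    have eC Q : e (fpsC Q) = Q by [].
    rewrite eC; elim/poly_ind: P => [|P a IH]; first by rewrite !rmorph0.
    have -> : e (h (fpsC (P * 'X + a%:P))) =
        e (h (fpsC P)) * e (h (lineT l)) + e (h (fpsC a%:P)).
      by rewrite !(rmorphD, rmorphM).
    rewrite {}IH comp_polyD comp_polyM comp_polyX comp_polyC; congr (_ * _ + _).
      by rewrite hT rmorphD ePI add0r rmorphXn.
    have -> : fpsC a%:P = pstr (lineA l) (fpsC a) by rewrite /= fpsC_map.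
    by rewrite hP.
  - by rewrite [LHS]X0 /= comp_poly0.
move=> hG; apply: fpsP => m; rewrite pcoef0; elim: m G hG => [|m IH] G hG.
  have := eh G; rewrite hG ePI => /esym/eqP; rewrite comp_poly_eq0 ?size_polyXn ?ltnS ?q_gt0 //.
  by move/eqP.
have G0 : pcoef G 0 = 0.
  have := eh G; rewrite hG ePI => /esym/eqP; rewrite comp_poly_eq0 ?size_polyXn ?ltnS ?q_gt0 //.
  by move/eqP.
pose G1 : lineA l := fps_shift 1 G.
have eG : G = PI (lineA l) * G1.
  by rewrite gen_pi -[fpsX _]expr1; apply: fps_dvdX => -[|k].
have hG' : h G1 = PI _ * G1.
  apply: (pi_regularX (n := 1) (@gen_regular _ _ (@polyC l))); rewrite expr1.
  by rewrite -{1}hP -rmorphM -!eG hG.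
by have := IH _ hG'; rewrite /= addn1.
Qed.

Lemma wcomp_jet_z0 (B : piAlg l) n (x : 'rV[B]_n.+1) :
  wcomp (jet_z iota x) 0 = PI B * wcomp x 0 + wcomp x 0 ^+ q.
Proof. by rewrite -!(gcomp0 F) gcomp_jet_z. Qed.

Lemma wcomp_row0 (B : piAlg l) n (b : B) : wcomp (row0 n.+1 b) 0 = b.
Proof. by rewrite (wcomp_row (fun i => if i == 0%N then b else 0)). Qed.

(** Since x = [x_0] + V(tail), a character trivial on N^n depends on x_0 alone and is a homomorphism
    from E to G_a, to which [line_rigid0] applies. *)
Lemma XJ_inj n (f : nfun l n.+1) : XJ iota f ->
  (forall (B : piAlg l) (y : 'rV[B]_n), i_pull f y = 0) -> forall B x, f B x = 0.
Proof.
move=> [nf Df sf zf] f0.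
have f00 B x : f B x = f B (row0 n.+1 (wcomp x 0)).
  rewrite {1}(row0_tail x) -(waddE iota) Df.
  by rewrite -[f B (wver _)]/(i_pull f (wtail x)) f0 addr0.
pose T := lineT l; pose G := f (lineA l) (row0 n.+1 T).
have [h hP hT] := line_pt (B := lineA l) (PI _ * T + T ^+ q).
have G0 : G = 0.
  apply: (line_rigid0 hP hT); rewrite /G -zf [RHS]f00 (nf _ _ _ hP) row0_nat hT.
  by rewrite wcomp_jet_z0 wcomp_row0.
move=> B x; rewrite f00; have [g gP <-] := line_pt (wcomp x 0).
by rewrite -row0_nat -(nf _ _ _ gP) -/T -/G G0 rmorph0.
Qed.

(** The theta_k already restrict onto all of X(N^n), by [hsum], and restriction to N^n is injective
    on X_n(E). *)
Lemma XJ_comb n (f : nfun l n.+1) : XJ iota f -> exists a, f = Thetac n a.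
Proof.
move=> Xf.
have Xif : XN iota (i_pull f).
  case: Xf => [nf Df sf zf]; split=> [B C h hP x|B x y|B a x|B x]; rewrite /i_pull.
  - by rewrite nf // wver_nat.
  - rewrite -Df !waddE; congr (f B _); apply: wcompP => k _.
    by rewrite wcompD !wcomp_ver; case: k => [|k]; rewrite ?addr0 ?wcompD.
  - by rewrite wver_ker_scale sf.
  - by rewrite wver_ker_z zf.
have [a aP] := XN_comb Xif.
exists (hsum a n).
pose g := nf_add f (nf_scale (-1) (Thetac n (hsum a n))).
have Xg : XJ iota g.
  by apply: is_hom_add => //; apply: is_hom_scale; apply: Theta_comb_XJ.
apply: nfunP => B x; apply/eqP; rewrite -subr_eq0.
have <- : g B x = f B x - Thetac n (hsum a n) x by rewrite /g /nf_add /nf_scale rmorphN1 mulN1r.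
apply/eqP/(XJ_inj Xg) => {B x} B y.
rewrite -[LHS]/(i_pull f y + pstr B (-1) * i_pull (Thetac n (hsum a n)) y).
rewrite aP i_pull_Theta_comb rmorphN1 mulN1r.
apply/eqP; rewrite subr_eq0; apply/eqP/eq_bigr => k _; congr (pstr B _ * _).
rewrite (hsumS a (ltn_ord k)) /icoef; case: ltnP => // le_nk.
by have -> : k.+1 = n; [apply/eqP; rewrite eqn_leq le_nk ltn_ord|rewrite hsum_last mulr0].
Qed.
End Classes.

(** * The class map and the colimits H(E) and X_prim(E) *)

Section ConcreteH.
Variables (F : finFieldType) (l : fieldType) (iota : {rmorphism F -> l}).
Local Notation q := #|F|.
Local Notation R := (fps l).
Local Notation PI B := (pstr B (piR l)).
Local Notation p := (piR l).
Local Notation Psic n a := (@Psi_comb F l n a).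
Local Notation Thetac n a := (@Theta_comb F l n a).

(* Modulo the image of X_(n-1)(E), the k-th basis character psiN k of N^n is
   identified with pi ^ k times the 0-th one. *)
Definition char_class n (f : nfun l n) : R :=
  let a := xget (fun=> 0) [set a | f = Psic n a] in \sum_(i < n) a i * p ^+ i.

Lemma char_classE n a : char_class (Psic n a) = \sum_(i < n) a i * p ^+ i.
Proof.
rewrite /char_class; case: xgetP => [b _ /= eab|/(_ a) []//].
apply: eq_bigr => i _; congr (_ * _); apply/esym.
apply: (@Psi_comb_inj F l n a b) (ltn_ord i) => B y; by rewrite eab.
Qed.

Lemma XN_Psi n (f : nfun l n) : XN iota f -> exists a, f = Psic n a.
Proof. by move=> /XN_comb[a aP]; exists a; apply: nfunP. Qed.

Lemma Psi_comb_add n a b : nf_add (Psic n a) (Psic n b) = Psic n (fun k => a k + b k).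
Proof.
apply: nfunP => B y; rewrite /nf_add /Psi_comb -big_split; apply: eq_bigr => k _ /=.
by rewrite rmorphD mulrDl.
Qed.

Lemma Psi_comb_scale n r a : nf_scale r (Psic n a) = Psic n (fun k => r * a k).
Proof.
apply: nfunP => B y; rewrite /nf_scale /Psi_comb mulr_sumr; apply: eq_bigr => k _ /=.
by rewrite rmorphM mulrA.
Qed.

Lemma Psi_comb_trunc n a : u_pull (Psic n a) = Psic n.+1 (fun k => if (k < n)%N then a k else 0).
Proof.
apply: nfunP => B y; rewrite {2}/Psi_comb big_ord_recr /= ltnn rmorph0 mul0r addr0.
apply: eq_bigr => k _; rewrite ltn_ord; congr (_ * _).
exact: (Psi_trunc F y (ltn_ord k)).
Qed.

Lemma Psi_comb_frob n a : frob_pull iota (Psic n a) =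
  Psic n.+1 (fun k => if k is j.+1 then phi iota (a j) else 0).
Proof.
apply: nfunP => B y; rewrite {2}/Psi_comb big_ord_recl rmorph0 mul0r add0r.
apply: eq_bigr => k _; rewrite lift0; congr (_ * _).
exact: (Psi_frob iota y (ltn_ord k)).
Qed.

Lemma Psi_combE n k : (k < n)%N -> @psiN F l k n = Psic n (fun j => (j == k)%:R).
Proof.
move=> lt_kn; apply: nfunP => B y; rewrite /Psi_comb (bigD1 (Ordinal lt_kn)) //= eqxx.
rewrite rmorph1 mul1r big1 ?addr0 // => j ne.
by rewrite (_ : (j == k :> nat) = false) ?rmorph0 ?mul0r //; apply: negbTE.
Qed.

Lemma class_add n (f g : nfun l n) : XN iota f -> XN iota g ->
  char_class (nf_add f g) = char_class f + char_class g.
Proof.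
move=> /XN_Psi[a ->] /XN_Psi[b ->]; rewrite Psi_comb_add !char_classE -big_split.
by apply: eq_bigr => i _; rewrite mulrDl.
Qed.

Lemma class_scale n r (f : nfun l n) : XN iota f ->
  char_class (nf_scale r f) = r * char_class f.
Proof.
move=> /XN_Psi[a ->]; rewrite Psi_comb_scale !char_classE mulr_sumr.
by apply: eq_bigr => i _; rewrite mulrA.
Qed.

Lemma XN_trunc n (f : nfun l n) : XN iota f -> XN iota (u_pull f).
Proof. by move=> /XN_Psi[a ->]; rewrite Psi_comb_trunc; apply: Psi_comb_XN. Qed.

Lemma class_trunc n (f : nfun l n) : XN iota f -> char_class (u_pull f) = char_class f.
Proof.
move=> /XN_Psi[a ->]; rewrite Psi_comb_trunc !char_classE big_ord_recr /= ltnn mul0r addr0.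
by apply: eq_bigr => i _; rewrite ltn_ord.
Qed.

Lemma class_frob n (f : nfun l n) : XN iota f ->
  char_class (frob_pull iota f) = p * phi iota (char_class f).
Proof.
move=> /XN_Psi[a ->]; rewrite Psi_comb_frob !char_classE big_ord_recl mul0r add0r.
rewrite rmorph_sum mulr_sumr; apply: eq_bigr => i _.
by rewrite lift0 rmorphM rmorphXn /= phi_pi exprS mulrCA.
Qed.

Lemma class_Psi n : char_class (@psiN F l 0 n.+1) = 1.
Proof.
rewrite Psi_combE // char_classE big_ord_recl mulr1 big1 ?addr0 // => i _.
by rewrite lift0 mul0r.
Qed.

Lemma Theta_comb_frob n b : frob_pull iota (Thetac n b) =
  Thetac n.+1 (fun k => if k is j.+1 then phi iota (b j) else 0).
Proof.
apply: nfunP => B y; rewrite {2}/Theta_comb big_ord_recl rmorph0 mul0r add0r.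
apply: eq_bigr => k _; rewrite lift0; congr (_ * _).
exact: (Theta_frob iota y (ltn_ord k)).
Qed.

Lemma Theta_comb_trunc n a :
  u_pull (Thetac n a) = Thetac n.+1 (fun k => if (k < n)%N then a k else 0).
Proof.
apply: nfunP => B y; rewrite {2}/Theta_comb big_ord_recr /= ltnn rmorph0 mul0r addr0.
apply: eq_bigr => k _; rewrite ltn_ord; congr (_ * _).
exact: (Theta_trunc iota y (ltn_ord k)).
Qed.

Lemma Theta_combE n k : (k < n)%N -> @thetaJ F l k n = Thetac n (fun j => (j == k)%:R).
Proof.
move=> lt_kn; apply: nfunP => B y; rewrite /Theta_comb (bigD1 (Ordinal lt_kn)) //= eqxx.
rewrite rmorph1 mul1r big1 ?addr0 // => j ne.
by rewrite (_ : (j == k :> nat) = false) ?rmorph0 ?mul0r //; apply: negbTE.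
Qed.

Lemma XJ_trunc n (f : nfun l n.+1) : XJ iota f -> XJ iota (u_pull f).
Proof. by move=> /XJ_comb[a ->]; rewrite Theta_comb_trunc; apply: Theta_comb_XJ. Qed.

Lemma i_pull_combE n c : i_pull (Thetac n c) = Psic n (icoef n c).
Proof. by apply: nfunP => B y; apply: i_pull_Theta_comb. Qed.

Lemma XJ_i_pull n (f : nfun l n.+1) : XJ iota f -> XN iota (i_pull f).
Proof. by move=> /XJ_comb[a ->]; rewrite i_pull_combE; apply: Psi_comb_XN. Qed.

(** With psi_k counted as pi^k, the class of i^* theta_k = psi_k - pi psi_(k-1) is 0 for k > 0; only
    theta_0 contributes. *)
Lemma class_i_pull n c : char_class (i_pull (Thetac n.+1 c)) = c 0%N.
Proof.
rewrite i_pull_combE char_classE.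
have := @abel_icoef l R idfun c (fun k => p ^+ k) n.+1; rewrite /= => <-.
rewrite big_ord_recl subr0 mulr1 big1 ?addr0 // => i _.
by rewrite lift0 -exprS subrr mulr0.
Qed.

Definition Ncomb0 n (f : nfun l n) := XN iota f /\ char_class f = 0.

Lemma Ncomb0_span n (S : nfun l n -> Prop) f :
  (forall g, S g -> Ncomb0 g) -> nf_span S f -> Ncomb0 f.
Proof.
move=> S0 [m [r [g [Sg fE]]]].
have {fE} -> : f = \big[@nf_add l n/nf_scale 0 (Psic n (fun=> 0))]_(i < m) nf_scale (r i) (g i).
  apply: nfunP => B x; rewrite fE.
  apply: (big_ind2 (fun (u : B) (h : nfun l n) => u = h B x)) => //.
    by rewrite /nf_scale rmorph0 mul0r.
  by move=> u h v k -> ->.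
apply: big_ind => [|h k [Xh ch] [Xk ck]|i _].
- split; first by apply: is_hom_scale; apply: Psi_comb_XN.
  by rewrite class_scale ?mul0r //; apply: Psi_comb_XN.
- by split; [apply: is_hom_add|rewrite class_add // ch ck addr0].
have [Xg cg] := S0 _ (Sg i).
by split; [apply: is_hom_scale|rewrite class_scale // cg mulr0].
Qed.

Lemma i_phi_imageP n (f : nfun l n.+1) : XN iota f ->
  (char_class f = 0 <-> i_phi_image iota f).
Proof.
move=> Xf; split=> [|/Ncomb0_span[]//]; last first.
  move=> g [h /XJ_comb[b ->] ->]; rewrite Theta_comb_frob.
  by split; [rewrite i_pull_combE; apply: Psi_comb_XN|rewrite class_i_pull].
have [a ->] := XN_Psi Xf; rewrite char_classE -hsum0 => a0.
(* Summation by parts: with H = [hsum a n.+1], the character is H_0 psi_0 plus the sum of the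
   H_(j+1) (psi_(j+1) - pi psi_j). H_0 is its class, hence 0, and the brackets are i^* phi^*
   theta_j. *)
exists n, (fun j => hsum a n.+1 j.+1).
exists (fun j => i_pull (frob_pull iota (@thetaJ F l j n))); split=> [j|B y].
  by exists (@thetaJ F l j n) => //; apply: Theta_XJ.
pose H k := pstr B (hsum a n.+1 k).
transitivity (\sum_(k < n.+1) (H k - PI B * H k.+1) * psiN F k y).
  by apply: eq_bigr => k _; rewrite /H -rmorphM -rmorphB -hsumS.
rewrite (abel_sum (PI B) H (fun k => psiN F k y)) /H a0 hsum_last rmorph0 mulr0 !mul0r subr0 add0r.
apply: eq_bigr => j _; congr (_ * _).
rewrite -(Theta_i iota j.+1 y) /i_pull (Theta_frob iota _ (ltn_ord j)) //.
Qed.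

Lemma phi_imageP n (f : nfun l n.+2) : XJ iota f ->
  (char_class (i_pull f) = 0 <-> phi_image iota f).
Proof.
move=> /XJ_comb[c ->]; rewrite class_i_pull; split=> [c0|]; last first.
  move=> [m [r [g [Sg fE]]]]; rewrite -(class_i_pull n c).
  suff [] : Ncomb0 (i_pull (Thetac n.+1 c)) by [].
  apply: (@Ncomb0_span _ (fun g => exists2 h : nfun l n.+1, XJ iota h & g = i_pull (frob_pull iota h))).
    move=> _ [h /XJ_comb[b ->] ->]; rewrite Theta_comb_frob.
    by split; [rewrite i_pull_combE; apply: Psi_comb_XN|rewrite class_i_pull].
  exists m, r, (fun i => i_pull (g i)); split=> [i|B y].
    by have [h Xh ->] := Sg i; exists h.
  by rewrite {1}/i_pull fE.
exists n, (fun j => c j.+1), (fun j => frob_pull iota (@thetaJ F l j n)); split=> [j|B y].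
  by exists (@thetaJ F l j n) => //; apply: Theta_XJ.
rewrite /Theta_comb big_ord_recl c0 rmorph0 mul0r add0r; apply: eq_bigr => j _.
by rewrite lift0 (Theta_frob iota _ (ltn_ord j)).
Qed.

Lemma Psi0_trunc n : u_pull (@psiN F l 0 n.+1) = @psiN F l 0 n.+2.
Proof. by apply: nfunP => B y; apply: Psi_trunc. Qed.
Lemma Theta0_trunc n : u_pull (@thetaJ F l 0 n.+1) = @thetaJ F l 0 n.+2.
Proof. by apply: nfunP => B y; apply: (Theta_trunc iota). Qed.
Lemma Theta0_i n : i_pull (@thetaJ F l 0 n) = @psiN F l 0 n.
Proof. by apply: nfunP => B y; rewrite (Theta_i iota) subr0. Qed.

Definition Pclass n (f : nfun l n.+2) : R := char_class (i_pull f).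

Lemma Pclass_trunc n (f : nfun l n.+2) : XJ iota f -> Pclass (u_pull f) = Pclass f.
Proof.
by move=> /XJ_comb[c ->]; rewrite Theta_comb_trunc /Pclass !class_i_pull.
Qed.

Lemma Pclass_Theta n : Pclass (@thetaJ F l 0 n.+1) = 1.
Proof. by rewrite Theta_combE // /Pclass class_i_pull. Qed.

Lemma H_colim : is_colim (fun n => @XN F l iota n.+1) (fun n => @nf_add l n.+1)
  (fun n => @nf_scale l n.+1) (fun n => @u_pull l n.+1) (@i_phi_image F l iota)
  (M := R^o) (fun n f => char_class f).
Proof.
apply: (@rank1_colim R _ _ _ _ _ _ _ (fun n => @psiN F l 0 n.+1)) => n *.
- exact: is_hom_scale.
- exact: XN_trunc.
- exact: class_add.
- exact: class_scale.
- exact: class_trunc.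
- exact: i_phi_imageP.
- exact: Psi_XN.
- exact: class_Psi.
Qed.

Lemma P_colim : is_colim (fun n => @XJ F l iota n.+1) (fun n => @nf_add l n.+2)
  (fun n => @nf_scale l n.+2) (fun n => @u_pull l n.+2) (@phi_image F l iota)
  (M := R^o) (fun n f => Pclass f).
Proof.
apply: (@rank1_colim R _ _ _ _ _ _ _ (fun n => @thetaJ F l 0 n.+1)) => n *.
- exact: is_hom_scale.
- exact: XJ_trunc.
- rewrite /Pclass -class_add //; exact: XJ_i_pull.
- rewrite /Pclass -class_scale //; exact: XJ_i_pull.
- exact: Pclass_trunc.
- exact: phi_imageP.
- exact: Theta_XJ.
- exact: Pclass_Theta.
Qed.
End ConcreteH.

(** * Laurent series *)

Section FracBasics.
Variable A : idomainType.

Lemma frac_numden (x : {fraction A}) : x = tofrac \n_(repr x)%qT / tofrac \d_(repr x)%qT.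
Proof.
rewrite -{1}[x]reprK -{1}[repr x]Ratio_numden.
case: (repr x) => -[n d] /= d0; unlock tofrac; rewrite /= in d0 *.
rewrite -[(_)^-1]FracField.pi_inv -[RHS]FracField.pi_mul /FracField.mulf /FracField.invf.
by rewrite !numden_Ratio ?oner_eq0 ?mulr1 ?mul1r // oner_neq0.
Qed.

Lemma fracP (x : {fraction A}) : exists2 ab : A * A, ab.2 != 0 & x = tofrac ab.1 / tofrac ab.2.
Proof.
exists (\n_(repr x)%qT, \d_(repr x)%qT); last exact: frac_numden.
exact: denom_ratioP.
Qed.

Lemma tofrac_neq0 (a : A) : a != 0 -> tofrac a != 0.
Proof. by rewrite tofrac_eq0. Qed.

Lemma tofrac_inj : injective (@FracField.tofrac A).
Proof. by move=> a b /eqP; rewrite tofrac_eq => /eqP. Qed.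

End FracBasics.

Section FracMap.
Variables (A B : idomainType) (h : {rmorphism A -> B}).
Hypothesis h_inj : injective h.

Lemma inj_neq0 a : a != 0 -> h a != 0.
Proof. by move=> a0; rewrite -(rmorph0 h) (inj_eq h_inj). Qed.

Lemma frac_mapE a b : b != 0 ->
  frac_map h (tofrac a / tofrac b) = tofrac (h a) / tofrac (h b).
Proof.
move=> b0; set x := tofrac a / tofrac b; rewrite /frac_map.
have d0 : \d_(repr x)%qT != 0 by exact: denom_ratioP.
have /eqP := frac_numden x; rewrite {1}/x eqr_div ?tofrac_neq0 //.
rewrite -!tofracM tofrac_eq => /eqP/(congr1 h); rewrite !rmorphM => e.
have hd0 := tofrac_neq0 (inj_neq0 d0); have hb0 := tofrac_neq0 (inj_neq0 b0).
apply/eqP; rewrite eqr_div //.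
by move/(congr1 (@FracField.tofrac B)): e; rewrite !tofracM => ->.
Qed.

Lemma frac_map_tofrac a : frac_map h (tofrac a) = tofrac (h a).
Proof.
by rewrite -[tofrac a]divr1 -(tofrac1 A) frac_mapE ?oner_eq0 // rmorph1 !tofrac1 !divr1.
Qed.

Lemma frac_map_monoid : monoid_morphism (frac_map h).
Proof.
split=> [|x y]; first by rewrite -(tofrac1 A) frac_map_tofrac rmorph1 tofrac1.
have [[a b] /= b0 ->] := fracP x; have [[c d] /= d0 ->] := fracP y.
by rewrite mulf_div -!tofracM !frac_mapE ?mulf_neq0 // !rmorphM mulf_div.
Qed.

Lemma frac_map_zmod : zmod_morphism (frac_map h).
Proof.
move=> x y.
have [[a b] /= b0 ->] := fracP x; have [[c d] /= d0 ->] := fracP y.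
rewrite -mulNr addf_div ?tofrac_neq0 // -tofracN -!tofracM -tofracD !frac_mapE ?mulf_neq0 //.
rewrite -mulNr addf_div ?tofrac_neq0 ?inj_neq0 //.
by rewrite !(rmorphD, rmorphM, rmorphN) /=.
Qed.
End FracMap.

Section LaurentTheory.
Variable k : fieldType.
Local Notation L := (laurent k).
Local Notation z := (zL k).

Lemma zL_neq0 : z != 0.
Proof.
rewrite tofrac_eq0; apply/eqP => /(congr1 (fun f => pcoef f 1))/eqP.
by rewrite pcoefX pcoef0 oner_eq0.
Qed.
Lemma zL_unit : z \is a GRing.unit.
Proof. by rewrite unitfE zL_neq0. Qed.

Lemma zLV n : z ^- n * z ^+ n = 1.
Proof. exact: (mulVf (expf_neq0 n zL_neq0)). Qed.

Lemma zLXn n (f : fps k) : z ^+ n * tofrac f = tofrac (fpsX k ^+ n * f).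
Proof. by rewrite tofracM tofracXn. Qed.

Lemma fps_unitE (f : fps k) : (f \is a GRing.unit) = (pcoef f 0 != 0).
Proof. by rewrite -unitfE. Qed.

Lemma fps_factor (f : fps k) : f != 0 ->
  exists n u, u \is a GRing.unit /\ f = fpsX k ^+ n * u.
Proof.
move=> f0; have ex : exists n, pcoef f n != 0.
  apply: contrapT => /forallNP fn; case/eqP: f0; apply: fpsP => n.
  by apply/eqP; have /negP/negPn := fn n.
case: (ex_minnP ex) => n fn mn; exists n, (fps_shift n f).
split; first by rewrite fps_unitE /= add0n.
apply: fps_dvdX => i lt_in; apply/eqP; apply: contraTT lt_in => /mn.
by rewrite -leqNgt.
Qed.

Lemma tofrac_unit (u : fps k) : u \is a GRing.unit -> (tofrac u)^-1 = tofrac u^-1.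
Proof.
move=> Uu; have u0 : tofrac u != 0.
  by rewrite tofrac_eq0; apply: contraTneq Uu => ->; rewrite unitr0.
by apply: (mulfI u0); rewrite divff // -tofracM divrr // tofrac1.
Qed.

Lemma laurent_factor (x : L) : x != 0 ->
  exists n u, u \is a GRing.unit /\ x = z ^ n * tofrac u.
Proof.
have [[a b] /= b0 ->] := fracP x => x0.
have a0 : a != 0.
  by apply: contraNneq x0 => ->; rewrite tofrac0 mul0r.
have [n [u [Uu ->]]] := fps_factor a0; have [m [v [Uv ->]]] := fps_factor b0.
exists (n%:Z - m%:Z), (u / v); split; first by rewrite unitrM Uu unitrV.
rewrite -!zLXn invfM tofrac_unit // expfzDr ?zL_neq0 // -exprz_inv.
by rewrite tofracM mulrACA -exprVn.
Qed.

Lemma laurent_den (x : L) : exists n f, x * z ^+ n = tofrac f.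
Proof.
have [->|x0] := eqVneq x 0; first by exists 0%N, 0; rewrite mul0r tofrac0.
have [[n|n] [u [_ ->]]] := laurent_factor x0.
  by exists 0%N, (fpsX k ^+ n * u); rewrite mulr1 -exprnP zLXn.
exists n.+1, u; rewrite NegzE mulrAC -exprnN.
by rewrite -[LHS]/(z ^- n.+1 * z ^+ n.+1 * tofrac u) zLV mul1r.
Qed.

Lemma fps_coefzX N (f : fps k) (j : int) :
  fps_coefz (fpsX k ^+ N * f) j = fps_coefz f (j - N%:Z).
Proof.
case: j => [j|j]; last by have -> : Negz j - N%:Z = Negz (j + N) by lia.
rewrite -[LHS]/(pcoef (fpsX k ^+ N * f) j) pcoefXnM.
case: ltnP => [lt_jN|le_Nj]; last by rewrite subzn.
by have -> : j%:Z - N%:Z = Negz (N - j).-1 by lia.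
Qed.

Lemma lcoefE (x : L) n f i : x * z ^+ n = tofrac f -> lcoef x i = fps_coefz f (i + n%:Z).
Proof.
move=> xf; rewrite /lcoef; case: xgetP => [[m g] _ /= xg|/(_ (n, f)) []//].
have : tofrac (fpsX k ^+ m * f) = tofrac (fpsX k ^+ n * g).
  by rewrite -!zLXn -xf -xg; ring.
move/tofrac_inj/(congr1 (fun h => fps_coefz h (i + m%:Z + n%:Z))).
rewrite !fps_coefzX addrK (_ : i + m%:Z + n%:Z - m%:Z = i + n%:Z); last by ring.
by move->.
Qed.

Lemma lcoef_tofrac f i : lcoef (tofrac f : L) i = fps_coefz f i.
Proof. by rewrite (@lcoefE _ 0%N f) ?mulr1 // addr0. Qed.

Lemma laurent_den2 (x y : L) :
  exists n f g, x * z ^+ n = tofrac f /\ y * z ^+ n = tofrac g.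
Proof.
have [[n [f xf]] [m [g yg]]] := (laurent_den x, laurent_den y).
exists (n + m)%N, (fpsX k ^+ m * f), (fpsX k ^+ n * g).
by rewrite -!zLXn -xf -yg exprD; split; ring.
Qed.

Lemma fps_coefzD (f g : fps k) i : fps_coefz (f + g) i = fps_coefz f i + fps_coefz g i.
Proof. by case: i => i /=; rewrite ?addr0. Qed.

Lemma lcoefD (x y : L) i : lcoef (x + y) i = lcoef x i + lcoef y i.
Proof.
have [n [f [g [xf yg]]]] := laurent_den2 x y.
rewrite (lcoefE _ xf) (lcoefE _ yg) -fps_coefzD; apply: lcoefE.
by rewrite mulrDl xf yg tofracD.
Qed.

Lemma lcoef0 i : lcoef (0 : L) i = 0.
Proof. by rewrite -tofrac0 lcoef_tofrac; case: i. Qed.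

Lemma lcoefN (x : L) i : lcoef (- x) i = - lcoef x i.
Proof. by apply/eqP; rewrite -addr_eq0 -lcoefD addNr lcoef0. Qed.

Lemma lcoefB (x y : L) i : lcoef (x - y) i = lcoef x i - lcoef y i.
Proof. by rewrite lcoefD lcoefN. Qed.

Lemma lcoef_sum I r (P : pred I) (E : I -> L) i :
  lcoef (\sum_(j <- r | P j) E j) i = \sum_(j <- r | P j) lcoef (E j) i.
Proof. by apply: (big_morph (fun x => lcoef x i)) => [x y|]; rewrite ?lcoefD ?lcoef0. Qed.

Lemma lcoefZ n (x : L) i : lcoef (z ^ n * x) i = lcoef x (i - n).
Proof.
have [m [f xf]] := laurent_den x; rewrite (lcoefE _ xf).
case: n => n.
  rewrite (@lcoefE _ m (fpsX k ^+ n * f)); last by rewrite -mulrA xf -exprnP zLXn.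
  by rewrite fps_coefzX; congr fps_coefz; ring.
rewrite (@lcoefE _ (n.+1 + m) f).
  by congr fps_coefz; rewrite NegzE; lia.
by rewrite NegzE -exprnN exprD -xf mulrACA zLV mul1r.
Qed.

Lemma lcoef_nth n (f : fps k) j : lcoef (z ^ n * tofrac f) (j%:Z + n) = pcoef f j.
Proof. by rewrite lcoefZ addrK lcoef_tofrac. Qed.

Lemma lcoef_low (x : L) (a : int) :
  (exists f, x = z ^ a * tofrac f) <-> (forall i, i < a -> lcoef x i = 0).
Proof.
split=> [[f ->] i lt_ia|x0].
  rewrite lcoefZ lcoef_tofrac; case E: (i - a) => [j|j] //; lia.
have [->|xn0] := eqVneq x 0; first by exists 0; rewrite tofrac0 mulr0.
have [N [u [Uu eu]]] := laurent_factor xn0.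
have le_aN : a <= N.
  rewrite leNgt; apply/negP => /x0; rewrite eu -[N in lcoef _ N]add0r (lcoef_nth N u 0).
  by move/eqP; apply/negP; rewrite -fps_unitE.
exists (fpsX k ^+ `|N - a|%N * u).
rewrite -zLXn eu mulrA exprnP -expfzDr ?zL_neq0 //; congr (z ^ _ * _); lia.
Qed.

Lemma lcoefP (x y : L) : (forall i, lcoef x i = lcoef y i) -> x = y.
Proof.
move=> xy; apply/eqP; rewrite -subr_eq0; apply/negPn/negP => d0.
have [N [u [Uu eu]]] := laurent_factor d0.
have := lcoefB x y N; rewrite xy subrr eu -[N in lcoef _ N]add0r (lcoef_nth N u 0).
by move/eqP; apply/negP; rewrite -fps_unitE.
Qed.
End LaurentTheory.

Section SigmaL.
Variables (F : finFieldType) (l : fieldType) (iota : {rmorphism F -> l}).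
Local Notation q := #|F|.
Local Notation L := (laurent l).
Local Notation z := (zL l).

Lemma phi_inj : injective (phi iota).
Proof.
apply: raddf_inj => f f0; apply: fpsP => n.
have /eqP := congr1 (fun g => pcoef g n) f0.
by rewrite pcoef0 /= /frobq expf_eq0 => /andP[_ /eqP].
Qed.

Lemma sigmaL_zmod : zmod_morphism (sigmaL iota).
Proof. exact: frac_map_zmod phi_inj. Qed.
Lemma sigmaL_monoid : monoid_morphism (sigmaL iota).
Proof. exact: frac_map_monoid phi_inj. Qed.
HB.instance Definition _ := GRing.isZmodMorphism.Build _ _ (sigmaL iota) sigmaL_zmod.
HB.instance Definition _ := GRing.isMonoidMorphism.Build _ _ (sigmaL iota) sigmaL_monoid.

Lemma sigmaL_tofrac f : sigmaL iota (tofrac f) = tofrac (phi iota f).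
Proof. exact: frac_map_tofrac phi_inj f. Qed.

Lemma sigmaL_z : sigmaL iota z = z.
Proof. by rewrite sigmaL_tofrac phi_pi. Qed.

Lemma sigmaL_zX n : sigmaL iota (z ^ n) = z ^ n.
Proof. by rewrite rmorphXz ?zL_unit //= sigmaL_z. Qed.

Lemma lcoef_sigmaL x i : lcoef (sigmaL iota x) i = lcoef x i ^+ q.
Proof.
have [n [f xf]] := laurent_den x.
rewrite (lcoefE _ xf) (@lcoefE _ _ n (phi iota f)); first last.
  by rewrite -sigmaL_tofrac -xf rmorphM rmorphXn /= sigmaL_z.
case: (_ + _) => [j|j] //=.
by rewrite expr0n gtn_eqF // ltnW ?card_gt1.
Qed.

Lemma phi_unit u : u \is a GRing.unit -> phi iota u \is a GRing.unit.
Proof. exact: rmorph_unit. Qed.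
End SigmaL.

(** * The isocrystal H_delta(E) *)

Section ModelH.
Variables (F : finFieldType) (l : fieldType) (iota : {rmorphism F -> l}).
Local Notation q := #|F|.
Local Notation R := (fps l).
Local Notation L := (laurent l).
Local Notation p := (piR l).

Lemma frac_tensor_regular (S : idomainType) :
  is_frac_tensor (fun _ : S^o => True) +%R *:%R (U := {fraction S}^o) (@FracField.tofrac S).
Proof.
split=> [x y _ _|s x _|x y _ _|u].
- exact: tofracD.
- exact: tofracM.
- split=> [/tofrac_inj ->|[s s0]]; first by exists 1; rewrite ?oner_neq0.
  by move/(mulfI s0) ->.
- have [[a b] /= b0 ->] := fracP u; exists b, a; split=> //.
  by rewrite -[LHS]/(tofrac b * (tofrac a / tofrac b)) mulrCA divff ?mulr1 // tofrac_eq0.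
Qed.

(** Shows that the statement about all [Hdata] is not vacuous: H(E) and X_prim(E) are realised on R
    through the class maps, H_delta(E) on l((z)). *)
Definition modelH : Hdata iota.
Proof.
refine (@MkHdata F l iota R^o (fun n f => char_class F f) (H_colim iota)
  (fun r => p * phi iota r) _ R^o (fun n f => Pclass F f) (P_colim iota)
  id _ L^o (@FracField.tofrac R) (frac_tensor_regular R)
  (fun x => zL l * sigmaL iota x) _ _).
- by move=> n f Xf; rewrite (class_frob Xf).
- by [].
- by move=> a x y; rewrite rmorphD rmorphM mulrDr mulrCA.
- by move=> h; rewrite sigmaL_tofrac -tofracM.
Defined.
End ModelH.

Section AnyH.
Variables (F : finFieldType) (l : fieldType) (iota : {rmorphism F -> l}) (X : Hdata iota).
Local Notation q := #|F|.
Local Notation R := (fps l).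
Local Notation L := (laurent l).
Local Notation p := (piR l).

Definition Hgen : Hmod X := Hcl X (@psiN F l 0 1).
Definition Pgen : Xprim X := Pcl X (@thetaJ F l 0 1).

Let HE n (f : nfun l n.+1) : XN iota f -> Hcl X f = char_class F f *: Hgen.
Proof.
move=> Xf; apply: (@rank1_colimE R _ (fun n => @XN F l iota n.+1) (fun n => @nf_add l n.+1)
  (fun n => @nf_scale l n.+1) (fun n => @u_pull l n.+1)
  (@i_phi_image F l iota) (fun n f => char_class F f) (fun n => @psiN F l 0 n.+1)) => // *;
  first [exact: HclP|exact: is_hom_add|exact: is_hom_scale|exact: XN_trunc|exact: (class_add (iota := iota))
    |exact: (class_scale (iota := iota))|exact: (class_trunc (iota := iota))
    |exact: i_phi_imageP|exact: Psi_XN|exact: class_Psi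
    |exact: Psi0_trunc].
Qed.

Lemma H_span (v : Hmod X) : exists r, v = r *: Hgen.
Proof.
by have [n [f [Xf <-]]] := cl_gen (HclP X) v; exists (char_class F f); apply: HE.
Qed.

Lemma H_free r : r *: Hgen = 0 -> r = 0.
Proof.
apply: (@rank1_colim_free R _ (fun n => @XN F l iota n.+1) (fun n => @nf_add l n.+1)
  (fun n => @nf_scale l n.+1) (fun n => @u_pull l n.+1)
  (@i_phi_image F l iota) (fun n f => char_class F f) (fun n => @psiN F l 0 n.+1)) => // *;
  first [exact: HclP|exact: is_hom_add|exact: is_hom_scale|exact: XN_trunc|exact: (class_add (iota := iota))
    |exact: (class_scale (iota := iota))|exact: (class_trunc (iota := iota))
    |exact: i_phi_imageP|exact: Psi_XN|exact: class_Psi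
    |exact: Psi0_trunc].
Qed.

Lemma Hgen_scale r : r *: Hgen = Hcl X (nf_scale r (@psiN F l 0 1)).
Proof. by rewrite (cl_scale (HclP X)) //; apply: Psi_XN. Qed.

Lemma Hfrob_gen r : Hfrob (r *: Hgen) = (p * phi iota r) *: Hgen.
Proof.
have XP : XN iota (@psiN F l 0 1) by apply: Psi_XN.
have Xr : XN iota (nf_scale r (@psiN F l 0 1)) by apply: is_hom_scale.
rewrite Hgen_scale HfrobP // HE.
  by rewrite (class_frob Xr) (class_scale r XP) class_Psi mulr1.
have [a ->] := XN_Psi Xr; rewrite Psi_comb_frob; exact: Psi_comb_XN.
Qed.

Lemma Pclass_add n (f g : nfun l n.+2) : XJ iota f -> XJ iota g ->
  Pclass F (nf_add f g) = Pclass F f + Pclass F g.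
Proof. by move=> Xf Xg; apply: (class_add (iota := iota)); exact: XJ_i_pull. Qed.

Lemma Pclass_scale n r (f : nfun l n.+2) : XJ iota f ->
  Pclass F (nf_scale r f) = r * Pclass F f.
Proof. by move=> Xf; apply: (class_scale (iota := iota)); exact: XJ_i_pull. Qed.

Lemma P_span (v : Xprim X) : exists r, v = r *: Pgen.
Proof.
apply: (@rank1_colim_span R _ (fun n => @XJ F l iota n.+1) (fun n => @nf_add l n.+2)
  (fun n => @nf_scale l n.+2) (fun n => @u_pull l n.+2)
  (@phi_image F l iota) (fun n f => Pclass F f) (fun n => @thetaJ F l 0 n.+1)) => // *;
  first [exact: PclP|exact: is_hom_add|exact: is_hom_scale|exact: XJ_trunc|exact: Pclass_add
    |exact: Pclass_scale|exact: (Pclass_trunc (iota := iota))|exact: phi_imageP|exact: Theta_XJ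
    |exact: Pclass_Theta|exact: (Theta0_trunc iota)].
Qed.

Lemma Pincl_gen r : Pincl (r *: Pgen) = r *: Hgen.
Proof.
have XT : XJ iota (@thetaJ F l 0 1) by apply: Theta_XJ.
rewrite -(cl_scale (PclP X)) // PinclP; last exact: is_hom_scale.
by rewrite Hgen_scale -(Theta0_i iota).
Qed.

Definition Dgen : Hdelta X := Hloc Hgen.

Lemma Hloc_gen r : Hloc (r *: Hgen) = tofrac r *: Dgen.
Proof. exact: (ft_scale (HlocP X)). Qed.

Lemma D_span (u : Hdelta X) : exists a, u = a *: Dgen.
Proof.
have [s [x [s0 _ su]]] := ft_gen (HlocP X) u; have [r xr] := H_span x.
exists ((tofrac s)^-1 * tofrac r); rewrite -scalerA -Hloc_gen -xr -su scalerA.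
by rewrite mulVf ?scale1r // tofrac_eq0.
Qed.

Lemma Dgen_neq0 : Dgen != 0.
Proof.
apply/eqP => D0; have L0 : Hloc (0 : Hmod X) = 0.
  apply: (@addrI _ (Hloc (0 : Hmod X))).
  by rewrite -(ft_add (HlocP X)) // !addr0.
have /(ft_eq (HlocP X) I I)[s s0] : Hloc Hgen = Hloc 0 by rewrite L0.
rewrite scaler0 => /H_free e; by rewrite e eqxx in s0.
Qed.

Lemma D_full : (fullv = <[Dgen]>)%VS.
Proof.
apply/eqP; rewrite eqEsubv subvf andbT; apply/subvP => u _.
by have [a ->] := D_span u; apply/memvZ/memv_line.
Qed.

Lemma D_dim : \dim {:Hdelta X} = 1%N.
Proof. by rewrite D_full dim_vline Dgen_neq0. Qed.

Lemma Dgen_basis : basis_of {:Hdelta X} [:: Dgen].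
Proof. by rewrite basisEfree seq1_free Dgen_neq0 /= subvf /= D_dim. Qed.

Lemma Dfrob_scale a : Dfrob (a *: Dgen) = (sigmaL iota a * zL l) *: Dgen.
Proof.
have D0 : Dfrob (0 : Hdelta X) = 0.
  have := DfrobP 1 (0 : Hdelta X) 0; rewrite scale1r addr0 rmorph1 scale1r.
  by move=> e; apply: (@addrI _ (Dfrob (0 : Hdelta X))); rewrite addr0 -e.
rewrite -[a *: _]addr0 DfrobP D0 addr0 -scalerA DfrobE; congr (_ *: _).
by rewrite -[Hgen]scale1r Hfrob_gen rmorph1 mulr1 Hloc_gen.
Qed.

(** The dimension equals 1 only propositionally, so the single index has to be cast. *)
Definition D_idx : 'I_(\dim {:Hdelta X}) := cast_ord (esym D_dim) ord0.

Lemma D_idxP i : i = D_idx.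
Proof.
have i1 : (i < 1)%N by rewrite -[1%N]D_dim.
by apply: ord_inj; case: (nat_of_ord i) i1.
Qed.

(** [det_frob] and [sigma_pull] use the unspecified basis [vbasis]; the unknown nonzero factor
    [D_co Dgen] is carried through the computations. *)
Definition D_co (d : Hdelta X) : L := coord (vbasis {:Hdelta X}) D_idx d.

Lemma D_coZ a d : D_co (a *: d) = a * D_co d.
Proof. by rewrite /D_co linearZ. Qed.

Lemma D_co_eq0 d : D_co d = 0 -> d = 0.
Proof.
move=> d0; rewrite (coord_vbasis (memvf d)) big1 // => i _.
by rewrite (D_idxP i) -/(D_co d) d0 scale0r.
Qed.

Lemma D_co_gen : D_co Dgen != 0.
Proof. by apply: contraNneq Dgen_neq0 => /D_co_eq0 ->. Qed.

Lemma D_coE d : d = (D_co d / D_co Dgen) *: Dgen.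
Proof.
have [a ->] := D_span d.
by rewrite D_coZ mulfK // D_co_gen.
Qed.

Lemma det_dim1 (A : comNzRingType) n (M : 'M[A]_n) (i : 'I_n) : n = 1%N -> \det M = M i i.
Proof. by move=> n1; subst n; rewrite det_mx11 [i]ord1. Qed.

Lemma det_frobE : det_frob X = sigmaL iota (D_co Dgen)^-1 * zL l * D_co Dgen.
Proof.
rewrite /det_frob (det_dim1 _ D_idx D_dim) mxE -/(D_co _).
set b := _`_D_idx; have b1 : D_co b = 1 by rewrite /D_co /b coord_free ?eqxx // (basis_free (vbasisP _)).
by rewrite [b]D_coE b1 div1r Dfrob_scale D_coZ.
Qed.

(** Changing the basis vector by a multiplies the matrix by a / sigma(a), which is a unit of l[[z]]
    because sigma preserves the order in z. *)
Lemma det_frob_ord : is_ordz (det_frob X) 1.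
Proof.
have [n [u [Uu e]]] := laurent_factor D_co_gen.
exists (u / phi iota u); first by rewrite unitrM Uu unitrV phi_unit.
rewrite det_frobE e fmorphV rmorphM /= sigmaL_zX sigmaL_tofrac expr1z.
rewrite invfM tofracM -tofrac_unit ?phi_unit //.
have zn0 := expfz_neq0 n (zL_neq0 l).
rewrite mulrACA; transitivity ((zL l ^ n)^-1 * zL l ^ n * (zL l * (tofrac u / tofrac (phi iota u)))).
  by ring.
by rewrite mulVf // mul1r.
Qed.

Lemma ordz_uniq (x : L) e e' : is_ordz x e -> is_ordz x e' -> e = e'.
Proof.
have low f i : is_ordz x f -> lcoef x i != 0 -> f <= i.
  move=> [u Uu ->] xi; rewrite leNgt; apply: contraNN xi => lt_if.
  by apply/eqP; have [h _] := lcoef_low (zL l ^ f * tofrac u) f; apply: h; first by exists u.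
have at_ f : is_ordz x f -> lcoef x f != 0.
  by move=> [u Uu ->]; rewrite -{2}[f]add0r (lcoef_nth f u 0) -fps_unitE.
move=> xe xe'; apply/le_anti/andP; split; apply: low => //; exact: at_.
Qed.
End AnyH.

(** * Expansion in powers of z - pi *)

Section Weights.
Variable k : fieldType.
Local Notation L := (laurent k).
Local Notation z := (zL k).
Local Notation FL := (fps L).
Local Notation z_neq0 := (zL_neq0 k).

(* Total order at least m, where z and the series variable both have weight 1. *)
Definition wgt (m : int) (f : FL) : Prop :=
  forall j : nat, exists g, pcoef f j = z ^ (m - j%:Z) * tofrac g.

Lemma wgtP m f : wgt m f <-> (forall j i, i < m - j%:Z -> lcoef (pcoef f j) i = 0).
Proof.
by split=> h j; [apply: (lcoef_low _ _).1 | apply: (lcoef_low _ _).2]; apply: h.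
Qed.

Lemma wgt_mono m m' f : m' <= m -> wgt m f -> wgt m' f.
Proof. by move=> le_m /wgtP h; apply/wgtP => j i lt_i; apply: h; lia. Qed.

Lemma wgtD m f g : wgt m f -> wgt m g -> wgt m (f + g).
Proof.
move=> /wgtP hf /wgtP hg; apply/wgtP => j i lt_i.
by rewrite pcoefD lcoefD hf ?hg ?addr0.
Qed.
Lemma wgt0 m : wgt m 0.
Proof. by apply/wgtP => j i _; rewrite pcoef0 lcoef0. Qed.
Lemma wgtN m f : wgt m f -> wgt m (- f).
Proof. by move=> /wgtP hf; apply/wgtP => j i lt_i; rewrite pcoefN lcoefN hf ?oppr0. Qed.
Lemma wgtB m f g : wgt m f -> wgt m g -> wgt m (f - g).
Proof. by move=> hf hg; apply: wgtD => //; apply: wgtN. Qed.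
Lemma wgt_sum m I (r : seq I) (P : pred I) (E : I -> FL) :
  (forall i, P i -> wgt m (E i)) -> wgt m (\sum_(i <- r | P i) E i).
Proof. by move=> h; apply: big_ind => //; [exact: wgt0|exact: wgtD]. Qed.

Lemma laurent_sum_low a I (r : seq I) (P : pred I) (E : I -> L) :
  (forall i, P i -> exists g, E i = z ^ a * tofrac g) ->
  exists g, \sum_(i <- r | P i) E i = z ^ a * tofrac g.
Proof.
move=> h; apply: (big_ind (fun x : L => exists g, x = z ^ a * tofrac g)) => //.
  by exists 0; rewrite tofrac0 mulr0.
by move=> _ _ [g ->] [g' ->]; exists (g + g'); rewrite tofracD mulrDr.
Qed.

Lemma wgtM m m' f g : wgt m f -> wgt m' g -> wgt (m + m') (f * g).
Proof.
move=> hf hg j; rewrite pcoefM; apply: laurent_sum_low => i _.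
have [[u ->] [v ->]] := (hf i, hg (j - i)%N); exists (u * v).
rewrite mulrACA -expfzDr ?z_neq0 // -tofracM; congr (z ^ _ * _).
have le_ij : (i <= j)%N by rewrite -ltnS.
by rewrite -subzn //; ring.
Qed.

(** The type [fps (laurent l)] plays two roles. In l((z))[[pi]], [zetaC] is z and the series
    variable is pi; in K[[z - pi]], [zetaC] is pi, the series variable is t = z - pi, and [xiC] is
    the image of z. *)
Definition zetaC : FL := fpsC z.
Definition xiC : FL := fpsC z + fpsX L.

Lemma wgt_C n g : wgt n (fpsC (z ^ n * tofrac g)).
Proof.
move=> [|j]; first by exists g; rewrite subr0.
by exists 0; rewrite tofrac0 mulr0.
Qed.

Lemma wgt_zeta n : wgt n (fpsC (z ^ n)).
Proof. by rewrite -[z ^ n]mulr1 -(tofrac1 (fps k)); apply: wgt_C. Qed.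

Lemma wgt_X n : wgt n%:Z (fpsX L ^+ n).
Proof.
move=> j; rewrite pcoefXn; case: eqP => [->|_].
  by exists 1; rewrite subrr expr0z tofrac1 mulr1.
by exists 0; rewrite tofrac0 mulr0.
Qed.

Lemma zeta_unit : zetaC \is a GRing.unit.
Proof. by rewrite fps_unitE pcoefC z_neq0. Qed.
Lemma xi_unit : xiC \is a GRing.unit.
Proof. by rewrite fps_unitE pcoefD pcoefC pcoefX addr0 z_neq0. Qed.

Lemma wgt_xi : wgt 1 xiC.
Proof.
apply: wgtD; last by have := wgt_X 1; rewrite expr1.
by have := wgt_zeta 1; rewrite expr1z.
Qed.

Lemma zeta_exp n : zetaC ^ n = fpsC (z ^ n).
Proof. by rewrite /zetaC rmorphXz ?zL_unit. Qed.

Lemma wgt_xiV : wgt (-1) xiC^-1.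
Proof.
pose g : FL := Fps (fun j => (-1) ^+ j * z ^ (- 1 - j%:Z)).
have xg : xiC * g = 1.
  apply: fpsP => j; rewrite mulrDl pcoefD pcoefCM pcoefXM pcoef1.
  have zS (n : nat) : z * z ^ (- 1 - n.+1%:Z) = z ^ (- 1 - n%:Z).
    by rewrite -{1}[z]expr1z -expfzDr ?z_neq0 //; congr (z ^ _); lia.
  case: j => [|j] /=.
    by rewrite mul1r addr0 subr0 exprN1 mulfV ?z_neq0.
  by rewrite exprS mulN1r mulNr mulrN mulrCA zS addNr.
have -> : xiC^-1 = g by apply: (mulrI xi_unit); rewrite divrr ?xi_unit.
move=> j; exists ((-1) ^+ j); rewrite mulrC tofracXn tofracN tofrac1 //.
Qed.

Lemma wgt1 : wgt 0 1.
Proof. by have := wgt_X 0; rewrite expr0. Qed.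

Lemma wgt_pow m f n : wgt m f -> wgt (m *+ n) (f ^+ n).
Proof.
move=> hf; elim: n => [|n IH]; first by rewrite mulr0n expr0; apply: wgt1.
by rewrite mulrS exprS; apply: wgtM.
Qed.

Lemma wgt_xi_exp n : wgt n (xiC ^ n).
Proof.
case: n => n; first by have := wgt_pow n wgt_xi; rewrite -exprnP pmulrn intz.
rewrite NegzE -exprnN -exprVn; have := wgt_pow n.+1 wgt_xiV.
by rewrite mulNrn pmulrn intz.
Qed.

Definition lconst : {rmorphism k -> FL} := (@fpsC L) \o (@FracField.tofrac _) \o (@fpsC k).

Section Eval2.
Variables zz pp : FL.
Lemma comm_pp : commr_rmorph lconst pp.
Proof. by move=> a; rewrite /GRing.comm mulrC. Qed.
Lemma comm_zz : commr_rmorph (horner_morph comm_pp) zz.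
Proof. by move=> a; rewrite /GRing.comm mulrC. Qed.
Definition eval2 : {rmorphism {poly {poly k}} -> FL} := horner_morph comm_zz.

Lemma eval2E p : eval2 p =
  \sum_(i < size p) \sum_(j < size p`_i) lconst p`_i`_j * pp ^+ j * zz ^+ i.
Proof.
rewrite /eval2 /= /horner_morph (@horner_coef_wide _ (size p)) ?size_poly //.
apply: eq_bigr => i _; rewrite coef_map_id0; last by rewrite map_poly0 horner0.
rewrite -mulr_suml; congr (_ * _).
rewrite /horner_morph (@horner_coef_wide _ (size p`_i)) ?size_poly //.
by apply: eq_bigr => j _; rewrite coef_map.
Qed.

Lemma eval2X : eval2 'X = zz.
Proof. exact: horner_morphX. Qed.
Lemma eval2P : eval2 ('X)%:P = pp.
Proof. by rewrite [LHS]horner_morphC /=; exact: horner_morphX. Qed.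
End Eval2.

(* [k[pi][z]] mapped to the two sides: (z, pi) |-> (zeta, X) and (xi, zeta). *)
Definition evL := eval2 zetaC (fpsX L).
Definition evR := eval2 xiC zetaC.

Lemma wgt_const a : wgt 0 (lconst a).
Proof. by have := wgt_C 0 (fpsC a); rewrite expr0z mul1r. Qed.

Lemma evL_coef p j : pcoef (evL p) j = tofrac (Fps (fun i => p`_i`_j)).
Proof.
rewrite /evL eval2E pcoef_sum; apply: lcoefP => i.
rewrite lcoef_tofrac lcoef_sum.
have cE (u v : nat) a : lcoef (pcoef (lconst a * fpsX L ^+ v * zetaC ^+ u) j) i =
    if (v == j) && (u%:Z == i) then a else 0.
  rewrite mulrC exprnP zeta_exp pcoefCM pcoefZXn eq_sym; case: eqP => _ /=; last by rewrite mulr0 lcoef0.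
  rewrite lcoefZ lcoef_tofrac; case E: (i - u%:Z) => [[|n]|n] /=.
  - by have -> : u%:Z == i by apply/eqP; lia.
  - by have -> : (u%:Z == i) = false by apply/eqP; lia.
  - by have -> : (u%:Z == i) = false by apply/eqP; lia.
have {cE} step u : lcoef (pcoef (\sum_(v < size p`_u) lconst p`_u`_v * fpsX L ^+ v * zetaC ^+ u) j) i
    = if u%:Z == i then p`_u`_j else 0.
  rewrite pcoef_sum lcoef_sum; under eq_bigr do rewrite cE.
  have [lt_j|le_j] := ltnP j (size p`_u).
    rewrite (bigD1 (Ordinal lt_j)) //= eqxx /= big1 ?addr0 // => v /negbTE ne.
    by rewrite (_ : (v == j :> nat) = false).
  rewrite [p`_u`_j]nth_default // if_same big1 // => v _.
  by rewrite ltn_eqF // (leq_trans (ltn_ord v)).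
under eq_bigr do rewrite step.
case: i {step} => i /=; last by rewrite big1.
have [lt_i|le_i] := ltnP i (size p).
  rewrite (bigD1 (Ordinal lt_i)) //= eqxx big1 ?addr0 // => u /negbTE ne.
  by rewrite (_ : (u%:Z == i%:Z) = false).
rewrite [p`_i]nth_default // coef0 big1 // => u _.
by rewrite eqz_nat ltn_eqF // (leq_trans (ltn_ord u)).
Qed.

(** Under [evL] distinct monomials occupy distinct places, so the bound forces total degree at least
    m on each of them; [evR] sends a monomial of degree d to weight at least d. *)
Lemma evLR_wgt p m : wgt m (evL p) -> wgt m (evR p).
Proof.
move=> /wgtP h.
have p0 i j : i%:Z + j%:Z < m -> p`_i`_j = 0.
  move=> lt_ij; have := h j i; rewrite evL_coef lcoef_tofrac /=; apply; lia.
rewrite /evR eval2E; apply: wgt_sum => i _; apply: wgt_sum => j _.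
have [lt_ij|le_ij] := ltP (i%:Z + j%:Z) m.
  by rewrite p0 // rmorph0 !mul0r; apply: wgt0.
apply: (wgt_mono le_ij); rewrite addrC -[j%:Z]add0r.
apply: wgtM; last exact: (wgt_xi_exp i).
by apply: wgtM; [apply: wgt_const|rewrite exprnP zeta_exp; apply: wgt_zeta].
Qed.

Lemma wgt_evL p : wgt 0 (evL p).
Proof.
by apply/wgtP => j i lt_i; rewrite evL_coef lcoef_tofrac; case: i lt_i => i //; lia.
Qed.
(** The pair (N, p) stands for z^(-N) p(z, pi). These Laurent polynomials are the dense subring on
    which the expansion is plain substitution. *)
Definition apL (a : nat * {poly {poly k}}) : FL := zetaC ^ (- a.1%:Z) * evL a.2.
Definition apR (a : nat * {poly {poly k}}) : FL := xiC ^ (- a.1%:Z) * evR a.2.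

Lemma zeta_expD m n : zetaC ^ (m + n) = zetaC ^ m * zetaC ^ n.
Proof. exact: (exprzDr zeta_unit). Qed.
Lemma xi_expD m n : xiC ^ (m + n) = xiC ^ m * xiC ^ n.
Proof. exact: (exprzDr xi_unit). Qed.

Lemma wgt_zeta_exp n : wgt n (zetaC ^ n).
Proof. by rewrite zeta_exp; apply: wgt_zeta. Qed.

Lemma apLR_wgt a m : wgt m (apL a) -> wgt m (apR a).
Proof.
case: a => N p h; rewrite /apR /=.
have -> : m = - N%:Z + (N%:Z + m) by lia.
apply: wgtM; first exact: wgt_xi_exp.
apply: evLR_wgt; have := wgtM (wgt_zeta_exp N) h.
by rewrite /apL mulrA -zeta_expD subrr mul1r.
Qed.

Definition ap_mul (a b : nat * {poly {poly k}}) := ((a.1 + b.1)%N, a.2 * b.2).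
Definition ap_sub (a b : nat * {poly {poly k}}) :=
  ((a.1 + b.1)%N, 'X^(b.1) * a.2 - 'X^(a.1) * b.2).

Lemma apL_mul a b : apL (ap_mul a b) = apL a * apL b.
Proof. by rewrite /apL /= PoszD opprD zeta_expD rmorphM mulrACA. Qed.
Lemma apR_mul a b : apR (ap_mul a b) = apR a * apR b.
Proof. by rewrite /apR /= PoszD opprD xi_expD rmorphM mulrACA. Qed.

Lemma apL_sub a b : apL (ap_sub a b) = apL a - apL b.
Proof.
rewrite /apL /= PoszD opprD rmorphB !rmorphM !rmorphXn /= /evL eval2X mulrBr.
rewrite -/evL; congr (_ - _); rewrite mulrA exprnP -zeta_expD; congr (zetaC ^ _ * _); ring.
Qed.
Lemma apR_sub a b : apR (ap_sub a b) = apR a - apR b.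
Proof.
rewrite /apR /= PoszD opprD rmorphB !rmorphM !rmorphXn /= /evR eval2X mulrBr.
rewrite -/evR; congr (_ - _); rewrite mulrA exprnP -xi_expD; congr (xiC ^ _ * _); ring.
Qed.

(* g is the image of f under the continuous extension of apL a |-> apR a. *)
Definition transfer (f g : FL) : Prop :=
  forall m : nat, exists a, wgt m%:Z (f - apL a) /\ wgt m%:Z (g - apR a).

Lemma wgt_apL a : wgt (- a.1%:Z) (apL a).
Proof. by rewrite -[- _]addr0; apply: wgtM; [apply: wgt_zeta_exp|apply: wgt_evL]. Qed.
Lemma wgt_apR a : wgt (- a.1%:Z) (apR a).
Proof. exact/apLR_wgt/wgt_apL. Qed.

Lemma transfer_bound f g : transfer f g -> exists N : nat, wgt (- N%:Z) f /\ wgt (- N%:Z) g.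
Proof.
move=> /(_ 0%N)[a [fa ga]]; exists a.1; split.
  rewrite -[f](subrK (apL a)); apply: wgtD (wgt_apL a); apply: wgt_mono fa; lia.
rewrite -[g](subrK (apR a)); apply: wgtD (wgt_apR a); apply: wgt_mono ga; lia.
Qed.

Lemma transferM f g f' g' : transfer f g -> transfer f' g' -> transfer (f * f') (g * g').
Proof.
move=> fg fg' m; have [[N [fN gN]] [N' [fN' gN']]] := (transfer_bound fg, transfer_bound fg').
(* The extra precision N + N' makes up for the poles of the factors. *)
have [[a [fa ga]] [b [fb gb]]] := (fg (m + N + N')%N, fg' (m + N + N')%N).
exists (ap_mul a b); rewrite apL_mul apR_mul.
have key (u v u' v' : FL) : wgt (- N%:Z) u -> wgt (- N'%:Z) u' ->
    wgt (m + N + N')%:Z (u - v) -> wgt (m + N + N')%:Z (u' - v') ->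
    wgt m (u * u' - v * v').
  move=> wu wu' uv uv'.
  have -> : u * u' - v * v' = (u - v) * u' + v * (u' - v') by ring.
  apply: wgtD; first by apply: wgt_mono (wgtM uv wu'); lia.
  have wv : wgt (- N%:Z) v.
    by rewrite -[v](subKr u); apply: wgtB => //; apply: wgt_mono uv; lia.
  by apply: wgt_mono (wgtM wv uv'); lia.
by split; apply: key.
Qed.

Lemma transferB f g f' g' : transfer f g -> transfer f' g' -> transfer (f - f') (g - g').
Proof.
move=> fg fg' m; have [[a [fa ga]] [b [fb gb]]] := (fg m, fg' m).
exists (ap_sub a b); rewrite apL_sub apR_sub.
have e (u v u' v' : FL) : u - u' - (v - v') = (u - v) - (u' - v') by ring.
by split; rewrite e; apply: wgtB.
Qed.

Lemma transfer_wgt f g (m : nat) : transfer f g -> wgt m f -> wgt m g.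
Proof.
move=> /(_ m)[a [fa ga]] fm; rewrite -[g](subrK (apR a)); apply: wgtD => //.
apply: apLR_wgt; have -> : apL a = f - (f - apL a) by rewrite subKr.
exact: wgtB.
Qed.

Lemma transfer_ap a : transfer (apL a) (apR a).
Proof. by move=> m; exists a; rewrite !subrr; split; apply: wgt0. Qed.

Lemma transfer1 : transfer 1 1.
Proof.
by have := transfer_ap (0%N, 1); rewrite /apL /apR /= oppr0 !expr0z !rmorph1 !mulr1.
Qed.

Lemma wgt_lim (e : nat -> FL) : (forall m : nat, wgt m (e m.+1 - e m)) ->
  exists g, forall m : nat, wgt m (g - e m).
Proof.
move=> de.
have d0 (m : nat) : wgt 0 (e m - e 0%N).
  elim: m => [|m IH]; first by rewrite subrr; apply: wgt0.
  rewrite -(subrKA (e m)); apply: wgtD => //; exact: wgt_mono (de m).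
(* Relative to [e 0], the j-th coefficients all lie in z^(-j) k[[z]]; without this factor they form
   a Cauchy sequence in k[[z]]. *)
have [r rP] := choice (fun mj : nat * nat => d0 mj.1 mj.2).
have rS j m : exists y, r (m.+1, j) - r (m, j) = fpsX k ^+ m * y.
  have [y yP] := de m j; exists y; apply: tofrac_inj.
  apply: (mulfI (expfz_neq0 (0 - j%:Z) z_neq0)).
  rewrite tofracB mulrBr -!(rP (_, j)) /= tofracM tofracXn.
  rewrite [RHS]mulrA exprnP -expfzDr ?z_neq0 //.
  have -> : pcoef (e m.+1 - e 0%N) j - pcoef (e m - e 0%N) j = pcoef (e m.+1 - e m) j.
    by rewrite !pcoefD !pcoefN; ring.
  by rewrite yP; congr (z ^ _ * _); lia.
have [s sP] := choice (fun j => (fpsX_complete k).2 (fun m => r (m, j)) (rS j)).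
exists (Fps (fun j => pcoef (e 0%N) j + z ^ (0 - j%:Z) * tofrac (s j))) => m j.
have [y yP] := sP j m; exists y.
have -> : z ^ (m%:Z - j%:Z) * tofrac y = z ^ (0 - j%:Z) * tofrac (fpsX k ^+ m * y).
  rewrite tofracM tofracXn mulrA exprnP -expfzDr ?z_neq0 //; congr (z ^ _ * _); lia.
have er : pcoef (e m) j - pcoef (e 0%N) j = z ^ (0 - j%:Z) * tofrac (r (m, j)) := rP (m, j).
rewrite -yP tofracB mulrBr -er pcoefD pcoefN [pcoef (Fps _) _]/=; ring.
Qed.

Definition approximable (f : FL) := forall m : nat, exists a, wgt m (f - apL a).

Lemma transfer_ex f : approximable f -> exists g, transfer f g.
Proof.
move=> /choice[a aP].
have [m|g gP] := @wgt_lim (fun m => apR (a m)).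
  rewrite -apR_sub; apply: apLR_wgt; rewrite apL_sub.
  have -> : apL (a m.+1) - apL (a m) = (f - apL (a m)) - (f - apL (a m.+1)) by ring.
  by apply: wgtB => //; apply: wgt_mono (aP m.+1); lia.
by exists g => m; exists (a m).
Qed.
End Weights.

(** * Identification of [expand] with the transfer *)

Section Expansion.
Variable l : fieldType.
Local Notation R := (fps l).
Local Notation K := (laurent l).
Local Notation z := (zL l).
Local Notation FL := (fps K).
Local Notation z_neq0 := (zL_neq0 l).
Local Notation xi := (xiC l).

Definition esum (b : int -> R) n : FL :=
  \sum_(i < n.*2.+1) fpsC (tofrac (b (i%:Z - n%:Z))) * xi ^ (i%:Z - n%:Z).

Lemma is_expansion_wgt b (g : FL) :
  (forall m : nat, exists n0, forall n, (n0 <= n)%N -> wgt m (g - esum b n)) ->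
  is_expansion b g.
Proof.
(* The k-th coefficient in weight at least m + k is divisible by pi^m, whence the shift by k. *)
move=> h k m; have [n0 n0P] := h (m + k)%N; exists n0 => n /n0P/(_ k)[r rP].
exists r; rewrite -[LHS]/(pcoef (g - esum b n) k) rP tofracM tofracXn.
by congr (_ * _); rewrite PoszD addrK.
Qed.

Lemma is_expansion_uniq b (g g' : FL) : is_expansion b g -> is_expansion b g' -> g = g'.
Proof.
move=> hg hg'; apply: fpsP => k; apply/eqP; rewrite -subr_eq0.
have h m : exists r, pcoef g k - pcoef g' k = tofrac (piR l ^+ m * r).
  have [[n0 n0P] [n1 n1P]] := (hg k m, hg' k m).
  have [r rP] := n0P (maxn n0 n1) (leq_maxl _ _).
  have [s sP] := n1P (maxn n0 n1) (leq_maxr _ _).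
  exists (r - s); rewrite mulrBr tofracB -rP -sP !pcoefD !pcoefN; ring.
have [r rP] := choice h.
have e m : r 0%N = piR l ^+ m * r m by apply: tofrac_inj; rewrite -(rP m) (rP 0%N) mul1r.
rewrite (rP 0%N) mul1r tofrac_eq0; apply/eqP/(fpsX_complete l).1 => n.
by exists (r n).
Qed.

Lemma expand_eq b (g : FL) : is_expansion b g -> expand b = g.
Proof.
move=> hg; rewrite /expand; case: xgetP => [g' _ hg'|/(_ g)//].
exact: is_expansion_uniq hg' hg.
Qed.

Lemma fps_poly (c : {poly l}) M : (size c <= M)%N ->
  Fps (fun j => c`_j) = \sum_(j < M) fpsC c`_j * fpsX l ^+ j.
Proof.
move=> sz; apply: fpsP => n; rewrite /= -[RHS]/(pcoef (fps_trunc M (Fps (fun j => c`_j))) n).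
by rewrite pcoef_trunc /=; case: ltnP => // le; rewrite nth_default // (leq_trans sz).
Qed.

Definition pslice (p : {poly {poly l}}) (i : nat) : R := Fps (fun j => p`_i`_j).

Lemma evR_slice (p : {poly {poly l}}) M : (size p <= M)%N ->
  evR l p = \sum_(i < M) fpsC (tofrac (pslice p i)) * xi ^+ i.
Proof.
move=> sz; rewrite /evR eval2E; transitivity (\sum_(i < size p) fpsC (tofrac (pslice p i)) * xi ^+ i).
  apply: eq_bigr => i _; rewrite -mulr_suml; congr (_ * _).
  rewrite /pslice (fps_poly (leqnn _)) !rmorph_sum; apply: eq_bigr => j _.
  by rewrite !rmorphM !rmorphXn.
rewrite (big_ord_widen M (fun i => fpsC (tofrac (pslice p i)) * xi ^+ i)) //.
rewrite [RHS](bigID (fun i : 'I_M => (i < size p)%N)) /=.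
rewrite [X in _ = _ + X]big1 ?addr0 // => i; rewrite -leqNgt => le_i.
rewrite (_ : pslice p i = 0) ?tofrac0 ?rmorph0 ?mul0r //.
by apply: fpsP => j; rewrite /= [p`_i]nth_default // coef0.
Qed.

Definition acoef (a : nat * {poly {poly l}}) (i : int) : R :=
  if i + a.1%:Z is Posz u then pslice a.2 u else 0.

Lemma apR_esum (a : nat * {poly {poly l}}) n : (a.1 + size a.2 <= n)%N -> apR a = esum (acoef a) n.
Proof.
case: a => N p /= le_n; rewrite /apR /= /esum.
rewrite -(big_mkord xpredT (fun i => fpsC (tofrac (acoef (N, p) (i%:Z - n%:Z))) * xi ^ (i%:Z - n%:Z))).
have le_N : (N <= n)%N by exact: leq_trans (leq_addr _ _) le_n.
rewrite (@big_cat_nat _ _ _ (n - N)%N) //=; last by lia.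
rewrite [X in _ = X + _]big_nat [X in _ = X + _]big1 ?add0r; last first.
  move=> i /andP[_ lt_i]; rewrite /acoef /=.
  have -> : i%:Z - n%:Z + N%:Z = Negz (n - N - i).-1 by lia.
  by rewrite tofrac0 rmorph0 mul0r.
rewrite -{1}[(n - N)%N]add0n big_addn big_mkord (@evR_slice _ (n.*2.+1 - (n - N))%N); last first.
  by apply: (leq_trans (leq_addl N (size p))); apply: (leq_trans le_n); lia.
rewrite mulr_sumr; apply: eq_bigr => i _.
have e1 : (i + (n - N))%N%:Z - n%:Z = i%:Z - N%:Z by lia.
have e2 : i%:Z - N%:Z + N%:Z = Posz i by lia.
rewrite e1 /acoef /= e2 mulrCA; congr (_ * _).
by rewrite exprnP -xi_expD addrC.
Qed.

Lemma lcoef_apL a (j : nat) (i : int) :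
  lcoef (pcoef (apL a) j) i = pcoef (acoef a i) j.
Proof.
case: a => N p; rewrite -[apL _]/(zetaC l ^ (- N%:Z) * evL l p) zeta_exp.
rewrite pcoefCM evL_coef lcoefZ opprK lcoef_tofrac.
by rewrite /acoef /=; case: (i + N%:Z) => u.
Qed.

(** Links the pi-adic limit of partial sums that defines [expand] with [transfer], which is
    compatible with products and differences. *)
Lemma transfer_expansion (f g : FL) : transfer f g -> is_expansion (BRcoef f) g.
Proof.
move=> fg; apply: is_expansion_wgt => m; have [a [fa ga]] := fg m.
exists (a.1 + size a.2)%N => n le_n.
rewrite -(subrKA (apR a)); apply: wgtD => //.
rewrite (apR_esum le_n) /esum -sumrB; apply: wgt_sum => i _.
rewrite -mulrBl -rmorphB -tofracB; move: (i%:Z - n%:Z) => {i}i.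
have [h ->] : exists h, tofrac (acoef a i - BRcoef f i) = z ^ (m%:Z - i) * tofrac h.
  apply/lcoef_low => j lt_j; rewrite lcoef_tofrac; case: j lt_j => // j lt_j.
  rewrite -[LHS]/(pcoef (acoef a i) j - lcoef (pcoef f j) i).
  have /wgtP/(_ j i) := fa; rewrite pcoefD pcoefN lcoefB lcoef_apL => e.
  by rewrite -opprB e ?oppr0 //; lia.
by apply: wgt_mono (wgtM (wgt_C _ _) (wgt_xi_exp _ i)); lia.
Qed.

Lemma transfer_expand (f g : FL) : transfer f g -> expand (BRcoef f) = g.
Proof. by move=> fg; apply/expand_eq/transfer_expansion. Qed.

Lemma inBR_approximable (f : FL) : inBR f -> approximable f.
Proof.
(* With slope s = 1 and bound c = m, every nonzero term z^i pi^j with i <= -n0 has i + j >= m.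
   Modulo weight m, only exponents i >= -n0 remain, and there i + n0 and j are both below n0 + m. *)
move=> hf m; have [n0 n0P] := hf 1 m%:R ltr01.
pose D := (n0 + m)%N.
exists (n0, \poly_(i < D) \poly_(j < D) lcoef (pcoef f j) (i%:Z - n0%:Z)).
apply/wgtP => j i lt_i; rewrite pcoefD pcoefN lcoefB lcoef_apL /acoef /=.
case E: (i + n0%:Z) => [u|u] /=.
  rewrite coef_poly (_ : (u < D)%N); last by rewrite /D; lia.
  rewrite coef_poly (_ : (j < D)%N); last by rewrite /D; lia.
  by rewrite (_ : u%:Z - n0%:Z = i) ?subrr //; lia.
rewrite subr0; apply/eqP; apply: contraT => nz.
pose n := absz i; have ei : i = - n%:Z by rewrite /n; lia.
have le_n : (n0 <= n)%N by lia.
have := n0P n le_n j; rewrite /= -ei => /(_ nz).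
rewrite mul1r lerBrDr -natrD ler_nat; lia.
Qed.

Lemma inBR_transfer (f : FL) : inBR f -> transfer f (expand (BRcoef f)).
Proof.
move=> /inBR_approximable/transfer_ex[g fg]; by rewrite (transfer_expand fg).
Qed.

Lemma inBR_C (x : K) : inBR (fpsC x).
Proof.
move=> s c s0; have [N [f xf]] := laurent_den x.
exists N.+1 => n lt_Nn j.
rewrite /= (lcoefE _ (x := if j == 0%N then x else 0) (n := N) (f := if j == 0%N then f else 0)).
  have -> : - n%:Z + N%:Z = Negz (n - N).-1 by lia.
  by rewrite eqxx.
by case: eqP => // _; rewrite mul0r tofrac0.
Qed.

Lemma transfer_laurent (x : K) : transfer (fpsC x) (expandL x).
Proof.
have := inBR_transfer (inBR_C x).
suff -> : BRcoef (fpsC x) = (fun i => fpsC (lcoef x i)) by [].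
apply: funext => i; apply: fpsP => j /=.
by case: eqP; rewrite ?lcoef0.
Qed.

Lemma transfer_uniq (f g g' : FL) : transfer f g -> transfer f g' -> g = g'.
Proof. by move=> /transfer_expand <- /transfer_expand. Qed.

Lemma expandLM (x y : K) : expandL (x * y) = expandL x * expandL y.
Proof.
apply: transfer_uniq (transfer_laurent _) _; rewrite rmorphM.
exact: transferM (transfer_laurent x) (transfer_laurent y).
Qed.

Lemma expandL1 : expandL (1 : K) = 1.
Proof. exact: transfer_uniq (transfer_laurent _) (transfer1 l). Qed.

Lemma expandL_unit x : x != 0 -> expandL (x : K) \is a GRing.unit.
Proof.
move=> x0; apply/unitrPr; exists (expandL x^-1).
by rewrite -expandLM divff // expandL1.
Qed.

Lemma expandRz_zpi : expandRz (zpi l) = tofrac (fpsX K).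
Proof.
rewrite /expandRz; congr tofrac.
have tr : transfer (zetaC l - fpsX K) (fpsX K).
  have := transfer_ap (0%N, 'X - ('X)%:P : {poly {poly l}}).
  rewrite /apL /apR /= oppr0 !expr0z !mul1r /evL /evR !rmorphB !eval2X !eval2P.
  by rewrite /xiC addrAC subrr add0r.
rewrite -(transfer_expand tr); congr expand; apply: funext => i; apply: fpsP => j.
have lz : lcoef z i = (i == 1)%:R.
  rewrite -[z]/(tofrac (fpsX l)) lcoef_tofrac; case: i => //= n; by rewrite eqz_nat.
have l1 : lcoef (1 : K) i = (i == 0)%:R.
  rewrite -(tofrac1 R) lcoef_tofrac; by case: i {lz} => [[|n]|n].
rewrite -[RHS]/(lcoef (pcoef (zetaC l - fpsX K) j) i) pcoefD pcoefN pcoefC pcoefX lcoefB.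
case: j => [|[|j]] /=; rewrite ?lcoef0 ?lz ?l1 ?subr0 ?sub0r.
- case: i lz l1 => [[|[|n]]|n] _ _ /=; rewrite ?subr0 ?add0r ?oppr0 //.
- case: i lz l1 => [[|[|n]]|n] _ _ /=; rewrite ?subr0 ?add0r ?oppr0 //.
- case: i lz l1 => [[|[|n]]|n] _ _ /=; rewrite ?subr0 ?add0r ?oppr0 //.
Qed.
End Expansion.

(** * The series t_- *)

Section TMinus.
Variables (F : finFieldType) (l : fieldType) (iota : {rmorphism F -> l}).
Local Notation q := #|F|.
Local Notation L := (laurent l).
Local Notation z := (zL l).
Local Notation FL := (fps L).
Local Notation sBR := (sigmaBR iota).
Local Notation t := (tminus F l).

Let q_gt0 : (0 < q)%N. Proof. exact: ltnW (card_gt1 F). Qed.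

Lemma sum_dvd (V : zmodType) (G : nat -> V) q' m : (0 < q')%N ->
  \sum_(i < (q' * m).+1) (if (q' %| i)%N then G (i %/ q')%N else 0) = \sum_(i < m.+1) G i.
Proof.
move=> q'0; elim: m => [|m IH]; first by rewrite muln0 !big_ord1 dvdn0 div0n.
rewrite [RHS]big_ord_recr -IH /= -!(big_mkord xpredT (fun i => if (q' %| i)%N then G (i %/ q')%N else 0)).
rewrite (@big_cat_nat _ _ _ (q' * m).+1) //=; last by rewrite ltnS leq_pmul2l.
congr (_ + _); rewrite mulnS addnC.
rewrite big_nat_recr /=; last by rewrite -{1}[(q' * m)%N]addn0 -addnS leq_add2l.
rewrite dvdn_addr ?dvdn_mulr // dvdnn mulnC divnMDl // divnn q'0 addn1.
rewrite big_nat big1 ?add0r // => i /andP[lt_i gt_i].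
case: ifP => // /dvdnP[r er]; exfalso; move: lt_i gt_i; rewrite er.
by have [le_rm|lt_mr] := leqP r m; nia.
Qed.

Lemma pcoef_sigmaBR f j :
  pcoef (sBR f) j = if (q %| j)%N then sigmaL iota (pcoef f (j %/ q)) else 0.
Proof. by []. Qed.

Lemma sigmaBR_zmod : zmod_morphism sBR.
Proof.
move=> f g; apply: fpsP => j; rewrite pcoefD pcoefN !pcoef_sigmaBR.
by case: ifP; rewrite ?subr0 // pcoefD pcoefN rmorphB.
Qed.

Lemma sigmaBR_monoid : monoid_morphism sBR.
Proof.
split=> [|f g]; apply: fpsP => n.
  rewrite pcoef_sigmaBR !pcoef1; case: n => [|n]; first by rewrite dvdn0 div0n rmorph1.
  case: ifP => // /dvdnP[[|r]] // ->; by rewrite mulnK // rmorph0 muln_eq0 /= (gtn_eqF q_gt0).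
rewrite pcoef_sigmaBR !pcoefM; case: ifP => [/dvdnP[m ->]|nd]; last first.
  apply/esym/big1 => i _; rewrite !pcoef_sigmaBR.
  case: ifP => d; rewrite ?mul0r //; case: ifP => d'; rewrite ?mulr0 //.
  move: (dvdn_add d d'); rewrite subnKC ?nd // -ltnS; exact: ltn_ord.
rewrite mulnK // rmorph_sum mulnC.
transitivity (\sum_(i < m.+1) sigmaL iota (pcoef f i) * sigmaL iota (pcoef g (m - i))).
  by apply: eq_bigr => i _; rewrite rmorphM.
rewrite -(sum_dvd (fun i => sigmaL iota (pcoef f i) * sigmaL iota (pcoef g (m - i))) m q_gt0).
apply: eq_bigr => i _; rewrite !pcoef_sigmaBR; case: ifP => d; last by rewrite mul0r.
have le_i : (i <= q * m)%N by rewrite -ltnS.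
rewrite dvdn_subr ?dvdn_mulr // d; congr (_ * sigmaL iota (pcoef g _)).
by case/dvdnP: d => r ->; rewrite mulnC -mulnBr mulnC !mulnK // mulKn.
Qed.
HB.instance Definition _ := GRing.isZmodMorphism.Build _ _ sBR sigmaBR_zmod.
HB.instance Definition _ := GRing.isMonoidMorphism.Build _ _ sBR sigmaBR_monoid.

Lemma sigmaBRC x : sBR (fpsC x) = fpsC (sigmaL iota x).
Proof.
apply: fpsP => j; rewrite pcoef_sigmaBR !pcoefC; case: j => [|j]; first by rewrite dvdn0 div0n.
case: ifP => // /dvdnP[[|r]] // e; rewrite e mulnK //= rmorph0.
by rewrite -e.
Qed.

Lemma sigmaBRX : sBR (fpsX L) = fpsX L ^+ q.
Proof.
apply: fpsP => j; rewrite pcoef_sigmaBR pcoefXn pcoefX.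
case: ifP => [/dvdnP[r ->]|nd].
  rewrite mulnK //; case: r => [|[|r]] /=.
  - by rewrite mul0n rmorph0 ltn_eqF.
  - by rewrite mul1n eqxx rmorph1.
  - by rewrite rmorph0 gtn_eqF // -{1}[q]mul1n ltn_pmul2r.
by case: eqP => // e; rewrite e dvdnn in nd.
Qed.

Definition tfactor i : FL := 1 - fpsC z^-1 * fpsX L ^+ (q ^ i)%N.
Definition tprod M : FL := \prod_(i < M) tfactor i.

Lemma sigmaBR_factor i : sBR (tfactor i) = tfactor i.+1.
Proof.
rewrite rmorphB rmorph1 rmorphM rmorphXn /= sigmaBRC sigmaBRX fmorphV /= sigmaL_z.
by rewrite -exprM -expnS.
Qed.

Lemma tprodS M : tprod M.+1 = tfactor 0 * sBR (tprod M).
Proof.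
rewrite /tprod big_ord_recl rmorph_prod; congr (_ * _); apply: eq_bigr => i _.
by rewrite lift0 -sigmaBR_factor.
Qed.

Lemma tprod_coef M j : (j < M)%N -> pcoef (tprod M) j = pcoef t j.
Proof.
elim: M => // M IH; rewrite ltnS leq_eqVlt => /orP[/eqP -> //|lt_jM].
have e : tprod M.+1 = tprod M * tfactor M by rewrite /tprod big_ord_recr.
rewrite -IH // e /tfactor mulrBr mulr1 pcoefD pcoefN mulrA mulrC pcoefXnM.
by rewrite (ltn_trans lt_jM (leq_expq F M)) subr0.
Qed.

Lemma sigmaBR_coef (f g : FL) n : (forall j, (j <= n)%N -> pcoef f j = pcoef g j) ->
  forall j, (j <= n)%N -> pcoef (sBR f) j = pcoef (sBR g) j.
Proof.
move=> fg j le_jn; rewrite !pcoef_sigmaBR fg //.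
exact: leq_trans (leq_div _ _) le_jn.
Qed.

Lemma tminusE : t = tfactor 0 * sBR t.
Proof.
apply: fpsP => j; rewrite -(@tprod_coef j.+2) ?ltnS ?leqnSn // tprodS !pcoefM.
apply: eq_bigr => i _; congr (_ * _).
apply: (@sigmaBR_coef _ _ j); last exact: leq_subr.
by move=> u le_u; rewrite tprod_coef.
Qed.

Lemma tminus_coef j : pcoef t j = pcoef (sBR t) j -
  (if j is j'.+1 then z^-1 * pcoef (sBR t) j' else 0).
Proof.
have -> : pcoef t j = pcoef (tfactor 0 * sBR t) j by congr pcoef; exact: tminusE.
move: (sBR t) => g.
rewrite /tfactor.
rewrite (expn0 q).
rewrite (expr1 (fpsX L)).
move: (z^-1) => w.
rewrite mulrBl mul1r.
rewrite pcoefD pcoefN -mulrA.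
rewrite pcoefCM.
rewrite pcoefXM.
by case: j => //; rewrite mulr0.
Qed.

Lemma tminus0 : pcoef t 0 = 1.
Proof.
by rewrite -(@tprod_coef 1) // /tprod big_ord1 /tfactor pcoefD pcoefN pcoefCM pcoefXn mulr0 subr0.
Qed.

Lemma tminus_unit : t \is a GRing.unit.
Proof. by rewrite fps_unitE tminus0 oner_neq0. Qed.

Lemma lcoef_sigmaBR (f : FL) j i : lcoef (pcoef (sBR f) j) i != 0 ->
  (q %| j)%N /\ lcoef (pcoef f (j %/ q)) i != 0.
Proof.
rewrite pcoef_sigmaBR; case: ifP => [d|_]; last by rewrite lcoef0 eqxx.
rewrite lcoef_sigmaL => h; split=> //; apply: contraNneq h => ->.
by rewrite expr0n gtn_eqF.
Qed.

(** A monomial pi^j z^(-n) of the product uses n distinct factors, so j >= 1 + q + ... + q^(n-1) >=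
    2^n - 1; the induction reads this off t = (1 - pi/z) sigma(t). *)
Lemma tminus_supp j i : lcoef (pcoef t j) i != 0 ->
  exists n : nat, i = - n%:Z /\ (2 ^ n <= j.+1)%N.
Proof.
elim/ltn_ind: j i => -[|j] IH i.
  rewrite tminus0 -(tofrac1 (fps l)) lcoef_tofrac; case: i => [[|n]|n] /=; rewrite ?eqxx // => _.
  by exists 0%N.
rewrite tminus_coef lcoefB => h.
have [h1|h1] := eqVneq (lcoef (pcoef (sBR t) j.+1) i) 0; last first.
  have [d nz] := lcoef_sigmaBR h1.
  have [n [-> le_n]] := IH _ (ltn_Pdiv (card_gt1 F) (ltn0Sn j)) _ nz.
  by exists n; split=> //; apply: leq_trans le_n _; rewrite ltnS leq_div.
have h2 : lcoef (pcoef (sBR t) j) (i + 1) != 0.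
  move: h; rewrite h1 sub0r oppr_eq0 -exprN1 lcoefZ opprK //.
have [d nz] := lcoef_sigmaBR h2.
have lt_jq : (j %/ q < j.+1)%N by rewrite ltnS leq_div.
have [n [ei le_n]] := IH _ lt_jq _ nz.
exists n.+1; split; first by lia.
rewrite expnS; apply: leq_trans (_ : 2 * (j %/ q).+1 <= _)%N; first by rewrite leq_mul2l.
have : (2 * (j %/ q) <= j)%N.
  by rewrite -{2}(divnK d) mulnC leq_mul2l card_gt1 orbT.
lia.
Qed.

Lemma sqr_le_exp2 n : (4 <= n)%N -> (n ^ 2 <= 2 ^ n)%N.
Proof.
elim: n => // n IH; rewrite leq_eqVlt => /orP[/eqP <- //|le_n].
have := IH le_n; rewrite -!mulnn (expnS 2 n); move: (2 ^ n)%N => y; nia.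
Qed.

Lemma inBR_tminus : inBR t.
Proof.
move=> s c s0.
(* Past a + 4 one has j + 1 >= 2^n >= n^2 >= (a + 4) n, so j >= a n + a, and a exceeds both s and
   c. *)
pose a := Num.bound (`|c| + s).
have ca : `|c| + s < a%:R by apply: archi_boundP; rewrite addr_ge0 // ltW.
exists (a + 4)%N => n le_n j; rewrite -[pcoef (BRcoef _ _) _]/(lcoef (pcoef t j) (- n%:Z)).
move=> /tminus_supp[m [/oppr_inj[em] le_m]]; rewrite -em in le_m.
have le_j : (a * n + a <= j)%N.
  have h4 : (4 <= n)%N by apply: leq_trans le_n; rewrite leq_addl.
  have h := leq_trans (sqr_le_exp2 h4) le_m.
  move: h le_n; rewrite expnS expn1; nia.
rewrite lerBrDr; apply: (@le_trans _ _ (a * n + a)%:R); last by rewrite ler_nat.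
rewrite natrD natrM addrC; apply: lerD.
  by apply: ler_wpM2r; rewrite ?ler0n // ltW // (le_lt_trans _ ca) // lerDr.
rewrite ltW // (le_lt_trans (ler_norm c)) // (le_lt_trans _ ca) // lerDl ltW //.
Qed.

Lemma inBR_sigma (f : FL) : inBR f -> inBR (sBR f).
Proof.
move=> hf s c s0; have [n0 h] := hf s c s0; exists n0 => n /h{}h j.
rewrite -[pcoef (BRcoef _ _) _]/(lcoef (pcoef (sBR f) j) (- n%:Z)).
move=> /lcoef_sigmaBR[_ /h le]; apply: le_trans le _.
by rewrite lerD2r ler_nat leq_div.
Qed.

Lemma inBR1 : inBR (1 : FL).
Proof. exact: (inBR_C 1). Qed.

Definition tE : FL := expand (BRcoef (sBR t)).

Lemma transfer_tE : transfer (sBR t) tE.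
Proof. exact/inBR_transfer/inBR_sigma/inBR_tminus. Qed.

(** In sigma(t_-) the factors are 1 - pi^(q^i)/z with i >= 1, whose second terms have total order at
    least q - 1 >= 1. The factor 1 - pi/z of t_-, which vanishes at z = pi, is gone, so the
    expansion of sigma(t_-) is a unit. *)
Lemma wgt_sigma_tminus : wgt 1 (sBR t - 1).
Proof.
apply/wgtP => j i lt_i; apply/eqP; apply: contraT; rewrite pcoefD pcoefN pcoef1.
case: j lt_i => [|j] lt_i.
  by rewrite pcoef_sigmaBR dvdn0 div0n tminus0 rmorph1 subrr lcoef0 eqxx.
rewrite subr0 => /lcoef_sigmaBR[d /tminus_supp[n [ei le_n]]].
have lt_n : (n < 2 ^ n)%N by rewrite ltn_expl.
have le2 : (2 * (j.+1 %/ q) <= j.+1)%N.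
  by rewrite -{2}(divnK d) mulnC leq_mul2l card_gt1 orbT.
have pos : (0 < j.+1 %/ q)%N by rewrite divn_gt0 // dvdn_leq.
lia.
Qed.

Lemma tE_unit : tE \is a GRing.unit.
Proof.
have h : wgt 1 (tE - 1).
  by apply: transfer_wgt wgt_sigma_tminus; apply: transferB (transfer1 l); apply: transfer_tE.
have [g] := h 0%N; rewrite pcoefD pcoefN pcoef1 subr0 expr1z => e.
rewrite fps_unitE -[pcoef tE 0](subrK 1) e.
rewrite -[z]/(tofrac (fpsX l)) -tofracM -(tofrac1 (fps l)) -tofracD tofrac_eq0.
apply/eqP => /(congr1 (fun f => pcoef f 0))/eqP.
by rewrite pcoefD pcoefXM pcoef1 add0r oner_eq0.
Qed.

Lemma transfer_pow (f g : FL) n : transfer f g -> transfer (f ^+ n) (g ^+ n).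
Proof.
move=> fg; elim: n => [|n IH]; first exact: transfer1.
by rewrite !exprS; apply: transferM.
Qed.

Lemma expandBR_unit : expandBR iota (sBR t^-1) \is a GRing.unit.
Proof.
have st1 : sBR t * sBR t^-1 = 1 by rewrite -rmorphM mulrV ?tminus_unit // rmorph1.
(* [expandBR] selects some g with this property, so the unit property is shown for all of them:
   comparing two transfers gives g [tE] = 1. *)
have good g : (exists n, inBR (sBR t ^+ n * sBR t^-1) /\
    expand (BRcoef (sBR t ^+ n * sBR t^-1)) = tE ^+ n * g) -> g \is a GRing.unit.
  move=> [n [hn en]]; have := inBR_transfer hn; rewrite en => /transferM/(_ transfer_tE).
  rewrite -mulrA [sBR t^-1 * _]mulrC st1 mulr1 => tr.
  have e := transfer_uniq tr (transfer_pow n transfer_tE).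
  apply/unitrPr; exists tE; apply: (mulrI (unitrX n tE_unit)).
  by rewrite mulrA e mulr1.
have ex : [set g : FL | exists n, inBR (sBR t ^+ n * sBR t^-1) /\
    expand (BRcoef (sBR t ^+ n * sBR t^-1)) = tE ^+ n * g]%classic
    (tE^-1 * expand (BRcoef (sBR t ^+ 1 * sBR t^-1))).
  exists 1%N; split; first by rewrite expr1 st1; exact: inBR1.
  by rewrite !expr1 mulVKr ?tE_unit.
exact/good/(xgetPex 0 (ex_intro _ _ ex)).
Qed.
End TMinus.

(** * The Hodge-Pink structure *)

Section HodgePink.
Variables (F : finFieldType) (l : fieldType) (iota : {rmorphism F -> l}) (X : Hdata iota).
Local Notation R := (fps l).
Local Notation K := (laurent l).
Local Notation FL := (fps K).

Lemma lattice_span_rank1 (V : vectType (laurent K)) (S : V -> Prop) (v : V) :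
  (forall w, S w -> exists a : FL, w = tofrac a *: v) ->
  (exists2 u : FL, u \is a GRing.unit & S (tofrac u *: v)) ->
  forall w, lattice_span S w <-> exists a : FL, w = tofrac a *: v.
Proof.
move=> S_sub [u Uu Su] w; split=> [[m [a [b [Sb ->]]]]|[a ->]].
  have /choice[c bc] i := S_sub _ (Sb i).
  exists (\sum_i a i * c i); rewrite rmorph_sum scaler_suml; apply: eq_bigr => i _.
  by rewrite bc scalerA rmorphM.
exists 1%N, (fun=> a / u), (fun=> tofrac u *: v); split=> //.
by rewrite big_ord1 scalerA -tofracM divrK.
Qed.

Definition Vgen : 'rV[laurent K]_(\dim {:Hdelta X}) := const_mx 1.
Definition Dexp (d : Hdelta X) : FL := expandL (sigmaL iota (D_co d)).

Lemma row_gen (w : 'rV[laurent K]_(\dim {:Hdelta X})) : w = w 0 (D_idx X) *: Vgen.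
Proof. by apply/rowP => i; rewrite !mxE mulr1 (D_idxP i). Qed.

Lemma sigma_pullE d : sigma_pull iota d = tofrac (Dexp d) *: Vgen.
Proof. by rewrite [LHS]row_gen mxE. Qed.

Lemma Dexp_unit d : d != 0 -> Dexp d \is a GRing.unit.
Proof.
move=> d0; apply: expandL_unit; rewrite fmorph_eq0.
by apply: contraNneq d0 => /D_co_eq0 ->.
Qed.

Lemma hpP_E (c : HPchoice X) (w : hpV (HdeltaHP c)) :
  hpP w <-> exists a : FL, w = tofrac a *: Vgen.
Proof.
apply: lattice_span_rank1 => [_ [d ->]|]; first by exists (Dexp d); exact: sigma_pullE.
exists (Dexp (Dgen X)); first exact/Dexp_unit/Dgen_neq0.
by exists (Dgen X); rewrite /= sigma_pullE.
Qed.

Section Choice.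
Variable c : HPchoice X.

Lemma HPord1 : HPord c = 1.
Proof. exact: ordz_uniq (HPordP c) (det_frob_ord X). Qed.

Lemma Psi_nil : Psi c = [::].
Proof.
have /andP[/eqP sp] := Psi_basis c; rewrite /free sp D_dim /= size_map.
by rewrite eq_sym eqSS => /nilP.
Qed.

Lemma Theta_neq0 : Hloc (Pincl (Theta c)) != 0.
Proof.
have /andP[_ /free_not0] := Psi_basis c.
by apply; rewrite inE eqxx.
Qed.

Lemma hpQ_E (w : hpV (HdeltaHP c)) :
  hpQ w <-> exists a : FL, w = ((tK l)^-1 * tofrac a) *: Vgen.
Proof.
have e (x : FL) : ((tK l)^-1 * tofrac x) *: Vgen = tofrac x *: ((tK l)^-1 *: Vgen).
  by rewrite scalerA mulrC.
transitivity (exists a : FL, w = tofrac a *: ((tK l)^-1 *: Vgen)); last first.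
  by split=> -[a ->]; exists a; rewrite e.
have eT : tK l ^ (- HPord c) *: sigma_pull iota (Hloc (Pincl (Theta c))) =
   tofrac (Dexp (Hloc (Pincl (Theta c)))) *: ((tK l)^-1 *: Vgen).
  by rewrite HPord1 sigma_pullE scalerA -e exprN1.
apply: lattice_span_rank1 => [v|].
  rewrite Psi_nil => -[->|[]//]; exists (Dexp (Hloc (Pincl (Theta c)))).
  exact: eT.
exists (Dexp (Hloc (Pincl (Theta c)))); first exact/Dexp_unit/Theta_neq0.
by left; rewrite eT.
Qed.

Lemma hpP_hpQ (w : hpV (HdeltaHP c)) :
  hpP w <-> exists2 y : hpV (HdeltaHP c), hpQ y & w = tK l *: y.
Proof.
have t0 : tK l != 0 by exact: zL_neq0.
split=> [/hpP_E[a ->]|[y /hpQ_E[a ->] ->]]; last first.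
  by apply/hpP_E; exists a; rewrite scalerA mulVKf.
exists (((tK l)^-1 * tofrac a) *: Vgen); first by apply/hpQ_E; exists a.
by rewrite scalerA mulVKf.
Qed.
End Choice.

Lemma HPchoice_ex : inhabited (HPchoice X).
Proof.
have B : basis_of {:Hdelta X} (Hloc (Pincl (Pgen X)) :: map (@Hloc _ _ _ X) [::]).
  by rewrite -[Pgen X]scale1r Pincl_gen Hloc_gen tofrac1 scale1r Dgen_basis.
exact: (inhabits (MkHPchoice (@P_span F l iota X) B (det_frob_ord X))).
Qed.
End HodgePink.

(** * The Carlitz shtuka *)

Lemma map_scalar11 (A B : nzRingType) (h : A -> B) (a : A) :
  map_mx h (a%:M : 'M_1) = (h a)%:M.
Proof. by apply/matrixP => i j; rewrite !ord1 !mxE. Qed.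

Section CarlitzShtuka.
Variables (F : finFieldType) (l : fieldType) (iota : {rmorphism F -> l}).
Local Notation R := (fps l).
Local Notation K := (laurent l).
Local Notation FL := (fps K).
Local Notation z := (zL l).
Local Notation sBR := (sigmaBR iota).
Local Notation t := (tminus F l).

Lemma carlitz_inv : exists n (T' : 'M[fps R]_1), (zpi l)%:M *m T' = (zpi l ^+ n)%:M.
Proof. by exists 1%N, 1%:M; rewrite mulmx1. Qed.
Definition carlitzM : shtuka l := @Shtuka l 1 0 (zpi l)%:M carlitz_inv.

Lemma sh_tau_carlitz (A : comUnitRingType) (h : fps R -> A) : sh_tau h carlitzM = (h (zpi l))%:M.
Proof. by apply/matrixP => i j; rewrite !ord1 !mxE /= expr0 invr1 mul1r !mulr1n. Qed.

Lemma embBR_zpi : embBR (zpi l) = fpsC z - fpsX K.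
Proof.
apply: fpsP => j; rewrite pcoefD pcoefN pcoefC pcoefX.
have e : fps_map (fun b : R => pcoef b j) (zpi l) =
    (if j == 0%N then fpsX l else 0) - (if j == 1%N then 1 else 0).
  apply: fpsP => n; rewrite -[LHS]/(pcoef (pcoef (zpi l) n) j) /zpi /piR !(pcoefD, pcoefN).
  rewrite pcoefC pcoefX; case: n j => [|[|n]] [|[|j]];
  by rewrite ?(pcoefX, pcoef1, pcoef0, pcoefD, pcoefN) ?subr0.
rewrite -[LHS]/(tofrac (fps_map (fun b : R => pcoef b j) (zpi l))) e tofracD tofracN.
by congr (_ - _); case: ifP; rewrite ?tofrac0 ?tofrac1.
Qed.

Lemma redL_zpi : redL (zpi l) = z.
Proof.
rewrite /redL; congr tofrac; apply: fpsP => n.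
rewrite -[LHS]/(pcoef (pcoef (zpi l) n) 0) /zpi /piR pcoefD pcoefN.
rewrite pcoefC pcoefX; case: n => [|[|n]].
all: by rewrite ?(pcoefX, pcoef1, pcoef0, pcoefD, pcoefN) ?subr0.
Qed.

(** Restates z t_- = (z - pi) sigma(t_-): multiplication by 1 / t_- carries tau = z - pi to its
    reduction z. *)
Lemma tminusV : (fpsC z - fpsX K) * t^-1 = sBR t^-1 * fpsC z.
Proof.
have Ut := tminus_unit F l.
have st1 : sBR t * sBR t^-1 = 1 by rewrite -rmorphM mulrV // rmorph1.
have key : fpsC z * t = (fpsC z - fpsX K) * sBR t.
  have -> : fpsC z * t = fpsC z * (tfactor F l 0 * sBR t) by congr (_ * _); exact: tminusE.
  rewrite mulrA; congr (_ * _).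
  rewrite /tfactor expn0 expr1 mulrBr mulr1 mulrA -rmorphM /= divff ?zL_neq0 //.
  by rewrite rmorph1 mul1r.
rewrite -[fpsC z - _]mulr1 -st1 mulrA -key; move: (sBR _) (fpsC z) => b y.
by rewrite mulrAC mulrK // mulrC.
Qed.

Lemma carlitz_delta : is_delta iota (M := carlitzM) (t^-1)%:M.
Proof.
have Ut := tminus_unit F l.
split.
- move=> i j; rewrite !ord1 mxE mulr1n; exists 1%N.
  by rewrite expr1 mulrV //; exact: inBR1.
- exists t%:M; split; last by rewrite -scalar_mxM mulVr.
  move=> i j; rewrite !ord1 mxE mulr1n; exists 0%N.
  by rewrite expr0 mul1r; exact: inBR_tminus.
- rewrite !sh_tau_carlitz !map_scalar11 -!scalar_mxM redL_zpi embBR_zpi.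
  by rewrite tminusV.
- rewrite map_scalar11; congr (_%:M).
  have : pcoef (t * t^-1) 0 = 1 by rewrite mulrV // pcoef1.
  by rewrite pcoefM big_ord1 tminus0 mul1r.
Qed.
End CarlitzShtuka.

Section HPIso.
Variables (F : finFieldType) (l : fieldType) (iota : {rmorphism F -> l}).
Variables (X : Hdata iota) (c : HPchoice X).
Local Notation R := (fps l).
Local Notation K := (laurent l).
Local Notation FL := (fps K).
Local Notation t := (tminus F l).
Local Notation a0 := (D_co (Dgen X)).
Local Notation eps := (tofrac (expandL (sigmaL iota a0^-1))).

Definition Dmap (d : Hdelta X) : 'rV[laurent l]_1 := const_mx (D_co d / a0).
Lemma Dmap_linear : linear Dmap.
Proof.
move=> a d d'; apply/rowP => i; rewrite !mxE /D_co linearD linearZ mulrDl /=.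
by rewrite mulrA.
Qed.
HB.instance Definition _ := GRing.isLinear.Build _ _ _ _ Dmap Dmap_linear.

(** The factor [eps] is forced by compatibility with [Dmap]: it is the expanded sigma-image of the
    factor relating the coordinate in [vbasis] to the one along [Dgen]. *)
Definition Vmap (w : 'rV[laurent K]_(\dim {:Hdelta X})) : 'rV[laurent K]_1 :=
  const_mx (w 0 (D_idx X) * eps).
Lemma Vmap_linear : linear Vmap.
Proof. by move=> a d d'; apply/rowP => i; rewrite !mxE mulrDl mulrA. Qed.
HB.instance Definition _ := GRing.isLinear.Build _ _ _ _ Vmap Vmap_linear.

Lemma eps_neq0 : eps != 0.
Proof.
rewrite tofrac_eq0; have : expandL (sigmaL iota a0^-1) \is a GRing.unit.
  by apply: expandL_unit; rewrite fmorph_eq0 invr_eq0 D_co_gen.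
by apply: contraTneq => ->; rewrite unitr0.
Qed.

Lemma Dmap_bij : bijective Dmap.
Proof.
exists (fun x : 'rV_1 => x 0 0 *: Dgen X) => [d|x]; first by rewrite mxE -D_coE.
by apply/rowP => i; rewrite !ord1 mxE D_coZ mulfK // D_co_gen.
Qed.

Lemma Vmap_bij : bijective Vmap.
Proof.
exists (fun x : 'rV_1 => (x 0 0 / eps) *: Vgen X) => [w|x].
  by rewrite mxE mulfK ?eps_neq0 // -row_gen.
by apply/rowP => i; rewrite !ord1 !mxE mulr1 divfK // eps_neq0.
Qed.

Lemma carlitz_hp_iso : hp_iso (HdeltaHP c) (@shtukaHP F l iota (carlitzM l) (t^-1)%:M).
Proof.
have t0 : tK l != 0 by exact: zL_neq0.
pose f : {linear hpD (HdeltaHP c) -> hpD (@shtukaHP F l iota (carlitzM l) (t^-1)%:M)} := Dmap.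
pose g : {linear hpV (HdeltaHP c) -> hpV (@shtukaHP F l iota (carlitzM l) (t^-1)%:M)} := Vmap.
exists f, g; split.
- exact: Dmap_bij.
- exact: Vmap_bij.
- move=> d; rewrite /= [d in LHS]D_coE Dfrob_scale; apply/rowP => i; rewrite !ord1.
  rewrite mxE D_coZ mulfK ?D_co_gen // sh_tau_carlitz redL_zpi mul_mx_scalar !mxE.
  by rewrite mulrC.
- move=> d; apply/rowP => i; rewrite !ord1 !mxE -[D_idx X]/(D_idx X) -/(D_co d).
  by rewrite -tofracM -expandLM -rmorphM.
move=> v; rewrite hpQ_E.
have eq_inv : invmx (sh_tau (@expandRz l) (carlitzM l)) = ((tK l)^-1)%:M.
  by rewrite sh_tau_carlitz expandRz_zpi invmx_scalar.
(* u is the Frobenius pullback of delta, expanded in z - pi. As it is a unit, only the inverse of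
   tau shapes the lattice, which is t^(-1) K[[t]]. *)
set u := expandBR iota (sigmaBR iota t^-1).
have Uu : u \is a GRing.unit by exact: expandBR_unit.
have ut : tofrac u != 0 :> laurent K.
  by rewrite tofrac_eq0; apply: contraTneq Uu => ->; rewrite unitr0.
have eU : tofrac u * tofrac u^-1 = 1 :> laurent K by rewrite -tofracM mulrV // tofrac1.
pose e' := expandL (sigmaL iota a0).
have ee : tofrac e' * eps = 1.
  by rewrite -tofracM -expandLM -rmorphM divff ?D_co_gen // rmorph1 expandL1 tofrac1.
rewrite /= eq_inv map_scalar11; split=> [[a ->]|[x ex]].
  exists (const_mx (a * expandL (sigmaL iota a0^-1) / u)).
  rewrite mul_mx_scalar mul_mx_scalar; apply/rowP => i; rewrite !ord1 !mxE mulr1 -/u.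
  rewrite !tofracM [RHS]mulrCA; move: eU; move: (tofrac u) (tofrac u^-1) (tofrac a) eps (tK l)^-1.
  by move=> y y' b e s yy; rewrite -[LHS]mulr1 -yy; ring.
exists (x 0 0 * u * e').
move: ex; rewrite mul_mx_scalar mul_mx_scalar => /rowP/(_ 0); rewrite !mxE -/u => ex.
rewrite [LHS]row_gen; congr (_ *: _).
apply: (mulIf eps_neq0); rewrite ex !tofracM -!mulrA ee mulr1.
by ring.
Qed.
End HPIso.

(** * Shtukas with the isocrystal of H_delta(E) *)

Section Zpi.
Variable l : fieldType.
Local Notation R := (fps l).
Local Notation zpi := (zpi l).

(* The quotient of f by z - pi; the remainder is the value of f at z = pi. *)
Definition zpi_quo (f : fps R) : fps R :=
  Fps (fun k => Fps (fun j => \sum_(i < j.+1) pcoef (pcoef f (k + i.+1)) (j - i))).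

Lemma zpi_quoE f k : pcoef (zpi_quo f) k = pcoef f k.+1 + piR l * pcoef (zpi_quo f) k.+1.
Proof.
apply: fpsP => j; rewrite pcoefD pcoefXM /= big_ord_recl /= subn0 addn1; congr (_ + _).
case: j => [|j]; first by rewrite big_ord0.
by apply: eq_bigr => i _; rewrite /= addSnnS.
Qed.

Lemma zpiM_coef (g : fps R) k : pcoef (zpi * g) k =
  (if k is k'.+1 then pcoef g k' else 0) - piR l * pcoef g k.
Proof. by rewrite /Defs.zpi mulrBl pcoefD pcoefN pcoefCM pcoefXM. Qed.

Lemma zpi_div f : exists g r, f = zpi * g + fpsC r.
Proof.
exists (zpi_quo f), (pcoef f 0 + piR l * pcoef (zpi_quo f) 0).
apply: fpsP => -[|k]; rewrite pcoefD zpiM_coef pcoefC.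
  by rewrite sub0r addrCA addNr addr0.
rewrite addr0; exact: (esym (etrans (congr1 (fun x => x - _) (zpi_quoE f k)) (addrK _ _))).
Qed.

(** Comparing coefficients gives g_k = pi g_(k+1) for all k, so g_0 is divisible by every power of
    pi and vanishes. *)
Lemma zpi_dvdC (g : fps R) r : zpi * g = fpsC r -> r = 0.
Proof.
move=> e.
have step k : pcoef g k = piR l * pcoef g k.+1.
  have := congr1 (fun f => pcoef f k.+1) e; rewrite zpiM_coef pcoefC /=.
  by move/eqP; rewrite subr_eq0 => /eqP.
have dv n : forall k, exists y, pcoef g k = piR l ^+ n * y.
  elim: n => [|n IH] k; first by exists (pcoef g k); rewrite expr0 mul1r.
  have [y ey] := IH k.+1; exists y; by rewrite step ey exprS mulrA.
have g0 : pcoef g 0 = 0 by apply: (proj1 (fpsX_complete l)) => n; exact: dv.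
have := congr1 (fun f => pcoef f 0) e; rewrite zpiM_coef pcoefC /= g0 mulr0 subr0.
by move=> <-.
Qed.

(** Setting z = pi identifies R[[z]] / (z - pi) with the domain R; the remainders r and s are the
    values. *)
Lemma zpi_prime (a b g : fps R) : a * b = zpi * g ->
  (exists a', a = zpi * a') \/ (exists b', b = zpi * b').
Proof.
have [a' [r ea]] := zpi_div a; have [b' [s eb]] := zpi_div b => e.
have : zpi * (g - a' * b - fpsC r * b') = fpsC (r * s).
  by rewrite rmorphM !mulrBr -e ea eb; ring.
move/zpi_dvdC/eqP; rewrite mulf_eq0 => /orP[]/eqP r0; [left; exists a'|right; exists b'].
  by rewrite ea r0 rmorph0 addr0.
by rewrite eb r0 rmorph0 addr0.
Qed.

Lemma zpi_neq0 : zpi != 0.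
Proof.
apply/eqP => /(congr1 (fun f => pcoef f 1))/eqP.
by rewrite pcoefD pcoefN pcoefC pcoefX subr0 oner_eq0.
Qed.

Lemma zpi_pow_factor n (s s' : fps R) : s * s' = zpi ^+ n ->
  exists m u, u \is a GRing.unit /\ s = u * zpi ^+ m.
Proof.
elim: n s s' => [|n IH] s s' e.
  exists 0%N, s; rewrite mulr1; split=> //; apply/unitrPr; by exists s'.
have can x y : zpi * x = zpi * y -> x = y by exact: (mulfI zpi_neq0).
have [[a ea]|[b eb]] := zpi_prime (etrans e (exprS _ _)).
  have [|m [u [Uu eu]]] := IH a s'; last by exists m.+1, u; rewrite ea eu exprS mulrCA.
  by apply: can; rewrite mulrA -ea e exprS.
by apply: (IH s b); apply: can; rewrite mulrCA -eb e exprS.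
Qed.
End Zpi.

Section Red.
Variable l : fieldType.
Definition redR : fps (fps l) -> fps l := fps_map (fun b : fps l => pcoef b 0).
Lemma redR_zmod : zmod_morphism redR.
Proof. by move=> f g; apply: fpsP. Qed.
Lemma redR_monoid : monoid_morphism redR.
Proof.
have e f : redR f = fps_map (@fps_at0 l) f by apply: fpsP.
by split=> [|f g]; rewrite !e ?rmorph1 ?rmorphM.
Qed.
HB.instance Definition _ := GRing.isZmodMorphism.Build _ _ redR redR_zmod.
HB.instance Definition _ := GRing.isMonoidMorphism.Build _ _ redR redR_monoid.
End Red.

(** * Lang's trick over R[[z]] *)

Section Lang.
Variables (F : finFieldType) (l : fieldType) (iota : {rmorphism F -> l}).
Local Notation R := (fps l).
Local Notation q := #|F|.
Local Notation iotaR := ((@fpsC l) \o iota).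
Local Notation sig := (fps_map (frobq iotaR)).
Local Notation red := (@redR l).
Local Notation P := (fpsC (piR l) : fps R).

Lemma red_dvd (f : fps R) : red f = 0 -> exists g, f = P * g.
Proof.
move=> f0; exists (fps_map (fps_shift 1) f); apply: fpsP => n; rewrite pcoefCM.
have h k : (k < 1)%N -> pcoef (pcoef f n) k = 0.
  by case: k => // _; have := congr1 (fun h => pcoef h n) f0.
exact: fps_dvdX h.
Qed.

Lemma red_P (g : fps R) : red (P * g) = 0.
Proof. by apply: fpsP => n; rewrite -[LHS]/(pcoef (pcoef (P * g) n) 0) pcoefCM pcoefXM. Qed.

(** Frobenius sends pi^n to pi^(q n), and q n >= n + 1 once n > 0; this is the contraction behind
    [lang_unit]. *)
Lemma sig_P n (g : fps R) : (0 < n)%N -> exists h, sig (P ^+ n * g) = P ^+ n.+1 * h.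
Proof.
move=> n0; rewrite rmorphM rmorphXn /= fpsC_map.
have -> : fpsC (frobq iotaR (piR l)) = P ^+ q by rewrite -rmorphXn.
rewrite -exprM; have /subnKC <- : (n.+1 <= q * n)%N.
  by move: (card_gt1 F) n0; move: q => Q; nia.
by move: (sig g) => y; rewrite exprD -mulrA; eexists.
Qed.

(* x |-> u * sig x is a contraction on the lifts of c. *)
Lemma lang_unit (u : fps R) (c : fps l) : c \is a GRing.unit -> c = phi iota c * red u ->
  exists2 C, C \is a GRing.unit & C = u * sig C.
Proof.
move=> Uc ec; pose C n := iter n (fun x => u * sig x) (fps_map (@fpsC l) c).
have C0 : red (C 0%N) = c by apply: fpsP.
have C1 : red (C 1%N) = c.
  rewrite rmorphM mulrC [RHS]ec; congr (_ * _); apply: fpsP => n.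
  by rewrite -[LHS]/(pcoef (fpsC (pcoef c n) ^+ q) 0) -rmorphXn.
have step n : exists y, C n.+1 - C n = P ^+ n.+1 * y.
  elim: n => [|n [y IH]].
    have [|g eg] := @red_dvd (C 1%N - C 0%N); last by exists g.
    by rewrite rmorphB /= C0 C1 subrr.
  have [h eh] := @sig_P n.+1 y isT; exists (u * h).
  rewrite mulrCA -eh -IH rmorphB mulrBr; reflexivity.
have CS n : C n.+1 = u * sig (C n) by [].
clearbody C.
have [sep lim] := fps_complete (fpsX_complete l).
have [|D hD] := lim C.
  by move=> n; have [y ->] := step n; exists (P * y); rewrite exprSr mulrA.
exists D.
  have : red D = c.
    have [y ey] := hD 1%N; have e : D = P * y + C 1%N by rewrite -[P]expr1 -ey subrK.
    by rewrite e rmorphD /= C1 red_P add0r.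
  move=> e; rewrite -[_ \is a GRing.unit]/(pcoef D 0 \is a GRing.unit) fps_unitE.
  by move: Uc; rewrite -e fps_unitE.
apply/eqP; rewrite -subr_eq0; apply/eqP/sep => n.
have [y ey] := hD n.+1; have [y' ey'] := hD n.+2; have [h eh] := @sig_P n.+1 y isT.
exists (P ^+ 2 * (y' - u * h)).
have -> : D - u * sig D = (D - C n.+2) - u * sig (D - C n.+1).
  by rewrite [C n.+2]CS rmorphB mulrBr opprB addrA subrK.
have eP : P ^+ n.+2 = P ^+ n * P ^+ 2 by rewrite -exprD addn2.
rewrite ey' ey eh eP; move: (P ^+ n) (P ^+ 2) => A B.
by rewrite mulrBr mulrBr !mulrA [u * A]mulrC -[A * u * B]mulrA [u * B]mulrC mulrA.
Qed.
End Lang.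

(** * Invariants of any shtuka with this isocrystal *)

Section Classification.
Variables (F : finFieldType) (l : fieldType) (iota : {rmorphism F -> l}).
Local Notation q := #|F|.
Local Notation R := (fps l).
Local Notation K := (laurent l).
Local Notation z := (zL l).
Local Notation iotaR := ((@fpsC l) \o iota).
Local Notation sigR := (fps_map (frobq iotaR)).

Lemma redLM (f g : fps R) : redL (f * g) = redL f * redL g.
Proof. by rewrite -tofracM -[RHS]/(tofrac (redR f * redR g)) -rmorphM. Qed.

Lemma redLX (f : fps R) n : redL (f ^+ n) = redL f ^+ n.
Proof. by rewrite -[LHS]/(tofrac (redR (f ^+ n))) rmorphXn tofracXn. Qed.

Lemma redR_unit (u : fps R) : u \is a GRing.unit -> redR u \is a GRing.unit.
Proof. exact: rmorph_unit. Qed.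

(** sigma preserves the order in z, so that of c0 cancels and 1 = m - p remains; the unit part of c0
    then solves the equation that [lang_unit] requires modulo pi. *)
Lemma frob_ord (c0 : K) (u : fps R) (m p : nat) : c0 != 0 -> u \is a GRing.unit ->
  z * c0 = sigmaL iota c0 * (redL (zpi l) ^- p * redL (u * zpi l ^+ m)) ->
  m = p.+1 /\ exists2 c : R, c \is a GRing.unit & c = phi iota c * redR u.
Proof.
move=> c00 Uu; have [k [c [Uc ->]]] := laurent_factor c00.
rewrite redLM redLX redL_zpi rmorphM /= sigmaL_zX sigmaL_tofrac -[redL u]/(tofrac (redR u)).
have e1 : z * (z ^ k * tofrac c) = z ^ (k + 1) * tofrac c.
  by rewrite expfzDr ?zL_neq0 // expr1z mulrA [z * _]mulrC.
have e2 : z ^ k * tofrac (phi iota c) * (z ^- p * (tofrac (redR u) * z ^+ m)) =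
    z ^ (k + (m%:Z - p%:Z)) * tofrac (phi iota c * redR u).
  rewrite !expfzDr ?zL_neq0 // -exprnN -exprnP tofracM; move: (z ^ k) (z ^- p) (z ^+ m) => a b d.
  by ring.
rewrite e1 e2 => e.
have Uc' : phi iota c * redR u \is a GRing.unit by rewrite unitrM phi_unit // redR_unit.
have o1 : is_ordz (z ^ (k + 1) * tofrac c) (k + 1) by exists c.
have o2 : is_ordz (z ^ (k + 1) * tofrac c) (k + (m%:Z - p%:Z)) by exists (phi iota c * redR u).
have ek := ordz_uniq o1 o2.
split; first by lia.
exists c => //; apply: tofrac_inj; move: e; rewrite -ek.
by apply/mulfI/expfz_neq0/zL_neq0.
Qed.

Section OverKsep.
Variables (Ksep : fieldType) (jK : {rmorphism K -> Ksep}).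
Definition jRm : {rmorphism R -> Ksep} := jK \o (@FracField.tofrac _).
Definition sigK : fps Ksep -> fps Ksep := fps_map (frobq (jRm \o iotaR)).
HB.instance Definition _ := GRing.RMorphism.on sigK.
Local Notation h := (fps_map jRm).

Lemma jRm_neq0 b : b != 0 -> jRm b != 0.
Proof. by move=> b0; rewrite fmorph_eq0 tofrac_eq0. Qed.

Lemma h_zpi : h (zpi l) = fpsX Ksep - fpsC (jRm (piR l)).
Proof. by rewrite rmorphB /= fpsX_map fpsC_map. Qed.

Lemma h_zpi_unit : h (zpi l) \is a GRing.unit.
Proof.
rewrite h_zpi fps_unitE pcoefD pcoefN pcoefC pcoefX sub0r.
rewrite oppr_eq0 jRm_neq0 //; apply/eqP => /(congr1 (fun f => pcoef f 1))/eqP.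
by rewrite pcoefX oner_eq0.
Qed.

Lemma sigK_h f : sigK (h f) = h (sigR f).
Proof. by apply: fpsP => n; exact: (esym (rmorphXn jRm q (pcoef f n))). Qed.
End OverKsep.

(** The tau-invariants of M are those of the Carlitz shtuka times a fixed vector. That vector is
    defined over R[[z]], hence Galois-invariant, so it leaves the character unchanged. *)
Lemma shtuka_class (X : Hdata iota) (c : HPchoice X) (M : shtuka l) Delta :
  hp_iso (HdeltaHP c) (@shtukaHP F l iota M Delta) ->
  exists rC : 'rV[fps R]_(sh_rank M), forall (Ksep : fieldType) (jK : {rmorphism K -> Ksep}),
   (forall x : 'rV[fps Ksep]_(sh_rank M),
     map_mx (fps_map (fun b => b ^+ q)) x *m sh_tau (fps_map (jR jK)) M = x <->
     exists2 y, sigK jK y * fps_map (jRm jK) (zpi l) = y & x = y *: map_mx (fps_map (jRm jK)) rC) /\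
   (forall y : fps Ksep, y *: map_mx (fps_map (jRm jK)) rC = 0 -> y = 0).
Proof.
case=> f [_ [fb _ fF _ _]].
case: M Delta f fb fF => r p mat minv Delta f fb fF.
have er : r = 1%N.
  have f0 : lker (linfun f) == 0%VS.
    by apply/lker0P => x y; rewrite !lfunE; exact: bij_inj.
  have fs : (linfun f @: {:Hdelta X})%VS = {:'rV[K]_r}%VS.
    apply/eqP; rewrite eqEsubv subvf /=; apply/subvP => y _.
    have [g _ gf] := fb; rewrite -(gf y) -(lfunE f); exact/memv_img/memvf.
  have dr : \dim {:'rV[K]_r} = r by rewrite dimvf /dim /= mul1n.
  have := limg_dim_eq (U := {:Hdelta X}) (f := linfun f).
  by rewrite (eqP f0) capv0 => /(_ erefl); rewrite fs dr => ->; exact: (D_dim X).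
subst r.
have [s' [n es]] : exists s' n, mat 0 0 * s' = zpi l ^+ n.
  have [n [T' /matrixP/(_ 0 0)]] := minv.
  by rewrite !mxE big_ord1 mulr1n => e; exists (T' 0 0), n.
have [m [u [Uu eu]]] := zpi_pow_factor es.
pose c0 := f (Dgen X) 0 0.
have c00 : c0 != 0.
  apply: contraNneq (Dgen_neq0 X) => c0E; apply/eqP/(bij_inj fb); rewrite linear0.
  by apply/rowP => i; rewrite ord1 [LHS]c0E mxE.
have [|em [cc Ucc ec]] := @frob_ord c0 u m p c00 Uu.
  have := fF (Dgen X); rewrite /= -[Dgen X in LHS]scale1r Dfrob_scale rmorph1 mul1r linearZ.
  by move=> /rowP/(_ 0); rewrite !mxE big_ord1 !mxE -/c0 eu.
have [C UC eC] := lang_unit Ucc ec.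
exists (const_mx C) => Ksep jK.
pose h : {rmorphism fps R -> fps Ksep} := fps_map (jRm jK).
have hz : h (zpi l) \is a GRing.unit by exact: h_zpi_unit.
have UhC : h C \is a GRing.unit by exact: (rmorph_unit h).
split; last first.
  move=> y /rowP/(_ 0); rewrite !mxE => /eqP; rewrite mulf_eq0 => /orP[/eqP//|/eqP e].
  by move: UhC; rewrite [h C]e unitr0.
move=> x.
have -> : sh_tau (fps_map (jR jK)) (Shtuka p minv) = (h u * h (zpi l))%:M.
  apply/matrixP => i j; rewrite !ord1.
  transitivity (h (zpi l) ^- p * h (mat 0 0)); first by rewrite !mxE.
  rewrite eu em exprS (rmorphM h) (rmorphM h) (rmorphXn h) !mxE mulr1n mulrCA; congr (_ * _).
  by rewrite mulrCA mulVr ?mulr1 ?unitrX.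
(* Writing an invariant as y C absorbs the unit u and leaves sigma(y) (z - pi) = y. *)
have eh : h C = h u * sigK jK (h C) by rewrite sigK_h -[in RHS]rmorphM -eC.
have UG : sigK jK (h C) \is a GRing.unit by exact: rmorph_unit.
have eM (a b : fps Ksep) : (const_mx a : 'rV_1) *m b%:M = const_mx (a * b).
  by apply/rowP => i; rewrite mul_mx_scalar !mxE mulrC.
have ex (w : 'rV[fps Ksep]_1) : w = const_mx (w 0 0) by apply/rowP => i; rewrite ord1 mxE.
have -> : map_mx (fps_map (fun b => b ^+ q)) x = const_mx (sigK jK (x 0 0)) :> 'rV_1.
  by apply/rowP => i; rewrite ord1 !mxE.
rewrite eM map_const_mx; split=> [/rowP/(_ 0)|[y ey ->]].
  rewrite !mxE => e; exists (x 0 0 / h C); last first.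
    by apply/rowP => i; rewrite ord1 !mxE divrK.
  have -> : sigK jK (x 0 0 / h C) = sigK jK (x 0 0) / sigK jK (h C) by rewrite rmorphM rmorphV.
  rewrite -[fps_map _ (zpi l)]/(h (zpi l)); apply: (mulIr UhC); rewrite divrK // -[RHS]e {2}eh.
  move: (sigK jK (x 0 0)) (h u) (h (zpi l)) UG; move: (sigK jK (h C)) => G a b d UG.
  by rewrite -[RHS]mulr1 -(mulVr UG); move: G^-1 => G'; ring.
have eS : sigK jK (y * h C) = sigK jK y * sigK jK (h C) by rewrite rmorphM.
apply/rowP => i; rewrite !mxE -[fps_map _ C]/(h C) eS -{2}ey -[fps_map _ (zpi l)]/(h (zpi l)) {2}eh.
by move: (sigK jK y) (sigK jK _) (h u) (h _) => a b d e; ring.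
Qed.
End Classification.

(** * Galois representations *)

Section RankOneRep.
Variables (F : finFieldType) (l : fieldType) (Ksep : fieldType) (jK : {rmorphism laurent l -> Ksep}).
Local Notation LF := (laurent F).
Local Notation galAut := (galAut jK).
Local Notation galRep := (galRep F jK).

Definition rank1_rep (V : galRep) (chi : galAut -> LF) : Prop :=
  exists v : rep_sp V, [/\ v != 0, forall u, exists k, u = k *: v &
    forall g, rep_act V g v = chi g *: v].

Section Lattice.
Variables (X : Type) (inX : X -> Prop) (addX : X -> X -> X) (scX : fps F -> X -> X).
Variables (gal : galAut -> X -> X) (e : X) (chi : galAut -> fps F).

Record rank1_lattice : Prop := Rank1Lattice {
  lat_in : forall v, inX v <-> exists a, v = scX a e;
  lat_add : forall a b, addX (scX a e) (scX b e) = scX (a + b) e;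
  lat_scale : forall a b, scX a (scX b e) = scX (a * b) e;
  lat_inj : forall a b, scX a e = scX b e -> a = b;
  lat_gal : forall g a, gal g (scX a e) = scX (chi g * a) e
}.
Hypothesis lat : rank1_lattice.

Lemma rational_rank1 V : is_rational_rep inX addX scX gal V ->
  rank1_rep V (fun g => tofrac (chi g)).
Proof.
case=> j jX jg; have in_e a : inX (scX a e) := proj2 (lat_in lat _) (ex_intro _ a erefl).
have je a : j (scX a e) = tofrac a *: j (scX 1 e).
  by rewrite -(ft_scale jX) // (lat_scale lat) mulr1.
exists (j (scX 1 e)); split=> [|u|g].
- apply/eqP => je0; have : j (scX 1 e) = j (scX 0 e) by rewrite [RHS]je je0 scaler0.
  move/(ft_eq jX (in_e 1) (in_e 0)) => [s s0].
  by rewrite !(lat_scale lat) => /(lat_inj lat)/eqP; rewrite mulr1 mulr0 (negbTE s0).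
- have [s [x [s0 /(lat_in lat)[a ->] eu]]] := ft_gen jX u.
  exists ((tofrac s)^-1 * tofrac a); rewrite -scalerA -je -eu scalerA mulVf ?scale1r //.
  by rewrite tofrac_eq0.
- have := jg g _ (in_e 1); by rewrite (lat_gal lat) mulr1 (je (chi g)).
Qed.

Lemma rational_ex : exists V, is_rational_rep inX addX scX gal V.
Proof.
pose j x : LF := xget 0 [set w | exists2 a, x = scX a e & w = tofrac a]%classic.
have je a : j (scX a e) = tofrac a.
  rewrite /j; apply: xget_unique; first by exists a.
  by move=> w [b /(lat_inj lat) -> ->].
pose act g : 'End(LF^o) := (tofrac (chi g) *: \1)%VF.
exists (@GalRep F l Ksep jK (LF^o : vectType LF) act); exists j; first split.
- by move=> _ _ /(lat_in lat)[a ->] /(lat_in lat)[b ->]; rewrite (lat_add lat) !je tofracD.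
- by move=> s _ /(lat_in lat)[a ->]; rewrite (lat_scale lat) !je tofracM.
- move=> _ _ /(lat_in lat)[a ->] /(lat_in lat)[b ->].
  rewrite !je; split=> [/tofrac_inj ->|[s s0]]; first by exists 1; rewrite ?oner_neq0.
  by rewrite !(lat_scale lat) => /(lat_inj lat)/(mulfI s0) ->.
- move=> u; have [[a b] /= b0 ->] := fracP u.
  exists b, (scX a e); split=> //; first exact: (proj2 (lat_in lat _) (ex_intro _ a erefl)).
  by rewrite je /GRing.scale /= mulrCA divff ?mulr1 // tofrac_eq0.
by move=> g _ /(lat_in lat)[a ->]; rewrite /= /act scale_lfunE id_lfunE (lat_gal lat) !je tofracM.
Qed.
End Lattice.

Lemma dual_repE (V : galRep) g (lam : rep_sp (dual_rep V)) :
  rep_act (dual_rep V) g lam = (lam \o rep_act V (galV g))%VF.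
Proof.
pose f0 (mu : 'Hom(rep_sp V, LF^o)) := (mu \o rep_act V (galV g))%VF.
have f0_lin : linear f0 by move=> k a b; rewrite /f0 comp_lfunDl comp_lfunZl.
pose f1 : {linear 'Hom(rep_sp V, LF^o) -> 'Hom(rep_sp V, LF^o)} :=
  HB.pack f0 (GRing.isLinear.Build _ _ _ _ f0 f0_lin).
exact: (lfunE f1 lam).
Qed.

(** On the dual line g acts through chi(g^-1); the isomorphism is evaluation at the basis vector
    v. *)
Lemma rank1_dual_iso (V W : galRep) chi : rank1_rep V chi ->
  rank1_rep W (fun g => chi (galV g)) -> rep_iso (dual_rep V) W.
Proof.
move=> [v [v0 v_span v_act]] [w [w0 w_span w_act]].
pose f0 (lam : 'Hom(rep_sp V, LF^o)) : rep_sp W := (lam v : LF) *: w.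
have f0_lin : linear f0.
  by move=> k a b; rewrite /f0 add_lfunE scale_lfunE scalerDl -scalerA.
pose f1 : {linear 'Hom(rep_sp V, LF^o) -> rep_sp W} :=
  HB.pack f0 (GRing.isLinear.Build _ _ _ _ f0 f0_lin).
have f1E lam : linfun f1 lam = (lam v : LF) *: w by rewrite lfunE.
exists (linfun f1 : 'Hom(rep_sp (dual_rep V), rep_sp W)); split.
  have vfree : free [:: v] by rewrite seq1_free.
  pose lam0 : {linear rep_sp V -> LF^o} := coord [tuple v] ord0.
  have lam0v : lam0 v = 1 by have := coord_free ord0 ord0 (vfree : free [tuple v]); rewrite /= => ->.
  have kP u : {k | u = k *: w} := cid (w_span u).
  have lamZ (lam : 'Hom(rep_sp V, LF^o)) k : lam (k *: v) = k * lam v by rewrite linearZ.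
  have lamv (b : LF) : (b *: linfun lam0 : 'Hom(rep_sp V, LF^o)) v = b.
    by rewrite scale_lfunE lfunE lam0v /GRing.scale /= mulr1.
  exists (fun u => sval (kP u) *: linfun lam0) => [lam|u]; last first.
    by rewrite f1E lamv; case: (kP u).
  apply/lfunP => x; have [k ->] := v_span x; rewrite !lamZ lamv; congr (_ * _).
  case: (kP _) => b /=; rewrite f1E => /eqP; rewrite -subr_eq0 -scalerBl scaler_eq0 (negbTE w0) orbF.
  by rewrite subr_eq0 => /eqP.
move=> g lam; rewrite !f1E.
have -> : rep_act (dual_rep V) g lam v = lam (rep_act V (galV g) v).
  by rewrite dual_repE comp_lfunE.
by rewrite v_act !linearZ /= w_act scalerA [in RHS]mulrC -scalerA.
Qed.
End RankOneRep.

(** * Frobenius equations over the separable closure *)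

Section FieldSeries.
Variables (F : finFieldType) (l : fieldType) (iota : {rmorphism F -> l}).
Variables (Ksep : fieldType) (jK : {rmorphism laurent l -> Ksep}) (HK : is_sep_closure jK).
Local Notation q := #|F|.
Local Notation sig := (@sigK F l iota Ksep jK).
Local Notation jFm := (jRm jK \o ((@fpsC l) \o iota)).
Local Notation p := (jRm jK (piR l)).
Local Notation T := (fpsX Ksep - fpsC p).

Lemma card_nat0 : (q%:R : Ksep) = 0.
Proof.
have [c c_pr cF] := finPcharP F.
have cK : c \in [pchar Ksep] by rewrite (rmorph_pchar jFm).
have := card_gt1 F; rewrite (card_pprimeChar cF); set n := logn _ _.
by case: n => [|n] // _; rewrite expnS natrM (pcharf0 cK) mul0r.
Qed.

(** The derivative is 1 because q = 0 in Ksep; so a separably closed field is enough to find the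
    roots. *)
Lemma artin_separable (a b : Ksep) : separable_poly (a *: 'X^q + 'X + b%:P).
Proof.
rewrite separable_poly.unlock; have -> : (a *: 'X^q + 'X + b%:P)^`() = 1.
  rewrite !derivE -scaler_nat card_nat0 scale0r scaler0 add0r addr0.
  by [].
exact: coprimep1.
Qed.

Lemma artin_size (a b : Ksep) : a != 0 -> size (a *: 'X^q + 'X + b%:P) = q.+1.
Proof.
move=> a0; rewrite -addrA size_polyDl size_scale ?size_polyXn //.
by rewrite size_XaddC ltnS card_gt1.
Qed.

Lemma p_neq0 : p != 0.
Proof.
apply: jRm_neq0; apply/eqP => /(congr1 (fun f => pcoef f 1))/eqP.
by rewrite pcoefX oner_eq0.
Qed.

Lemma artin_root (b : Ksep) : exists y, p * y ^+ q + y = b.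
Proof.
have [|y] := (proj2 HK) _ (artin_separable p (- b)).
  by rewrite artin_size ?p_neq0 // ltnS (ltnW (card_gt1 F)).
rewrite /root !hornerE => /eqP e; exists y.
by apply/eqP; rewrite -subr_eq0 -e.
Qed.

Lemma artin_root0 : exists2 y, y != 0 & p * y ^+ q + y = 0.
Proof.
have eq : p *: 'X^q + 'X + 0%:P = 'X * (p *: 'X^(q.-1) + 1) :> {poly Ksep}.
  rewrite addr0 mulrDr mulr1 -scalerAr -exprS prednK //.
  exact: ltnW (card_gt1 F).
have := artin_separable p 0; rewrite eq separable_mul => /and3P[_ s _].
have sz : size (p *: 'X^(q.-1) + 1 : {poly Ksep}) = q.
  have q1 := card_gt1 F; rewrite size_polyDl size_scale ?p_neq0 ?size_polyXn ?size_poly1 //; lia.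
have [|y] := (proj2 HK) _ s; first by rewrite sz card_gt1.
rewrite /root !hornerE => /eqP e; exists y.
  apply/eqP => y0; move: e; rewrite y0 expr0n; case: eqP => [e|_].
    by move: (card_gt1 F) e; lia.
  by rewrite mulr0 add0r => /eqP; rewrite oner_eq0.
have -> : p * y ^+ q + y = y * (p * y ^+ q.-1 + 1).
  by rewrite mulrDr mulr1 mulrCA -exprS prednK // ltnW // card_gt1.
by rewrite e mulr0.
Qed.

Lemma sig_coef f n : pcoef (sig f) n = pcoef f n ^+ q. Proof. by []. Qed.

Lemma T_coef f n : pcoef (f * T) n = (if n is n'.+1 then pcoef f n' else 0) - p * pcoef f n.
Proof. by rewrite mulrC mulrBl pcoefD pcoefN pcoefXM pcoefCM. Qed.

(** Coefficientwise this reads pi x_0^q + x_0 = 0 and pi x_(n+1)^q + x_(n+1) = x_n^q, solved one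
    after the other; a nonzero x_0 makes x a unit. *)
Lemma period_ex : exists2 x : fps Ksep, x \is a GRing.unit & sig x * T = x.
Proof.
have [y0 y00 e0] := artin_root0.
have /choice[g gP] := fun b : Ksep => artin_root (b ^+ q).
exists (Fps (fun n => iter n g y0)); first by rewrite fps_unitE.
apply: fpsP => n; rewrite T_coef !sig_coef.
case: n => [|n]; first by rewrite sub0r; apply/esym/eqP; rewrite -addr_eq0 addrC; apply/eqP.
by apply/eqP; rewrite subr_eq addrC; apply/eqP; rewrite gP.
Qed.

Lemma fixed_const (y : Ksep) : y ^+ q = y -> exists a, y = jFm a.
Proof.
move=> ey; have := congr1 (map_poly jFm) (finField_genPoly F).
rewrite rmorphB rmorph_prod /= map_polyXn map_polyX => /(congr1 (fun r => r.[y])).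
rewrite !hornerE ey subrr => /esym/eqP; rewrite horner_prod prodf_seq_eq0 => /hasP[a _].
rewrite rmorphB /= map_polyX map_polyC /= !hornerE subr_eq0 => /eqP ->; by exists a.
Qed.

Lemma fixed_series (f : fps Ksep) : sig f = f -> exists a, f = fps_map jFm a.
Proof.
move=> ef; have h n : exists a, pcoef f n = jFm a.
  by apply: fixed_const; rewrite -{2}ef.
have [a aP] := choice h; exists (Fps a); exact: fpsP.
Qed.

Lemma const_fixed (a : fps F) : sig (fps_map jFm a) = fps_map jFm a.
Proof.
apply: fpsP => n; rewrite sig_coef -[pcoef (fps_map _ _) n]/(jFm (pcoef a n)).
by rewrite -rmorphXn expf_card.
Qed.
End FieldSeries.

(** * The lattice of invariants and the Tate module *)

Section Lattices.
Variables (F : finFieldType) (l : fieldType) (iota : {rmorphism F -> l}).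
Variables (Ksep : fieldType) (jK : {rmorphism laurent l -> Ksep}).
Local Notation q := #|F|.
Local Notation R := (fps l).
Local Notation sig := (@sigK F l iota Ksep jK).
Local Notation jFm := (jRm jK \o ((@fpsC l) \o iota)).
Local Notation p := (jRm jK (piR l)).
Local Notation T := (fpsX Ksep - fpsC p).
Local Notation hF := (fps_map jFm).
Local Notation h := (fps_map (jRm jK)).
Local Notation tscale := (@tate_scale F l iota Ksep jK).
Local Notation cz := (@carlitz F l Ksep jK).
Variable x : fps Ksep.
Hypotheses (Ux : x \is a GRing.unit) (ex : sig x * T = x).

Lemma hF_inj : injective hF.
Proof.
move=> a b ab; apply: fpsP => n; apply: (fmorph_inj jFm).
exact: (congr1 (fun f => pcoef f n) ab).
Qed.

(** The quotient of two solutions is fixed by Frobenius, hence lies in F_q[[z]]. *)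
Lemma solutions (y : fps Ksep) : sig y * T = y <-> exists a, y = hF a * x.
Proof.
split=> [ey|[a ->]]; last by rewrite rmorphM /= const_fixed -mulrA ex.
have [|a ea] := @fixed_series F l iota Ksep jK (y / x); last by exists a; rewrite -ea divrK.
have Usx : sig x \is a GRing.unit by exact: rmorph_unit.
have UT : T \is a GRing.unit by move: Ux; rewrite -{1}ex unitrM => /andP[].
have -> : sig (y / x) = sig y / sig x by rewrite rmorphM rmorphV.
by rewrite -[in RHS]ey -[in RHS]ex invrM // mulrA mulrK.
Qed.

Lemma omega_eq : sig x^-1 = T * x^-1.
Proof.
have Usx : sig x \is a GRing.unit by exact: rmorph_unit.
have -> : sig x^-1 = (sig x)^-1 by rewrite rmorphV.
by apply: (mulIr Usx); rewrite mulVr // mulrAC -{2}ex [T * _]mulrC mulrV // ex.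
Qed.

Lemma dual_solutions (y : fps Ksep) : sig y = T * y <-> exists a, y = hF a * x^-1.
Proof.
split=> [ey|[a ->]]; last by rewrite rmorphM /= const_fixed [in LHS]omega_eq mulrCA.
have [|a ea] := @fixed_series F l iota Ksep jK (y * x); last by exists a; rewrite -ea mulrK.
have -> : sig (y * x) = T * y * sig x by rewrite rmorphM /= ey.
by rewrite -[in RHS]ex mulrAC mulrC [T * _]mulrC.
Qed.

Section Gal.
Variable g : galAut jK.

Lemma gal_const (b : R) : g (jRm jK b) = jRm jK b.
Proof. exact: gal_fix. Qed.

Lemma gal_h (f : fps R) : fps_map g (h f) = h f.
Proof. by apply: fpsP => n; exact: gal_const. Qed.

Lemma gal_hF (f : fps F) : fps_map g (hF f) = hF f.
Proof. by apply: fpsP => n; exact: gal_const. Qed.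

Lemma gal_T : fps_map g T = T.
Proof. by rewrite rmorphB /= fpsX_map fpsC_map gal_const. Qed.

Lemma gal_sig (f : fps Ksep) : fps_map g (sig f) = sig (fps_map g f).
Proof. by apply: fpsP => n; exact: rmorphXn. Qed.

Definition chi : fps F := xget 0 [set a | fps_map g x = hF a * x]%classic.

Lemma chiP : fps_map g x = hF chi * x.
Proof.
have [a ea] : exists a, fps_map g x = hF a * x.
  by apply/solutions; rewrite -gal_sig -{1}gal_T -rmorphM /= ex.
by rewrite /chi; case: xgetP => // /(_ a) [].
Qed.
End Gal.

(** Applying g to the action of its inverse on x gives x = chi(g^-1) g(x), since g fixes
    F_q[[z]]. *)
Lemma omega_gal (g : galAut jK) : fps_map g x^-1 = hF (chi (galV g)) * x^-1.
Proof.
have e : x = hF (chi (galV g)) * fps_map g x.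
  rewrite -(gal_hF g) -rmorphM -chiP; apply: fpsP => n.
  by rewrite -[RHS]/(g (gal_inv g (pcoef x n))) gal_invK.
have Ug : fps_map g x \is a GRing.unit by exact: rmorph_unit.
have -> : fps_map g x^-1 = (fps_map g x)^-1 by rewrite rmorphV.
by apply: (mulIr Ug); rewrite mulVr // mulrAC -e mulrV.
Qed.

Lemma shtuka_lattice (M : shtuka l) (rC : 'rV[fps R]_(sh_rank M)) :
  (forall v : 'rV[fps Ksep]_(sh_rank M),
     map_mx (fps_map (fun b => b ^+ q)) v *m sh_tau (fps_map (jR jK)) M = v <->
     exists2 y, sig y * h (zpi l) = y & v = y *: map_mx h rC) ->
  (forall y : fps Ksep, y *: map_mx h rC = 0 -> y = 0) ->
  rank1_lattice (fun v : 'rV[fps Ksep]_(sh_rank M) =>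
       map_mx (fps_map (fun b => b ^+ q)) v *m sh_tau (fps_map (jR jK)) M = v)
    +%R (fun a v => fps_map (jF iota jK) a *: v) (fun g v => map_mx (fps_map g) v)
    (x *: map_mx h rC) chi.
Proof.
move=> sol inj; have jFE a : fps_map (jF iota jK) a = hF a by []; split.
- move=> v; rewrite sol h_zpi; split=> [[y /solutions[a ->] ->]|[a ->]].
    by exists a; rewrite scalerA.
  exists (hF a * x); last by rewrite scalerA.
  by apply/solutions; exists a.
- by move=> a b; rewrite -scalerDl !jFE rmorphD.
- by move=> a b; rewrite scalerA !jFE rmorphM.
- move=> a b; rewrite !jFE !scalerA => /eqP; rewrite -subr_eq0 -scalerBl -mulrBl => /eqP/inj/eqP.
  by rewrite (mulIr_eq0 _ (mulIr Ux)) subr_eq0 => /eqP/hF_inj.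
- move=> g a; apply/rowP => i; rewrite !jFE !mxE !rmorphM /= gal_h.
  rewrite gal_hF chiP; move: (hF a) (hF (chi g)) (h _) => A B C.
  by rewrite !mulrA [A * B]mulrC.
Qed.

(** The series starts at y_1, because y_0 = 0 in every compatible system. *)
Definition tseries (y : nat -> Ksep) : fps Ksep := Fps (fun n => y n.+1).
Definition omega : nat -> Ksep := fun n => if n is n'.+1 then pcoef x^-1 n' else 0.

Lemma tseriesP (y y' : nat -> Ksep) : y 0%N = y' 0%N -> tseries y = tseries y' -> y = y'.
Proof.
move=> e0 e; apply: funext => -[|n] //.
exact: (congr1 (fun f => pcoef f n) e).
Qed.

(** The relation pi y_(n+1) + y_(n+1)^q = y_n is the n-th coefficient of sigma(Y) = (z - pi) Y. *)
Lemma in_tateP (y : nat -> Ksep) :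
  in_tate F jK y <-> y 0%N = 0 /\ sig (tseries y) = T * tseries y.
Proof.
have coef n : pcoef (T * tseries y) n =
    (if n is n'.+1 then y n'.+1 else 0) - p * y n.+1 by rewrite mulrC T_coef.
split=> [yt|[y0 ey]].
  have y0 : y 0%N = 0 := proj1 (yt 0%N).
  split=> //; apply: fpsP => n; rewrite coef sig_coef.
  have [_ e] := yt n; apply/eqP; rewrite eq_sym subr_eq addrC; apply/eqP.
  by rewrite -[RHS]/(cz (y n.+1)) e; case: n {e} => [|n].
have step n : cz (y n.+1) = y n.
  have := congr1 (fun f => pcoef f n) ey; rewrite coef sig_coef => /eqP.
  by rewrite eq_sym subr_eq addrC => /eqP e; rewrite -[LHS]/(_ + _) -e; case: n {e}.
move=> n; split=> //; elim: n => //= n IH.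
by rewrite -iterS iterSr step.
Qed.

Lemma iter_tate (y : nat -> Ksep) n i : in_tate F jK y -> (i <= n)%N -> iter i cz (y n) = y (n - i)%N.
Proof.
move=> yt; elim: i => [|i IH] le_in; first by rewrite subn0.
rewrite iterS IH ?(ltnW le_in) //; have [_ <-] := yt (n - i.+1)%N.
by rewrite -subSn.
Qed.

(** As z^i moves y_n to y_(n-i), the action of a is the Cauchy product of generating series. *)
Lemma tscale_series a (y : nat -> Ksep) : in_tate F jK y ->
  tscale a y 0%N = 0 /\ tseries (tscale a y) = hF a * tseries y.
Proof.
move=> yt; split; first by rewrite /tate_scale big_ord0.
apply: fpsP => n; rewrite pcoefM; apply: eq_bigr => i _.
rewrite iter_tate //; last by rewrite ltnW.
by rewrite subSn // -ltnS.
Qed.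

Lemma omega_series : tseries omega = x^-1.
Proof. exact: fpsP. Qed.

Lemma omega_tate : in_tate F jK omega.
Proof. by apply/in_tateP; split=> //; rewrite omega_series omega_eq. Qed.

Lemma tscale_omega a : tseries (tscale a omega) = hF a * x^-1.
Proof. by have [_ ->] := tscale_series a omega_tate; rewrite omega_series. Qed.

Lemma tscale0 a (y : nat -> Ksep) : tscale a y 0%N = 0.
Proof. by rewrite /tate_scale big_ord0. Qed.

Lemma tscale_tate a : in_tate F jK (tscale a omega).
Proof.
apply/in_tateP; rewrite tscale0 tscale_omega; split=> //.
by apply/dual_solutions; exists a.
Qed.

Lemma tate_lattice :
  rank1_lattice (in_tate F jK) (fun y y' n => y n + y' n) tscale
    (fun (g : galAut jK) y n => g (y n)) omega (fun g => chi (galV g)).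
Proof.
split.
- move=> v; split=> [vt|[a ->]]; last exact: tscale_tate.
  have [v0 /dual_solutions[a ea]] := proj1 (in_tateP v) vt.
  by exists a; apply: tseriesP; rewrite ?tscale0 // tscale_omega.
- move=> a b; apply: tseriesP; first by rewrite !tscale0 addr0.
  by rewrite tscale_omega rmorphD mulrDl -!tscale_omega; apply: fpsP.
- move=> a b; apply: tseriesP; first by rewrite !tscale0.
  have [_ ->] := tscale_series a (tscale_tate b).
  by rewrite !tscale_omega rmorphM /= mulrA.
- move=> a b /(congr1 tseries); rewrite !tscale_omega => /mulIr; rewrite unitrV => /(_ Ux).
  exact: hF_inj.
- move=> g a; apply: tseriesP; first by rewrite !tscale0 rmorph0.
  transitivity (fps_map g (tseries (tscale a omega))); first exact: fpsP.
  by rewrite !tscale_omega rmorphM rmorphM /= omega_gal gal_hF mulrCA mulrA.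
Qed.
End Lattices.

Theorem mainTheorem6 (F : finFieldType) (l : fieldType) (iota : {rmorphism F -> l})
    (Ksep : fieldType) (jK : {rmorphism laurent l -> Ksep}) (HKsep : is_sep_closure jK) :
  inhabited (Hdata iota) /\
  forall X : Hdata iota, inhabited (HPchoice X) /\
    forall c : HPchoice X,
      [/\ \dim {:Hdelta X} = 1%N,
          exists v : Hdelta X, basis_of {:Hdelta X} [:: v] /\ Dfrob v = zL l *: v
        & forall w : hpV (HdeltaHP c),
            hpP w <-> exists2 y : hpV (HdeltaHP c), hpQ y & w = tK l *: y] /\
      [/\ exists V : galRep F jK, is_assoc_rep iota (HdeltaHP c) V,
          exists W : galRep F jK, is_tate_rep iota W
        & forall V W : galRep F jK,
            is_assoc_rep iota (HdeltaHP c) V -> is_tate_rep iota W -> rep_iso V W].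
Proof.
split; first exact: (inhabits (modelH iota)).
move=> X; split; first exact: HPchoice_ex.
move=> c; split.
  split; first exact: D_dim; last exact: hpP_hpQ.
  exists (Dgen X); split; first exact: Dgen_basis.
  by rewrite -[Dgen X in LHS]scale1r Dfrob_scale rmorph1 mul1r.
(* One period x serves every shtuka and the Tate module, so both characters are expressed through
   the same [chi]. *)
have [x Ux ex] := period_ex iota HKsep.
have tate := tate_lattice Ux ex.
split.
- have [rC /(_ Ksep jK)[sol inj]] := shtuka_class (carlitz_hp_iso c).
  have [V0 V0P] := rational_ex (shtuka_lattice Ux ex sol inj).
  exists (dual_rep V0), (carlitzM l), ((tminus F l)^-1)%:M; split.
  + exact: carlitz_delta.
  + exact: carlitz_hp_iso.
  + by exists V0.
- exact: rational_ex tate.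
move=> V W [M [Delta [_ iso [V0 V0P ->]]]] WP.
have [rC /(_ Ksep jK)[sol inj]] := shtuka_class iso.
apply: rank1_dual_iso (rational_rank1 (shtuka_lattice Ux ex sol inj) V0P) _.
have := rational_rank1 tate WP; apply.
Qed.
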